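(* Let $X=(X_t)_{t\ge 0}$ be a subordinator with drift $b\ge 0$ and Lévy measure $\Pi$. (i) If $X$ is stochastically compact at $0$, i.e. $\limsup_{y\to 0+}\overline{\Pi}(y)/K_\Pi(y)<\infty$, then for each $t>0$ the law of $X_t$ admits a density, $\mathbb{P}(X_t\in dy)=f_t(y)\,dy$, $y\ge 0$, such that $f_t\in C^\infty(\mathbb{R})$. (ii) Assume that $X$ is stochastically compact at $0$, that $b<x/t<\mu$, and that one of the following two regimes holds: ($SC_0$-I) $t\to\infty$ and $x/t\to b$; ($SC_0$-II) $t\to 0$, $x/t\to b$, and moreover $$\frac{x-\mathbf{b}(t)}{c(t)}\to-\infty \ \text{ if (N) below fails},\qquad\text{or}\qquad \frac{x-bt}{c(t)}\to 0\ \text{ if (N) holds},$$ where (N) is the condition $$\limsup_{y\to 0}\frac{y\left(b+\int_0^y z\,\Pi(dz)\right)}{\int_0^y z^2\,\Pi(dz)}<\infty .$$ Then, with $\rho_t=\rho(x/t)$ and $\phi$ the standard normal density, $$\sqrt{t}\,\sigma(\rho_t)\,f_t(z)=\left(\phi\!\left(\frac{z-x}{\sqrt{t}\,\sigma(\rho_t)}\right)+o(1)\right)e^{-tH(\rho_t)}e^{\rho_t(z-x)},$$ where the $o(1)$ term is uniform in $z>0$ and in $x$.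
   Context: $X$ is a subordinator (non-decreasing càdlàg process with stationary independent increments, $X_0=0$) with Laplace exponent $\psi(\lambda)=-\frac1t\log\mathbb{E}(e^{-\lambda X_t})=b\lambda+\int_{(0,\infty)}(1-e^{-\lambda x})\,\Pi(dx)$, $\lambda\ge 0$, where $b\ge0$ is the drift and $\Pi$ the Lévy measure. Put $\mu:=\mathbb{E}(X_1)=\psi'(0+)\in(0,\infty]$; also $b=\psi'(\infty)$. For $b<s<\mu$, $\rho(s)>0$ is the unique solution of $\psi'(\rho(s))=s$; for $b<x/t<\mu$ write $\rho_t:=\rho(x/t)$. For $u>0$: $H(u)=\psi(u)-u\psi'(u)$ and $\sigma^2(u)=\int_0^\infty y^2e^{-uy}\,\Pi(dy)$, $\sigma(u)=\sqrt{\sigma^2(u)}$. For $x>0$: $\overline{\Pi}(x)=\Pi(x,\infty)$, $K_\Pi(x)=x^{-2}\int_{y\in(0,x)}y^2\,\Pi(dy)$, and $Q_\Pi(z)=2z^{-2}\int_0^z y\overline{\Pi}(y)\,dy$. The function $c$ is defined by $tQ_\Pi(c(t))=1$, and $\mathbf{b}(t)=t\left(b+\int_0^{c(t)}y\,\Pi(dy)\right)$. Uniformity in $x$: here $x$ depends on $t$, and ''$o(1)$ uniformly in $x$'' means that if $A_t$ are sets of admissible values of $x$ such that the convergences defining the regime hold uniformly over $x\in A_t$, then the supremum of $|o(1)|$ over $x\in A_t$ (and over $z>0$) tends to $0$ in the regime's limit in $t$; equivalently, the estimate holds along every choice $x=x(t)$ satisfying the regime. *)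

(* Defs.v *)
From HB Require Import structures.
From mathcomp Require Import all_boot all_order all_algebra.
From mathcomp Require Import all_classical all_reals all_analysis.
Import Order.TTheory GRing.Theory Num.Theory.
Import numFieldNormedType.Exports.

Set Implicit Arguments.
Unset Strict Implicit.
Unset Printing Implicit Defensive.

Local Open Scope classical_set_scope.
Local Open Scope ring_scope.

Section Subordinator.
Context d (T : measurableType d) (R : realType) (P : probability T R).

Definition mutually_independent (n : nat) (Y : nat -> T -> R) : Prop :=
  forall B : nat -> set R, (forall i, measurable (B i)) ->
    P (\bigcap_(i in `I_n) (Y i @^-1` B i)) =
    (\prod_(i < n) P (Y i @^-1` B i))%E.

(* The time set is [0, +oo[ : the values of X at negative times are junk, and
   no condition is put on them. *)
Record subordinator (X : R -> {RV P >-> R}) : Prop := Subordinator {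
  sub_start : {ae P, forall w, X 0 w = 0} ;
  sub_nondecreasing :
    {ae P, forall w, forall s t : R, 0 <= s -> s <= t -> X s w <= X t w} ;
  sub_right_continuous :
    {ae P, forall w, forall t : R, 0 <= t -> X s w @[s --> t^'+] --> X t w} ;
  sub_left_limits :
    {ae P, forall w, forall t : R, 0 < t -> cvg (X s w @[s --> t^'-])} ;
  sub_stationary : forall s t : R, 0 <= s -> 0 <= t ->
    forall B : set R, measurable B ->
      P [set w | B (X (s + t) w - X s w)] = P (X t @^-1` B) ;
  sub_independent : forall (n : nat) (t : nat -> R), 0 <= t 0%N ->
    (forall i, t i <= t i.+1) ->
    mutually_independent n (fun i w => X (t i.+1) w - X (t i) w) }.

Definition laplace_exponent (X : R -> {RV P >-> R}) (t u : R) : R :=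
  - t^-1 * ln (fine 'E_P[fun w => expR (- u * X t w)]).

Definition smooth (f : R -> R) : Prop :=
  forall (n : nat) (y : R), derivable (derive1n n f) y 1.

Definition is_density (f : R -> R) (Y : {RV P >-> R}) : Prop :=
  (forall y, 0 <= f y) /\
  forall B : set R, measurable B ->
    distribution P Y B = (\int[lebesgue_measure]_(y in B) (f y)%:E)%E.

End Subordinator.

Section LevyMeasure.
Context (R : realType).

(* A measure on ]0, +oo[ is represented by a measure on R that does not charge
   ]-oo, 0]; the integrability condition is the usual one for subordinators,
   and makes the real-valued integrals below finite (where u > 0). *)
Definition levy_measure (Pi : {measure set R -> \bar R}) : Prop :=
  Pi (`]-oo, 0]%classic) = 0%E /\
  (\int[Pi]_(y in `]0%R, +oo[%classic) (Num.min 1 y)%:E < +oo)%E.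

Variables (b : R) (Pi : {measure set R -> \bar R}).

Definition psi (u : R) : R :=
  b * u + \int[Pi]_(y in `]0, +oo[) (1 - expR (- (u * y))).

Definition rho (s : R) : R :=
  xget 0 [set u : R | 0 < u /\ derive1 psi u = s].

Definition Hfun (u : R) : R := psi u - u * derive1 psi u.

Definition sigma2 (u : R) : R :=
  \int[Pi]_(y in `]0, +oo[) (y ^+ 2 * expR (- (u * y))).

Definition sigma (u : R) : R := Num.sqrt (sigma2 u).

Definition Pibar (x : R) : R := fine (Pi (`]x, +oo[%classic)).

Definition KPi (x : R) : R := x ^- 2 * \int[Pi]_(y in `]0, x[) (y ^+ 2).

Definition QPi (z : R) : R :=
  2 * z ^- 2 * \int[lebesgue_measure]_(y in `]0, z[) (y * Pibar y).

Definition cfun (t : R) : R := xget 0 [set z : R | 0 < z /\ t * QPi z = 1].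

Definition bfun (t : R) : R := t * (b + \int[Pi]_(y in `]0, cfun t[) y).

(* In Rocq x / 0 = 0, so the first clause is needed for the quotient to have its
   mathematical meaning: without it a measure Pi that vanishes near 0 would
   satisfy the limsup condition. *)
Definition stochastically_compact0 : Prop :=
  (forall y : R, 0 < y -> 0 < KPi y) /\
  (limf_esup (fun y => (Pibar y / KPi y)%:E) 0^'+ < +oo)%E.

(* Only used under stochastic compactness at 0, so that the denominator is
   positive. *)
Definition condN : Prop :=
  (limf_esup (fun y : R => (y * (b + \int[Pi]_(z in `]0, y[) z) /
                            \int[Pi]_(z in `]0, y[) (z ^+ 2))%:E) 0^'+
   < +oo)%E.

(* g t i tends to G as t goes along F, uniformly over i in A t. *)
Definition unif_cvg (I : Type) (F : set_system R) (A : R -> set I)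
    (g : R -> I -> R) (G : set_system R) : Prop :=
  forall U : set R, G U -> \forall t \near F, forall i, A t i -> U (g t i).

Definition SC0_I (A : R -> set R) : Prop :=
  unif_cvg (pinfty_nbhs R) A (fun t x => x / t) (nbhs b).

Definition SC0_II (A : R -> set R) : Prop :=
  unif_cvg 0^'+ A (fun t x => x / t) (nbhs b) /\
  ((~ condN /\
    unif_cvg 0^'+ A (fun t x => (x - bfun t) / cfun t) (ninfty_nbhs R)) \/
   (condN /\
    unif_cvg 0^'+ A (fun t x => (x - b * t) / cfun t) (nbhs (0 : R)))).

(* r is the o(1) term, uniform over x in A t and z > 0 as t goes along F. *)
Definition local_estimate (f : R -> R -> R) (F : set_system R)
    (A : R -> set R) : Prop :=
  exists r : R -> R * R -> R,
    unif_cvg F (fun t => A t `*` [set z | 0 < z]) r (nbhs (0 : R)) /\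
    forall t x z : R, 0 < t -> A t x -> 0 < z ->
      let rt := rho (x / t) in
      Num.sqrt t * sigma rt * f t z =
      (normal_pdf 0 1 ((z - x) / (Num.sqrt t * sigma rt)) + r t (x, z)) *
      expR (- (t * Hfun rt)) * expR (rt * (z - x)).

End LevyMeasure.

(* Main.v *)
From HB Require Import structures.
From mathcomp Require Import all_boot all_order all_algebra ring lra.
From mathcomp Require Import all_classical all_reals all_analysis measurable_realfun.
Require Import Defs.
Import Order.TTheory GRing.Theory Num.Theory.
Import numFieldNormedType.Exports.

Set Implicit Arguments.
Unset Strict Implicit.
Unset Printing Implicit Defensive.

Local Open Scope classical_set_scope.
Local Open Scope ring_scope.

(* Write m for the law of X_t and tilt it by exp(-ux), where u = rho(x/t) makes
   x the mean. The Laplace transform is known only on the half-line u >= 0; it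
   determines the identity x m(dx) = t (b delta_0 + y Pi(dy)) * m (polynomials in
   exp(-hx) approximate test functions), and this identity, read on the
   vertical line through u, is a differential equation in v which gives
   int exp(-(u - iv)x) m(dx) = exp(-t psi(u - iv)).
   Stochastic compactness bounds the truncated second moments
   int min(y,z)^2 Pi(dy) by C int_(0,z) y^2 Pi(dy), so that the modulus of this
   transform decays faster than any power of v: Fourier inversion yields a
   smooth density. At scale s = sqrt t sigma(u), a Taylor expansion of
   the exponent compares the transform with that of the normal law, with an
   error of order 1/(s u). Here (s u)^2 is comparable to t Q(1/u), which tends to
   infinity in each of the two regimes. *)

(** All integrals are real: [psi (u - iv)] is carried by the pair [alpha], [beta], and the transform
    by its cosine and sine parts on v >= 0. The double integral over v and x behind the inversion
    formula does not converge absolutely. A factor exp(-ev) turns the integral over v into a Poisson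
    kernel, and e tends to 0 in a primitive of the tilted law, [tilted_sign], not in a density whose
    existence is still unknown. The tilt u depends on x while the law of X_t does not. Continuous
    densities being unique, the given [f t] equals [tilted_density] for every u > 0, in particular
    at the saddlepoint; undoing that tilt leaves the factors exp(-tH) and exp(rho(z - x)).
    Uniformity comes from an explicit bound: [local_error] depends on t and u only through s u, and
    not on z, so a regime has only to make t Q(1/u) large uniformly over [A t]. For t at infinity,
    Q(1/u) stays above a positive constant. For t at 0, t Q(c(t)) = 1 and u c(t) is large; the power
    growth of Q towards 0, a consequence of compactness, transfers this to 1/u. *)

Section Calculus.
Context {R : realType}.
Implicit Types (f g : R -> R) (x y a b : R).

Lemma is_derive_add f g x a b : is_derive x 1 f a -> is_derive x 1 g b ->
  is_derive x 1 (fun y => f y + g y) (a + b).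
Proof. by move=> ? ?; exact: is_deriveD. Qed.

Lemma is_derive_sub f g x a b : is_derive x 1 f a -> is_derive x 1 g b ->
  is_derive x 1 (fun y => f y - g y) (a - b).
Proof. by move=> ? ?; exact: is_deriveB. Qed.

Lemma is_derive_opp f x a : is_derive x 1 f a ->
  is_derive x 1 (fun y => - f y) (- a).
Proof. by move=> ?; exact: is_deriveN. Qed.

Lemma is_derive_mul f g x a b : is_derive x 1 f a -> is_derive x 1 g b ->
  is_derive x 1 (fun y => f y * g y) (a * g x + f x * b).
Proof.
by move=> ? ?; apply: is_derive_eq; rewrite addrC mulrC; congr (_ + _); exact: mulrC.
Qed.

Lemma is_derive_pow f n x a : is_derive x 1 f a ->
  is_derive x 1 (fun y => f y ^+ n.+1) (n.+1%:R * f x ^+ n * a).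
Proof.
move=> fa; have -> : (fun y => f y ^+ n.+1) = f ^+ n.+1 by rewrite exprfctE.
exact: is_deriveX.
Qed.

Lemma is_derive_idfun x : is_derive x 1 (fun y => y) 1.
Proof. exact: is_derive_id. Qed.

Lemma is_derive_const (c : R) x : is_derive x 1 (fun=> c) 0.
Proof. exact: is_derive_cst. Qed.

Lemma is_derive_expf f x a : is_derive x 1 f a ->
  is_derive x 1 (fun y => expR (f y)) (a * expR (f x)).
Proof.
by move=> ?; apply: (is_derive_eq (is_derive1_comp _ _)); rewrite mulrC.
Qed.

Lemma is_derive_cosf f x a : is_derive x 1 f a ->
  is_derive x 1 (fun y => cos (f y)) (- (a * sin (f x))).
Proof.
by move=> ?; apply: (is_derive_eq (is_derive1_comp _ _)); rewrite mulNr mulrC.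
Qed.

Lemma is_derive_sinf f x a : is_derive x 1 f a ->
  is_derive x 1 (fun y => sin (f y)) (a * cos (f x)).
Proof.
by move=> ?; apply: (is_derive_eq (is_derive1_comp _ _)); rewrite mulrC.
Qed.

Lemma is_derive_continuous f x a : is_derive x 1 f a -> {for x, continuous f}.
Proof.
by move=> fa; apply/differentiable_continuous/derivable1_diffP; exact: ex_derive.
Qed.

Lemma is_derive_all_continuous f g : (forall x, is_derive x 1 f (g x)) ->
  continuous f.
Proof. by move=> h x; exact: is_derive_continuous (h x). Qed.

Lemma is_derive_derive1 f x a : is_derive x 1 f a -> derive1 f x = a.
Proof. by move=> fa; rewrite derive1E; exact: derive_val. Qed.

Lemma mean_value f g a b : a <= b ->
  (forall x, a <= x <= b -> is_derive x 1 f (g x)) ->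
  exists2 c, a <= c <= b & f b - f a = g c * (b - a).
Proof.
move=> ab fg.
have [c cab ->] : exists2 c, c \in `[a, b] & f b - f a = g c * (b - a).
  apply: MVT_segment => //.
  - by move=> x xab; apply: fg; move: xab; rewrite in_itv/= => /andP[/ltW-> /ltW->].
  - apply: derivable_within_continuous => x xab.
    have := fg x; rewrite in_itv/= in xab; move=> /(_ xab) h; exact: ex_derive.
by exists c; [rewrite in_itv in cab|].
Qed.

Lemma derive_ge0_le f g a b : a <= b ->
  (forall x, a <= x <= b -> is_derive x 1 f (g x)) ->
  (forall x, a <= x <= b -> 0 <= g x) -> f a <= f b.
Proof.
move=> ab fg g0; have [c cab h] := mean_value ab fg.
by rewrite -subr_ge0 h mulr_ge0 ?g0// subr_ge0.
Qed.

Lemma derive_ge0_ge0 f g x : 0 <= x -> f 0 = 0 ->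
  (forall y, 0 <= y -> is_derive y 1 f (g y)) ->
  (forall y, 0 <= y -> 0 <= g y) -> 0 <= f x.
Proof.
move=> x0 f0 fg g0; rewrite -f0; apply: (@derive_ge0_le f g) => // y /andP[y0 _].
  exact: fg.
exact: g0.
Qed.

Lemma derive_bounded_lipschitz f g (K : R) : (forall x, is_derive x 1 f (g x)) ->
  (forall x, `|g x| <= K) -> forall a b, `|f b - f a| <= K * `|b - a|.
Proof.
move=> fg gK a b; wlog ab : a b / a <= b.
  move=> wl; have [/wl//|/ltW/wl h] := leP a b.
  by rewrite distrC (distrC b).
have [c _ ->] := mean_value ab (fun x _ => fg x).
by rewrite normrM ler_wpM2r.
Qed.

(** Made for functions known only as limits or through bounds on their increments ([tilted_sign],
    the distribution function), to which no rule of differentiation applies. *)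
Lemma is_derive_quad_near f x (l K : R) :
  (forall h, `|h| <= 1 -> `|f (x + h) - f x - h * l| <= K * h ^+ 2) ->
  is_derive x 1 f l.
Proof.
move=> fK; have K0 : 0 <= K.
  by have := fK 1; rewrite normr1 expr1n mulr1 => /(_ (lexx _)); exact: le_trans.
have cv : (h^-1 *: (f (h *: 1 + x) - f x)) @[h --> 0^'] --> l.
  apply/cvgrPdist_le => e e0; near=> h.
  have h0 : h != 0 by near: h; exact: nbhs_dnbhs_neq.
  have hn : 0 < `|h| by rewrite normr_gt0.
  rewrite /GRing.scale /= mulr1 (addrC h) -(ler_pM2l hn) -normrM mulrBr mulrA.
  rewrite divff// mul1r distrC (le_trans (fK h _))//.
    by near: h; apply: dnbhs0_le.
  rewrite -real_normK ?num_real// expr2 mulrA mulrC; apply: ler_wpM2l => //.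
  have : `|h| <= e / (K + 1).
    by near: h; apply: dnbhs0_le; rewrite divr_gt0// ltr_wpDl.
  rewrite ler_pdivlMr ?ltr_wpDl// => /(le_trans _); apply.
  by rewrite mulrC ler_wpM2l// lerDl.
apply: DeriveDef; first by apply/cvg_ex; exists l.
exact/cvg_lim.
Unshelve. all: by end_near. Qed.

(** The bound is asked only within distance [|b - a|] of a. Applied to f minus its linear part, with
    K proportional to that distance, it yields a quadratic remainder. *)
Lemma segment_lipschitz f g (K a b : R) :
  (forall x, `|x - a| <= `|b - a| -> is_derive x 1 f (g x)) ->
  (forall x, `|x - a| <= `|b - a| -> `|g x| <= K) -> `|f b - f a| <= K * `|b - a|.
Proof.
move=> fg gK; have [ab|/ltW ba] := leP a b.
  have sub x : a <= x <= b -> `|x - a| <= `|b - a|.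
    by move=> /andP[ax xb]; rewrite !ger0_norm ?subr_ge0 ?lerD2r.
  have [c cab ->] := mean_value ab (fun x xab => fg x (sub x xab)).
  by rewrite normrM ler_wpM2r ?gK// sub.
have sub x : b <= x <= a -> `|x - a| <= `|b - a|.
  by move=> /andP[ax xb]; rewrite !ler0_norm ?subr_le0// !opprB lerD2l lerN2.
have [c cab h] := mean_value ba (fun x xab => fg x (sub x xab)).
by rewrite distrC h normrM (distrC b) ler_wpM2r ?gK// sub.
Qed.

End Calculus.

(* [apply:] would let type class resolution discharge the premises, with
   derivatives in an unwieldy form. *)
Ltac derive_step :=
  first [ notypeclasses refine (is_derive_const _ _)
        | notypeclasses refine (is_derive_idfun _)
        | notypeclasses refine (is_derive_expf _)
        | notypeclasses refine (is_derive_cosf _)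
        | notypeclasses refine (is_derive_sinf _)
        | notypeclasses refine (is_derive_pow _ _)
        | notypeclasses refine (is_derive_opp _)
        | notypeclasses refine (is_derive_sub _ _)
        | notypeclasses refine (is_derive_add _ _)
        | notypeclasses refine (is_derive_mul _ _) ].
Ltac derives :=
  notypeclasses refine (is_derive_eq _ _); [by repeat derive_step|cbv beta; rewrite ?[id _]/id].

(** * Trigonometric and exponential inequalities *)

Section Elementary.
Context {R : realType}.
Implicit Types (x y a b : R).

Lemma cos_lipschitz a b : `|cos b - cos a| <= `|b - a|.
Proof.
rewrite -[leRHS]mul1r; apply: (@derive_bounded_lipschitz _ cos (fun x => - sin x)).
by move=> x; rewrite normrN sin_max.
Qed.

Lemma sin_lipschitz a b : `|sin b - sin a| <= `|b - a|.
Proof.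
rewrite -[leRHS]mul1r; apply: (@derive_bounded_lipschitz _ sin cos).
exact: cos_max.
Qed.

Lemma norm_sin_le x : `|sin x| <= `|x|.
Proof. by have := sin_lipschitz 0 x; rewrite sin0 !subr0. Qed.

(** First of three bounds, each obtained by integrating the previous one from 0: [norm_sin_le] gives
    this one, which gives the cubic bound for the sine, then the quartic one for the cosine. *)
Lemma cos_ge_quad x : 0 <= x -> 1 - cos x <= x ^+ 2 / 2.
Proof.
move=> x0; rewrite -subr_ge0.
apply: (@derive_ge0_ge0 _ (fun y : R => y ^+ 2 / 2 - (1 - cos y)) (fun y => y - sin y)) => //.
  by rewrite cos0; field.
  by move=> y _; derives; field.
move=> y y0; rewrite subr_ge0.
by have := norm_sin_le y; rewrite (ger0_norm y0) ler_norml => /andP[].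
Qed.

Lemma sin_ge_cubic x : 0 <= x -> x - sin x <= x ^+ 3 / 6.
Proof.
move=> x0; rewrite -subr_ge0.
apply: (@derive_ge0_ge0 _ (fun y : R => y ^+ 3 / 6 - (y - sin y)) (fun y : R => y ^+ 2 / 2 - (1 - cos y))) => //.
  by rewrite sin0; field.
  by move=> y _; derives; field.
by move=> y y0; rewrite subr_ge0 cos_ge_quad.
Qed.

Lemma cos_le_quartic x : 0 <= x -> x ^+ 2 / 2 - (1 - cos x) <= x ^+ 4 / 24.
Proof.
move=> x0; rewrite -subr_ge0.
apply: (@derive_ge0_ge0 _ (fun y : R => y ^+ 4 / 24 - (y ^+ 2 / 2 - (1 - cos y))) (fun y : R => y ^+ 3 / 6 - (y - sin y))) => //.
  by rewrite cos0; field.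
  by move=> y _; derives; field.
by move=> y y0; rewrite subr_ge0 sin_ge_cubic.
Qed.

Lemma onem_cos_ge x : 0 <= x -> x <= 1 -> x ^+ 2 / 8 <= 1 - cos x.
Proof.
move=> x0 x1; have := cos_le_quartic x0.
have x2 : x ^+ 2 <= 1 by rewrite exprn_ile1.
have x20 : 0 <= x ^+ 2 by rewrite exprn_ge0.
have -> : x ^+ 4 = x ^+ 2 * x ^+ 2 by ring.
by move=> h; nra.
Qed.

(** The quartic bound serves up to 1; beyond, [1 - cos x] is nonnegative and the quadratic term is
    itself below [x ^+ 3]. A cubic error on the whole half-line can be integrated against the third
    tilted moment. *)
Lemma cos_taylor2 x : 0 <= x -> `|1 - cos x - x ^+ 2 / 2| <= x ^+ 3.
Proof.
move=> x0; rewrite ler_norml; have h1 := cos_ge_quad x0.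
have h2 := cos_le_quartic x0; have x3 : 0 <= x ^+ 3 by rewrite exprn_ge0.
apply/andP; split; last lra.
have [x1|x1] := leP x 1.
  have : x ^+ 4 <= x ^+ 3 by rewrite exprS ler_piMl.
  lra.
have : x ^+ 2 <= x ^+ 3 by rewrite [leRHS]exprS ler_peMl ?exprn_ge0// ltW.
have := cos_le1 x; lra.
Qed.

Lemma sin_taylor1 x : 0 <= x -> `|sin x - x| <= x ^+ 3.
Proof.
move=> x0; rewrite ler_norml; have h1 := sin_ge_cubic x0.
have := norm_sin_le x; rewrite (ger0_norm x0) ler_norml => /andP[_ h2].
have x3 : 0 <= x ^+ 3 by rewrite exprn_ge0.
lra.
Qed.

Lemma expRN_le1 x : 0 <= x -> expR (- x) <= 1.
Proof. by move=> x0; rewrite expR_le1 oppr_le0. Qed.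

Lemma onem_expRN_le x : 1 - expR (- x) <= x.
Proof. by have := expR_ge1Dx (- x); lra. Qed.

Lemma expRN_lipschitz a b : 0 <= a -> 0 <= b ->
  `|expR (- a) - expR (- b)| <= `|a - b|.
Proof.
wlog ab : a b / a <= b.
  move=> wl a0 b0; have [/wl|/ltW/wl] := leP a b; first exact.
  by rewrite distrC (distrC a); exact.
move=> a0 b0; have -> : `|a - b| = b - a by rewrite ler0_norm ?opprB// subr_le0.
rewrite ger0_norm ?subr_ge0 ?ler_expR ?lerN2//.
have -> : expR (- a) - expR (- b) = expR (- a) * (1 - expR (- (b - a))).
  by rewrite mulrBr mulr1 -expRD; congr (_ - expR _); ring.
apply: le_trans (onem_expRN_le _); rewrite ler_piMl ?expRN_le1//.
by rewrite subr_ge0 expRN_le1// subr_ge0.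
Qed.

Lemma pow_expRN_le n x : 0 <= x -> x ^+ n * expR (- x) <= n`!%:R.
Proof.
move=> x0; rewrite expRN ler_pdivrMr ?expR_gt0//.
case: n => [|n]; first by rewrite fact0 expr0 mul1r -expR0 ler_expR.
have := expR_ge1Dxn n x0.
have f0 : 0 < n.+1`!%:R :> R by rewrite ltr0n fact_gt0.
move=> h; have : x ^+ n.+1 / n.+1`!%:R <= expR x by apply: le_trans h; rewrite lerDr.
by rewrite ler_pdivrMr// mulrC.
Qed.

(* The two regimes of [x] are separated by a power [k <= n]. *)
Lemma pow_expRN_min n k x : (k <= n)%N -> 0 <= x ->
  x ^+ n * expR (- x) <= n`!%:R * Num.min x 1 ^+ k.
Proof.
move=> kn x0; have [x1|x1] := leP x 1; last first.
  by rewrite expr1n mulr1 pow_expRN_le.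
have f1 : 1 <= n`!%:R :> R by rewrite ler1n fact_gt0.
apply: (@le_trans _ _ (x ^+ k)); last by rewrite ler_peMl ?exprn_ge0.
apply: (@le_trans _ _ (x ^+ n)); first by rewrite ler_piMr ?exprn_ge0 ?expRN_le1.
exact: ler_wiXn2l.
Qed.

(** The modulus of exp(-a - ic) is at most 1 for a >= 0, so two transforms can be compared through
    their exponents alone. *)
Lemma exp_cos_lipschitz a a' c c' : 0 <= a -> 0 <= a' ->
  `|expR (- a) * cos c - expR (- a') * cos c'| <= `|a - a'| + `|c - c'|.
Proof.
move=> a0 a'0.
have -> : expR (- a) * cos c - expR (- a') * cos c' =
  (expR (- a) - expR (- a')) * cos c + expR (- a') * (cos c - cos c') by ring.
apply: (le_trans (ler_normD _ _)); apply: lerD; rewrite normrM.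
  rewrite -[leRHS]mulr1; apply: ler_pM => //; first exact: expRN_lipschitz.
  exact: cos_max.
rewrite -[leRHS]mul1r; apply: ler_pM => //; last exact: cos_lipschitz.
by rewrite ger0_norm ?expR_ge0 ?expRN_le1.
Qed.

End Elementary.

(** * Measurability and real-valued integrals *)

Section MeasurableOps.
Context d (T : measurableType d) (R : realType).
Implicit Types (D : set T) (f g : T -> R).

Lemma measurable_cosf D f : measurable_fun D f -> measurable_fun D (fun x => cos (f x)).
Proof.
move=> mf; apply: (@measurableT_comp _ _ _ _ _ _ (@cos R)) => //.
exact: (continuous_measurable_fun (@continuous_cos R)).
Qed.

Lemma measurable_sinf D f : measurable_fun D f -> measurable_fun D (fun x => sin (f x)).
Proof.
move=> mf; apply: (@measurableT_comp _ _ _ _ _ _ (@sin R)) => //.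
exact: (continuous_measurable_fun (@continuous_sin R)).
Qed.

Lemma measurable_expf D f : measurable_fun D f -> measurable_fun D (fun x => expR (f x)).
Proof. by move=> mf; apply: (@measurableT_comp _ _ _ _ _ _ (@expR R)). Qed.

Lemma measurable_oppf D f : measurable_fun D f -> measurable_fun D (fun x => - f x).
Proof. by move=> mf; apply: (@measurableT_comp _ _ _ _ _ _ (@GRing.opp R)). Qed.

Lemma measurable_minf D f g : measurable_fun D f -> measurable_fun D g ->
  measurable_fun D (fun x => Num.min (f x) (g x)).
Proof. by move=> mf mg; exact: measurable_minr. Qed.

End MeasurableOps.

Ltac measurability := repeat
  first [ exact: measurable_cst | exact: measurable_id | assumption
        | apply: measurable_expf | apply: measurable_cosf | apply: measurable_sinf
        | apply: measurable_oppf | apply: measurable_funB | apply: measurable_funD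
        | apply: measurable_funX | apply: measurable_minf | apply: measurable_funM ].

Section RealIntegrals.
Context d (T : measurableType d) (R : realType) (mu : {measure set T -> \bar R}).
Implicit Types (D : set T) (f g : T -> R).

Lemma integrable_le D f g : measurable D -> measurable_fun D f ->
  mu.-integrable D (EFin \o g) -> (forall x, D x -> `|f x| <= g x) ->
  mu.-integrable D (EFin \o f).
Proof.
move=> mD mf ig fg; apply: le_integrable ig => //; first exact/measurable_EFinP.
by move=> x Dx /=; rewrite lee_fin (le_trans (fg _ Dx))// ler_norm.
Qed.

Lemma integrable_measurable D f : mu.-integrable D (EFin \o f) -> measurable_fun D f.
Proof. by move/measurable_int/measurable_EFinP. Qed.

Lemma integrable_scale D f (c : R) : measurable D -> mu.-integrable D (EFin \o f) ->
  mu.-integrable D (EFin \o (fun x => c * f x)).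
Proof.
move=> mD fi; have := integrableZl mD c fi.
by apply: eq_integrable => // x _ /=; rewrite EFinM.
Qed.

Lemma integrable_sub D f g : measurable D -> mu.-integrable D (EFin \o f) ->
  mu.-integrable D (EFin \o g) -> mu.-integrable D (EFin \o (fun x => f x - g x)).
Proof.
move=> mD fi gi; have := integrableB mD fi gi.
by apply: eq_integrable => // x _ /=; rewrite EFinB.
Qed.

Lemma integrable_add D f g : measurable D -> mu.-integrable D (EFin \o f) ->
  mu.-integrable D (EFin \o g) -> mu.-integrable D (EFin \o (fun x => f x + g x)).
Proof.
move=> mD fi gi; have := integrableD mD fi gi.
by apply: eq_integrable => // x _ /=; rewrite EFinD.
Qed.

Lemma Rintegral_subset A D f : measurable A -> measurable D -> A `<=` D ->
  mu.-integrable D (EFin \o f) -> (forall x, D x -> 0 <= f x) ->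
  \int[mu]_(x in A) f x <= \int[mu]_(x in D) f x.
Proof.
move=> mA mD AD fi f0; have fA := integrableS mD mA AD fi.
rewrite /Rintegral fine_le ?integrable_fin_num//; apply: ge0_subset_integral => //.
exact: measurable_int fi.
Qed.

Lemma Rintegral_norm_le D f g : measurable D -> measurable_fun D f ->
  mu.-integrable D (EFin \o g) -> (forall x, D x -> `|f x| <= g x) ->
  `|\int[mu]_(x in D) f x| <= \int[mu]_(x in D) g x.
Proof.
move=> mD mf gi fg; have fi := integrable_le mD mf gi fg.
apply: (le_trans (le_normr_Rintegral mD fi)); apply: le_Rintegral => //.
have := integrable_abse fi; by apply: eq_integrable.
Qed.

Lemma Rintegral_dist_le D f g h : measurable D -> mu.-integrable D (EFin \o f) ->
  mu.-integrable D (EFin \o g) -> mu.-integrable D (EFin \o h) ->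
  (forall x, D x -> `|f x - g x| <= h x) ->
  `|\int[mu]_(x in D) f x - \int[mu]_(x in D) g x| <= \int[mu]_(x in D) h x.
Proof.
move=> mD fi gi hi fg; rewrite -RintegralB//.
apply: Rintegral_norm_le => //.
exact/integrable_measurable/integrable_sub.
Qed.

Lemma dominated_cvg_Rintegral D (f_ : nat -> T -> R) f g : measurable D ->
  (forall n, measurable_fun D (f_ n)) ->
  (forall x, D x -> (fun n => f_ n x) @ \oo --> f x) ->
  mu.-integrable D (EFin \o g) ->
  (forall n x, D x -> `|f_ n x| <= g x) ->
  (fun n => \int[mu]_(x in D) f_ n x) @ \oo --> \int[mu]_(x in D) f x.
Proof.
move=> mD mf_ ff ig fg.
have mf : measurable_fun D f.
  by apply: (@measurable_fun_cvg _ _ _ D f_) => // x Dx; exact: ff.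
have fle x : D x -> `|f x| <= g x.
  move=> Dx; apply: (ler_cvg_to (cvg_norm (ff x Dx)) (cvg_cst (g x))).
  by apply: nearW => n; exact: fg.
apply: fine_cvg; rewrite fineK; last first.
  by apply: integrable_fin_num => //; exact: integrable_le fle.
apply: (@dominated_cvg _ _ _ mu _ mD (fun n x => (f_ n x)%:E) _ (EFin \o g)) => //.
- by move=> n; exact/measurable_EFinP.
- by move=> x Dx; apply: cvg_EFin; [exact: nearW|exact: ff].
Unshelve. all: by end_near. Qed.

Lemma is_derive_Rintegral D (f df : R -> T -> R) (G : T -> R) (u v a : R) :
  measurable D -> u < a < v ->
  (forall x, u < x < v -> mu.-integrable D (EFin \o f x)) ->
  (forall x y, u < x < v -> D y -> is_derive x 1 (f ^~ y) (df x y)) ->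
  mu.-integrable D (EFin \o G) ->
  (forall x y, u < x < v -> D y -> `|df x y| <= G y) ->
  is_derive a 1 (fun x => \int[mu]_(y in D) f x y) (\int[mu]_(y in D) df a y).
Proof.
move=> mD ua fi fd Gi dG.
have Ia : `]u, v[%classic a by rewrite /= in_itv/=.
have Iu x : `]u, v[%classic x -> u < x < v by rewrite /= in_itv.
have p1 x y : u < x < v -> D y -> partial1of2 f x y = df x y.
  by move=> xI Dy; exact/is_derive_derive1/fd.
(* [G] bounds a norm on [D] only, so its sign elsewhere is unknown; its absolute value is
   nonnegative everywhere. *)
have G'0 y : 0 <= `|G y| by [].
have G'i : mu.-integrable D (EFin \o (fun y => `|G y|)).
  by have := integrable_abse Gi; apply: eq_integrable.
have G'b x y : `]u, v[%classic x -> D y -> `|partial1of2 f x y| <= `|G y|.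
  by move=> /Iu xI Dy; rewrite p1// (le_trans (dG _ _ xI Dy))// ler_norm.
have fi' x : `]u, v[%classic x -> mu.-integrable D (EFin \o f x) by move=> /Iu; exact: fi.
have fd' x y : `]u, v[%classic x -> D y -> derivable (f^~ y) x 1.
  by move=> /Iu xI Dy; have h := fd _ _ xI Dy; exact: ex_derive.
have -> : \int[mu]_(y in D) df a y = \int[mu]_(y in D) partial1of2 f a y.
  by apply: eq_Rintegral => y /set_mem Dy; rewrite p1.
apply: DeriveDef.
  exact: (@derivable_under_integral _ _ _ mu f D mD a u v Ia fi' fd' _ G'0 G'i G'b).
rewrite -derive1E.
exact: (@differentiation_under_integral _ _ _ mu f D mD a u v Ia fi' fd' _ G'0 G'i G'b).
Qed.

End RealIntegrals.

(** * Integrals against the Levy measure *)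

Section LevyIntegrals.
Context {R : realType} (b : R) (Pi : {measure set R -> \bar R}).

Definition dpsi (u : R) : R := b + \int[Pi]_(y in `]0, +oo[) (y * expR (- (u * y))).

(* [psi (u - iv) = psi u + alpha u v - i beta u v]. *)
Definition alpha (u v : R) : R :=
  \int[Pi]_(y in `]0, +oo[) (expR (- (u * y)) * (1 - cos (v * y))).

Definition beta (u v : R) : R :=
  b * v + \int[Pi]_(y in `]0, +oo[) (expR (- (u * y)) * sin (v * y)).

Definition dalpha (u v : R) : R :=
  \int[Pi]_(y in `]0, +oo[) (y * expR (- (u * y)) * sin (v * y)).

Definition dbeta (u v : R) : R :=
  b + \int[Pi]_(y in `]0, +oo[) (y * expR (- (u * y)) * cos (v * y)).

(** For z > 0 this is [z ^+ 2 * QPi Pi z]. Truncation by a minimum keeps it continuous in z even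
    when Pi has atoms. *)
Definition Umoment (z : R) : R := \int[Pi]_(y in `]0, +oo[) (Num.min y z ^+ 2).

(** For z > 0 this is [z ^+ 2 * KPi Pi z]. *)
Definition Vmoment (z : R) : R := \int[Pi]_(y in `]0, z[) (y ^+ 2).

Hypothesis hPi : levy_measure Pi.

Local Notation D0 := (`]0%R, +oo[%classic : set R).

Let mD0 : measurable D0. Proof. exact: measurable_itv. Qed.

Lemma in_D0 (y : R) : D0 y -> 0 < y.
Proof. by rewrite /= in_itv/= andbT. Qed.

Lemma min1_integrable : Pi.-integrable D0 (EFin \o (fun y => Num.min 1 y)).
Proof.
have [_ h] := hPi; apply/integrableP; split.
  by apply/measurable_EFinP; measurability.
rewrite (le_lt_trans _ h)// le_eqVlt; apply/orP; left; apply/eqP.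
apply: eq_integral => y /set_mem /in_D0 y0 /=.
by rewrite ger0_norm// le_min ler01 ltW.
Qed.

Lemma levy_integrable (f : R -> R) (C : R) : measurable_fun setT f ->
  (forall y, 0 < y -> `|f y| <= C * Num.min 1 y) -> Pi.-integrable D0 (EFin \o f).
Proof.
move=> mf fC; apply: (@integrable_le _ _ _ Pi D0 f (fun y => C * Num.min 1 y)) => //.
- exact: measurable_funTS.
- exact: integrable_scale mD0 min1_integrable.
- by move=> y /in_D0; exact: fC.
Qed.

(** Since [min (uy) 1 <= (1 + u) min 1 y], these weights are dominated by the function whose
    integrability defines Levy measures. *)
Lemma pow_exp_le_min n (u y : R) : 0 < u -> 0 < y ->
  y ^+ n.+1 * expR (- (u * y)) <= n.+1`!%:R / u ^+ n.+1 * (1 + u) * Num.min 1 y.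
Proof.
move=> u0 y0; have uy : 0 <= u * y by rewrite mulr_ge0 ?ltW.
have := @pow_expRN_min R n.+1 1 (u * y) isT uy; rewrite expr1 => h.
have un : 0 < u ^+ n.+1 by rewrite exprn_gt0.
have hm : Num.min (u * y) 1 <= (1 + u) * Num.min 1 y.
  have [y1|y1] := leP y 1; rewrite ge_min; apply/orP.
    by left; rewrite ler_pM2r// lerDr.
  by right; rewrite mulr1 lerDl ltW.
have -> : y ^+ n.+1 * expR (- (u * y)) =
    (u * y) ^+ n.+1 * expR (- (u * y)) / u ^+ n.+1.
  by rewrite exprMn; field; rewrite gt_eqF.
rewrite ler_pdivrMr//; apply: (le_trans h).
have -> : n.+1`!%:R / u ^+ n.+1 * (1 + u) * Num.min 1 y * u ^+ n.+1 =
  n.+1`!%:R * ((1 + u) * Num.min 1 y) by field; rewrite gt_eqF.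
by rewrite ler_wpM2l.
Qed.

Lemma levy_pow_exp_integrable n (u : R) (g : R -> R) : 0 < u ->
  measurable_fun setT g -> (forall y, `|g y| <= 1) ->
  Pi.-integrable D0 (EFin \o (fun y => y ^+ n.+1 * expR (- (u * y)) * g y)).
Proof.
move=> u0 mg g1.
apply: (@levy_integrable _ (n.+1`!%:R / u ^+ n.+1 * (1 + u))); first by measurability.
move=> y y0; apply: le_trans (pow_exp_le_min n u0 y0).
rewrite normrM -[leRHS]mulr1; apply: ler_pM => //.
by rewrite ger0_norm// mulr_ge0 ?expR_ge0// exprn_ge0// ltW.
Qed.

Lemma levy_pow_exp_integrable1 n (u : R) : 0 < u ->
  Pi.-integrable D0 (EFin \o (fun y => y ^+ n.+1 * expR (- (u * y)))).
Proof.
move=> u0; have := @levy_pow_exp_integrable n u (cst 1) u0.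
have h : forall y : R, `|cst (1 : R) y| <= 1 by move=> y; rewrite normr1.
move=> /(_ (measurable_cst _) h); apply: eq_integrable => // y _ /=.
by rewrite mulr1.
Qed.

Lemma levy_onem_exp_integrable (u : R) : 0 <= u ->
  Pi.-integrable D0 (EFin \o (fun y => 1 - expR (- (u * y)))).
Proof.
move=> u0; apply: (@levy_integrable _ (1 + u)); first by measurability.
move=> y y0; have uy : 0 <= u * y by rewrite mulr_ge0// ltW.
rewrite ger0_norm ?subr_ge0 ?expRN_le1//; have [y1|y1] := leP y 1.
  by apply: le_trans (onem_expRN_le _) _; rewrite ler_pM2r// lerDr.
by have := expR_ge0 (- (u * y)); lra.
Qed.

Lemma levy_exp_mul_integrable (u v : R) (g : R -> R) : 0 <= u ->
  measurable_fun setT g -> (forall y, `|g y| <= 2) ->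
  (forall y, 0 < y -> `|g y| <= `|v| * y) ->
  Pi.-integrable D0 (EFin \o (fun y => expR (- (u * y)) * g y)).
Proof.
move=> u0 mg g2 gv; apply: (@levy_integrable _ (2 + `|v|)); first by measurability.
move=> y y0; have uy : 0 <= u * y by rewrite mulr_ge0// ltW.
rewrite normrM; apply: (@le_trans _ _ `|g y|).
  by rewrite ler_piMl// ger0_norm ?expR_ge0 ?expRN_le1.
have v0 : 0 <= `|v| by [].
have [y1|y1] := leP y 1; last by have := g2 y; lra.
by have := gv _ y0; nra.
Qed.

Lemma levy_alpha_integrable (u v : R) : 0 <= u ->
  Pi.-integrable D0 (EFin \o (fun y => expR (- (u * y)) * (1 - cos (v * y)))).
Proof.
move=> u0; apply: (@levy_exp_mul_integrable _ v) => //; first by measurability.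
  by move=> y; rewrite ler_norml; have := cos_le1 (v * y); have := cos_geN1 (v * y); lra.
move=> y y0; have := cos_lipschitz (v * y) 0.
by rewrite cos0 sub0r normrN normrM (gtr0_norm y0).
Qed.

Lemma levy_beta_integrable (u v : R) : 0 <= u ->
  Pi.-integrable D0 (EFin \o (fun y => expR (- (u * y)) * sin (v * y))).
Proof.
move=> u0; apply: (@levy_exp_mul_integrable _ v) => //; first by measurability.
  by move=> y; rewrite (le_trans (sin_max _))// ler1n.
by move=> y y0; have := norm_sin_le (v * y); rewrite normrM (gtr0_norm y0).
Qed.

Lemma levy_ytrig_integrable (u : R) (g : R -> R) : 0 < u ->
  measurable_fun setT g -> (forall y, `|g y| <= 1) ->
  Pi.-integrable D0 (EFin \o (fun y => y * expR (- (u * y)) * g y)).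
Proof. by move=> u0 mg g1; have := @levy_pow_exp_integrable 0 u g u0 mg g1. Qed.

Lemma levy_y_integrable (u : R) : 0 < u ->
  Pi.-integrable D0 (EFin \o (fun y => y * expR (- (u * y)))).
Proof. by move=> u0; have := @levy_pow_exp_integrable1 0 u u0. Qed.

Lemma is_derive_psi (u : R) : 0 < u -> is_derive u 1 (psi b Pi) (dpsi u).
Proof.
move=> u0; rewrite /psi /dpsi; apply: is_derive_add.
  by derives; rewrite ?mulr1; ring.
(* The domination is taken on ]u/2, u + 1[, away from 0: the integral of y against Pi may diverge at
   infinity. *)
apply: (@is_derive_Rintegral _ _ _ Pi D0 (fun u y => 1 - expR (- (u * y)))
  (fun u y => y * expR (- (u * y))) (fun y => y * expR (- (u / 2 * y))) (u / 2) (u + 1)) => //.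
- by apply/andP; split; lra.
- by move=> x /andP[xu _]; apply: levy_onem_exp_integrable; lra.
- by move=> x y _ _; derives; ring.
- by apply: levy_y_integrable; lra.
- move=> x y /andP[xu _] /in_D0 y0; rewrite ger0_norm ?mulr_ge0 ?expR_ge0 ?(ltW y0)//.
  by rewrite ler_pM2l// ler_expR lerN2 ler_pM2r// ltW.
Qed.

Lemma is_derive_dpsi (u : R) : 0 < u -> is_derive u 1 dpsi (- sigma2 Pi u).
Proof.
move=> u0; rewrite /dpsi /sigma2.
have -> : - (\int[Pi]_(y in `]0, +oo[) (y ^+ 2 * expR (- (u * y)))) =
  0 + \int[Pi]_(y in `]0, +oo[) (- (y ^+ 2 * expR (- (u * y)))).
  rewrite add0r -mulN1r -RintegralZl//; last exact: levy_pow_exp_integrable1.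
  by apply: eq_Rintegral => y _; rewrite mulN1r.
apply: (is_derive_add (is_derive_const b u)).
apply: (@is_derive_Rintegral _ _ _ Pi D0 (fun u y => y * expR (- (u * y)))
  (fun u y => - (y ^+ 2 * expR (- (u * y)))) (fun y => y ^+ 2 * expR (- (u / 2 * y))) (u / 2) (u + 1)) => //.
- by apply/andP; split; lra.
- by move=> x /andP[xu _]; apply: levy_y_integrable; lra.
- by move=> x y _ _; derives; ring.
- by apply: levy_pow_exp_integrable1; lra.
- move=> x y /andP[xu _] /in_D0 y0; rewrite normrN.
  rewrite ger0_norm ?(mulr_ge0 (sqr_ge0 _) (expR_ge0 _))//.
  by rewrite ler_wpM2l ?(sqr_ge0 y)// ler_expR lerN2 ler_pM2r// ltW.
Qed.

Lemma is_derive_alpha (u v : R) : 0 < u -> is_derive v 1 (alpha u) (dalpha u v).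
Proof.
move=> u0; apply: (@is_derive_Rintegral _ _ _ Pi D0
  (fun v y => expR (- (u * y)) * (1 - cos (v * y)))
  (fun v y => y * expR (- (u * y)) * sin (v * y))
  (fun y => y * expR (- (u * y))) (v - 1) (v + 1)) => //.
- by apply/andP; split; lra.
- by move=> x _; apply: levy_alpha_integrable; rewrite ltW.
- by move=> x y _ _; derives; ring.
- exact: levy_y_integrable.
- move=> x y _ /in_D0 y0; have ye := mulr_ge0 (ltW y0) (expR_ge0 (- (u * y))).
  by rewrite normrM (ger0_norm ye) ler_piMr// sin_max.
Qed.

Lemma is_derive_beta (u v : R) : 0 < u -> is_derive v 1 (beta u) (dbeta u v).
Proof.
move=> u0; rewrite /beta /dbeta.
have h : is_derive v 1 (fun w => b * w) b by derives; ring.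
apply: (is_derive_add h).
apply: (@is_derive_Rintegral _ _ _ Pi D0
  (fun v y => expR (- (u * y)) * sin (v * y))
  (fun v y => y * expR (- (u * y)) * cos (v * y))
  (fun y => y * expR (- (u * y))) (v - 1) (v + 1)) => //.
- by apply/andP; split; lra.
- by move=> x _; apply: levy_beta_integrable; rewrite ltW.
- by move=> x y _ _; derives; ring.
- exact: levy_y_integrable.
- move=> x y _ /in_D0 y0; have ye := mulr_ge0 (ltW y0) (expR_ge0 (- (u * y))).
  by rewrite normrM (ger0_norm ye) ler_piMr// cos_max.
Qed.

Lemma alpha_ge0 (u v : R) : 0 <= alpha u v.
Proof.
apply: Rintegral_ge0 => y _; rewrite mulr_ge0 ?expR_ge0// subr_ge0.
Qed.

Lemma alpha0 (u : R) : alpha u 0 = 0.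
Proof.
rewrite /alpha; have -> : (fun y : R => expR (- (u * y)) * (1 - cos (0 * y))) = cst 0.
  by apply/funext => y; rewrite mul0r cos0 subrr mulr0.
by rewrite Rintegral_cst// mul0r.
Qed.

Lemma beta0 (u : R) : beta u 0 = 0.
Proof.
rewrite /beta; have -> : (fun y : R => expR (- (u * y)) * sin (0 * y)) = cst 0.
  by apply/funext => y; rewrite mul0r sin0 mulr0.
by rewrite Rintegral_cst// mul0r mulr0 addr0.
Qed.

Lemma psi0 : psi b Pi 0 = 0.
Proof.
rewrite /psi; have -> : (fun y : R => 1 - expR (- (0 * y))) = cst 0.
  by apply/funext => y; rewrite mul0r oppr0 expR0 subrr.
by rewrite Rintegral_cst// mul0r mulr0 addr0.
Qed.

Lemma sqr_min_le (z y : R) : 0 < z -> 0 < y ->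
  `|Num.min y z ^+ 2| <= (z ^+ 2 + 1) * Num.min 1 y.
Proof.
move=> z0 y0; rewrite ger0_norm ?sqr_ge0//.
have [yz|zy] := leP y z; have [y1|y1] := leP y 1; nra.
Qed.

Lemma Umoment_integrable (z : R) : 0 < z ->
  Pi.-integrable D0 (EFin \o (fun y => Num.min y z ^+ 2)).
Proof.
move=> z0; apply: (@levy_integrable _ (z ^+ 2 + 1)); first by measurability.
by move=> y; exact: sqr_min_le.
Qed.

Lemma sub_D0 (z : R) : `]0, z[ `<=` D0.
Proof. by move=> y /=; rewrite !in_itv/= andbT => /andP[]. Qed.

Lemma Vmoment_integrable (z : R) : 0 < z ->
  Pi.-integrable (`]0, z[%classic : set R) (EFin \o (fun y => y ^+ 2)).
Proof.
move=> z0; have := integrableS mD0 (measurable_itv _) (@sub_D0 z) (Umoment_integrable z0).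
apply: eq_integrable => // y /set_mem /=; rewrite in_itv/= => /andP[_ yz].
by rewrite min_l// ltW.
Qed.

Lemma Vmoment_le_Umoment (z : R) : 0 < z -> Vmoment z <= Umoment z.
Proof.
move=> z0; have -> : Vmoment z = \int[Pi]_(y in `]0, z[) (Num.min y z ^+ 2).
  apply: eq_Rintegral => y /set_mem /=; rewrite in_itv/= => /andP[_ yz].
  by rewrite min_l// ltW.
apply: Rintegral_subset => //; first exact: sub_D0.
  exact: Umoment_integrable.
by move=> y _; rewrite sqr_ge0.
Qed.

Lemma Vmoment_le (w z : R) : 0 < w -> w <= z -> Vmoment w <= Vmoment z.
Proof.
move=> w0 wz; apply: Rintegral_subset => //.
- by move=> y /=; rewrite !in_itv/= => /andP[-> /lt_le_trans]; apply.
- by apply: Vmoment_integrable; exact: lt_le_trans wz.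
- by move=> y _; rewrite sqr_ge0.
Qed.

(** Markov's inequality for [min 1 y], which is at least [min 1 z] on this ray. *)
Lemma tail_lty (z : R) : 0 < z -> (Pi (`]z, +oo[%classic) < +oo)%E.
Proof.
move=> z0; have mz : measurable (`]z, +oo[%classic : set R) by exact: measurable_itv.
have sub : `]z, +oo[ `<=` D0.
  by move=> y /=; rewrite !in_itv/= !andbT; exact: lt_trans.
have m0 : 0 < Num.min 1 z by rewrite lt_min ltr01.
have h : ((Num.min 1 z)%:E * Pi (`]z, +oo[%classic) < +oo)%E.
  rewrite -integral_cst//; have [_ /(le_lt_trans _)] := hPi; apply.
  apply: (@le_trans _ _ (\int[Pi]_(y in `]z, +oo[) (Num.min 1 y)%:E)%E).
    apply: ge0_le_integral => //.
    - by move=> y _; rewrite lee_fin ltW.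
    - by apply/measurable_EFinP; measurability.
    - move=> y; rewrite /= in_itv/= andbT => zy; rewrite lee_fin.
      by rewrite le_min ge_min lexx/= ge_min (ltW zy) orbT.
  apply: ge0_subset_integral => //; first by apply/measurable_EFinP; measurability.
  by move=> y /in_D0 y0; rewrite lee_fin le_min ler01 ltW.
rewrite ltNge leye_eq; apply/negP => /eqP e; move: h.
by rewrite e mulry gtr0_sg// mul1e ltxx.
Qed.

Lemma tail_fin_num (z : R) : 0 < z -> Pi (`]z, +oo[%classic) \is a fin_num.
Proof. by move=> z0; rewrite ge0_fin_numE// tail_lty. Qed.

End LevyIntegrals.

(** * Fubini and the tail integral defining Q *)

Section FundamentalTheorem.
Context {R : realType}.

Lemma ftc_segment (f F : R -> R) (a b : R) : a < b -> continuous f ->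
  (forall x : R, is_derive x 1 F (f x)) ->
  (\int[lebesgue_measure]_(x in `[a, b]) (f x)%:E = (F b - F a)%:E)%E.
Proof.
move=> ab cf dF; have cF := is_derive_all_continuous dF.
rewrite (@continuous_FTC2 _ f F)//.
- exact: continuous_subspaceT.
- split.
  + by move=> x _; have h := dF x; exact: ex_derive.
  + exact/cvg_at_right_filter/cF.
  + exact/cvg_at_left_filter/cF.
- by move=> x _; exact: is_derive_derive1.
Qed.

End FundamentalTheorem.

Section TailIntegral.
Context {R : realType}.

(* Both sides are the integral of [2 y] over the region [0 < y < z, y < w]. *)
Lemma tail_integral (mu : {sigma_finite_measure set R -> \bar R}) (z : R) : 0 < z ->
  (\int[lebesgue_measure]_(y in (`]0%R, z[%classic : set (measurableTypeR R)))
     ((2 * y)%:E * mu (`]y, +oo[%classic)) =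
   \int[mu]_(w in `]0%R, +oo[) (Num.min w z ^+ 2)%:E)%E.
Proof.
move=> z0.
pose f (p : measurableTypeR R * R) : \bar R :=
  ((if [&& 0 < p.1, p.1 < z & p.1 < p.2] then 2 * p.1 else 0)%R)%:E.
have f0 p : (0 <= f p)%E.
  by rewrite /f lee_fin; case: ifP => // /and3P[p0 _ _]; rewrite mulr_ge0// ltW.
have mf : measurable_fun setT f.
  apply/measurable_EFinP; apply: measurable_fun_ifT.
  - apply: measurable_and; first exact: measurable_fun_ltr.
    by apply: measurable_and; exact: measurable_fun_ltr.
  - by apply: measurable_funM.
  - by [].
have inner1 y : (\int[mu]_w f (y, w))%E =
    if y \in `]0, z[ then ((2 * y)%:E * mu (`]y, +oo[%classic))%E else 0%E.
  rewrite /f /= in_itv/=; case: ifPn => [/andP[y0 yz]|nyz].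
    rewrite -integral_cst//.
    rewrite [RHS]integral_mkcond; apply: eq_integral => w _.
    by rewrite patchE mem_setE in_itv/= andbT y0 yz /=; case: ifP.
  rewrite integral0_eq// => w _; case: ifPn => // /and3P[y0 yz _].
  by move: nyz; rewrite y0 yz.
have inner2 w : (\int[lebesgue_measure]_y f (y, w))%E =
    if w \in `]0, +oo[ then (Num.min w z ^+ 2)%:E else 0%E.
  rewrite /f /= in_itv/= andbT; case: ifPn => w0; last first.
    rewrite integral0_eq// => y _; case: ifPn => // /and3P[y0 yz yw].
    by move: w0; rewrite (lt_trans y0 yw).
  have m0 : 0 < Num.min w z by rewrite lt_min w0.
  transitivity (\int[lebesgue_measure]_(y in (`]0%R, (Num.min w z)[%classic :
      set (measurableTypeR R))) ((2 * y)%R)%:E)%E.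
    rewrite [RHS]integral_mkcond; apply: eq_integral => y _.
    rewrite patchE mem_setE in_itv/= lt_min (andbC (y < w)).
    by case: ifP.
  have mg : measurable_fun (setT : set (measurableTypeR R)) (fun y : R => (2 * y)%:E).
    by apply/measurable_EFinP; exact: measurable_funM.
  rewrite integral_itv_bndo_bndc; last exact: measurable_funTS.
  rewrite integral_itv_obnd_cbnd; last exact: measurable_funTS.
  have h1 (x : R) : is_derive x 1 (fun y : R => 2 * y) 2 by derives; ring.
  have h2 (x : R) : is_derive x 1 (fun y : R => y ^+ 2) (2 * x) by derives; ring.
  by rewrite (ftc_segment m0 (is_derive_all_continuous h1) h2) expr0n/= subr0.
rewrite integral_mkcond [RHS]integral_mkcond.
transitivity (\int[lebesgue_measure]_y \int[mu]_w f (y, w))%E.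
  by apply: eq_integral => y _; rewrite inner1 patchE mem_setE.
rewrite (fubini_tonelli f)//; apply: eq_integral => w _.
by rewrite inner2 patchE mem_setE.
Qed.

Lemma levy_sigma_finite (Pi : {measure set R -> \bar R}) :
  levy_measure Pi -> sigma_finite setT Pi.
Proof.
move=> hPi; exists (fun n : nat => if n is k.+1 then `]k.+1%:R^-1, +oo[%classic
                        else `]-oo, 0]%classic).
  apply/esym; rewrite -subTset => x _.
  have [x0|x0] := leP x 0; first by exists 0%N => //=; rewrite in_itv.
  have [k kx] : exists k : nat, k.+1%:R^-1 < x.
    exists (Num.truncn x^-1); rewrite invf_plt ?posrE//.
    exact: truncnS_gt.
  by exists k.+1 => //=; rewrite in_itv/= kx.
case=> [|k]; split; [exact: measurable_itv| |exact: measurable_itv|].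
  by have [-> _] := hPi.
by apply: tail_lty => //; rewrite invr_gt0.
Qed.

(** A copy of Pi indexed by the proof [hPi], to which the sigma-finite structure, depending on that
    proof, can be attached. *)
Definition levy_sfinite (Pi : {measure set R -> \bar R}) (hPi : levy_measure Pi) :
  set R -> \bar R := Pi.

HB.instance Definition _ Pi hPi := Measure.copy (@levy_sfinite Pi hPi) Pi.

HB.instance Definition _ Pi hPi := @Measure_isSigmaFinite.Build _ _ _
  (@levy_sfinite Pi hPi) (levy_sigma_finite hPi).

Lemma QPiE (Pi : {measure set R -> \bar R}) (z : R) : levy_measure Pi -> 0 < z ->
  QPi Pi z = z ^- 2 * Umoment Pi z.
Proof.
move=> hPi z0; pose mu : {sigma_finite_measure set R -> \bar R} := levy_sfinite hPi.
have tI := tail_integral mu z0.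
have P0 y : 0 <= Pibar Pi y by apply: fine_ge0.
set I := (\int[lebesgue_measure]_(y in (`]0%R, z[%classic : set (measurableTypeR R)))
   (y * Pibar Pi y)%:E)%E.
have I0 : (0 <= I)%E.
  apply: integral_ge0 => y; rewrite /= in_itv/= => /andP[y0 _].
  by rewrite lee_fin mulr_ge0// ltW.
have mt : measurable_fun (`]0%R, z[%classic : set (measurableTypeR R)) (Pibar Pi).
  apply: measurable_funTS; rewrite /Pibar.
  pose A := [set p : measurableTypeR R * R | p.1 < p.2].
  have mA : measurable A.
    have := @measurable_fun_ltr _ (measurableTypeR R * R)%type R setT fst snd.
    move=> /(_ measurable_fst measurable_snd measurableT [set true]).
    rewrite setTI; apply => //.
  have := measurable_fun_xsection mu mA => h.
  apply: (@measurableT_comp _ _ _ _ _ _ fine); first exact: fine_measurable.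
  apply: eq_measurable_fun h => y _ /=; congr (mu _); apply/seteqP.
  by split => w; rewrite /xsection /= in_itv/= andbT inE.
transitivity (z ^- 2 * fine (2%:E * I)%E).
  (* If [I] is infinite, [fine] sends both sides to 0. *)
  rewrite /QPi /Rintegral -/I; have [->|Ify] := eqVneq I +oo%E.
    by rewrite mulry gtr0_sg// mul1e /= !mulr0.
  by rewrite fineM ?ge0_fin_numE ?ltey//= mulrA (mulrC (z ^- 2)).
congr (_ * _); rewrite /Umoment /Rintegral; congr fine; rewrite -tI /I.
rewrite -ge0_integralZl_EFin//.
- apply: eq_integral => y /set_mem /=; rewrite in_itv/= => /andP[y0 _].
  rewrite -[in RHS](@fineK _ (Pi _)) ?tail_fin_num// -!EFinM mulrA.
  by [].
- by move=> y; rewrite /= in_itv/= => /andP[y0 _]; rewrite lee_fin mulr_ge0// ltW.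
- by apply/measurable_EFinP; apply: measurable_funM.
Qed.
End TailIntegral.

(** * Truncated and tilted moments of the Levy measure *)

Section TruncatedMoments.
Context {R : realType} (b : R) (Pi : {measure set R -> \bar R}).
Hypothesis hPi : levy_measure Pi.

Local Notation D0 := (`]0%R, +oo[%classic : set R).
Local Notation U := (Umoment Pi).
Local Notation V := (Vmoment Pi).

Lemma D0_split (z : R) : 0 < z -> D0 = (`]0, z]%classic : set R) `|` `]z, +oo[%classic.
Proof.
move=> z0; apply/seteqP; split => y /=; rewrite !in_itv/= !andbT.
  by move=> y0; have [yz|zy] := leP y z; [left; rewrite y0|right].
by case=> [/andP[]//|]; exact: lt_trans.
Qed.

Lemma Rintegral_D0_split (f : R -> R) (z : R) : 0 < z ->
  Pi.-integrable D0 (EFin \o f) ->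
  \int[Pi]_(y in `]0, +oo[) f y =
  \int[Pi]_(y in `]0, z]) f y + \int[Pi]_(y in `]z, +oo[) f y.
Proof.
move=> z0 fi; rewrite [in LHS](D0_split z0) Rintegral_setU//.
  by rewrite -(D0_split z0).
apply/disj_setPS => y [/=]; rewrite !in_itv/= andbT => /andP[_ yz].
by rewrite ltNge yz.
Qed.

Lemma Pibar_ge0 (z : R) : 0 <= Pibar Pi z. Proof. exact: fine_ge0. Qed.

Lemma Umoment_ge0 (z : R) : 0 <= U z.
Proof. by apply: Rintegral_ge0 => y _; rewrite sqr_ge0. Qed.

(** The squared minimum does not change for jumps up to y, and grows by at most [z ^+ 2 - y ^+ 2]
    for the others. Both the doubling estimate and the continuity of U rest on this. *)
Lemma Umoment_increment (y z : R) : 0 < y -> y <= z ->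
  U z <= U y + (z ^+ 2 - y ^+ 2) * Pibar Pi y.
Proof.
move=> y0 yz; have z0 := lt_le_trans y0 yz.
have iz := Umoment_integrable hPi z0; have iy := Umoment_integrable hPi y0.
have m1 : measurable (`]0, y]%classic : set R) by exact: measurable_itv.
have m2 : measurable (`]y, +oo[%classic : set R) by exact: measurable_itv.
have m0 : measurable D0 by exact: measurable_itv.
have sub1 : `]0, y] `<=` D0 by rewrite (D0_split y0); left.
have sub2 : `]y, +oo[ `<=` D0 by rewrite (D0_split y0); right.
have ic : Pi.-integrable (`]y, +oo[%classic : set R) (EFin \o (fun=> z ^+ 2)).
  apply/integrableP; split; first exact/measurable_EFinP.
  rewrite (eq_integral (cst (z ^+ 2)%:E)) ?integral_cst//=.
    by rewrite lte_mul_pinfty// ?lee_fin ?sqr_ge0// tail_lty.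
  by move=> w _; rewrite /= ger0_norm ?sqr_ge0.
rewrite {1}/Umoment (Rintegral_D0_split y0 iz) {1}/Umoment (Rintegral_D0_split y0 iy).
have -> : \int[Pi]_(w in `]0, y]) (Num.min w z ^+ 2) =
    \int[Pi]_(w in `]0, y]) (Num.min w y ^+ 2).
  apply: eq_Rintegral => w /set_mem /=; rewrite in_itv/= => /andP[_ wy].
  by rewrite !min_l// (le_trans wy).
have -> : \int[Pi]_(w in `]y, +oo[) (Num.min w y ^+ 2) = y ^+ 2 * Pibar Pi y.
  rewrite /Pibar -Rintegral_cst//.
  apply: eq_Rintegral => w /set_mem /=; rewrite in_itv/= andbT => wy.
  by rewrite min_r// ltW.
rewrite -addrA lerD2l mulrBl addrC subrK /Pibar -Rintegral_cst//.
apply: le_Rintegral => //; first exact: integrableS iz.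
move=> w; rewrite /= in_itv/= andbT => yw; rewrite ler_sqr ?nnegrE ?ge_min ?lexx ?orbT//.
  by rewrite le_min !ltW// (lt_trans y0).
exact: ltW.
Qed.

Lemma UmomentE (z : R) : 0 < z -> U z = V z + z ^+ 2 * fine (Pi (`[z, +oo[%classic)).
Proof.
move=> z0; have iz := Umoment_integrable hPi z0.
have m1 : measurable (`]0, z[%classic : set R) by exact: measurable_itv.
have m2 : measurable (`[z, +oo[%classic : set R) by exact: measurable_itv.
have D0E : D0 = (`]0, z[%classic : set R) `|` `[z, +oo[%classic.
  apply/seteqP; split => y /=; rewrite !in_itv/= !andbT.
    by move=> y0; have [yz|zy] := ltP y z; [left; rewrite y0|right].
  by case=> [/andP[]//|]; exact: lt_le_trans.
rewrite /Umoment D0E Rintegral_setU//.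
- congr (_ + _).
    apply: eq_Rintegral => y /set_mem /=; rewrite in_itv/= => /andP[_ yz].
    by rewrite min_l// ltW.
  rewrite -Rintegral_cst//; apply: eq_Rintegral => y /set_mem /=.
  by rewrite in_itv/= andbT => zy; rewrite min_r.
- by rewrite -D0E.
apply/disj_setPS => y [/=]; rewrite !in_itv/= andbT => /andP[_ yz].
by rewrite leNgt yz.
Qed.

(** [UmomentE] involves a closed ray, V being taken on an open interval, whereas compactness speaks
    of [Pibar]. An atom at z would separate the two; passing to z / 2 restores an upper bound. *)
Lemma Pibar_le_closed (z : R) : 0 < z ->
  Pibar Pi z <= fine (Pi (`[z, +oo[%classic)) <= Pibar Pi (z / 2).
Proof.
move=> z0; have f1 := tail_fin_num hPi z0.
have z2 : 0 < z / 2 by rewrite divr_gt0.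
have f2 := tail_fin_num hPi z2.
have le1 : (Pi (`]z, +oo[%classic) <= Pi (`[z, +oo[%classic))%E.
  apply: le_measure; rewrite ?inE//.
  by move=> y /=; rewrite !in_itv/= !andbT; exact: ltW.
have le2 : (Pi (`[z, +oo[%classic) <= Pi (`](z / 2)%R, +oo[%classic))%E.
  apply: le_measure; rewrite ?inE//.
  move=> y /=; rewrite !in_itv/= !andbT; apply: lt_le_trans; lra.
have f3 : Pi (`[z, +oo[%classic) \is a fin_num.
  by rewrite ge0_fin_numE// (le_lt_trans le2)// tail_lty.
by apply/andP; split; rewrite fine_le.
Qed.

(** [min w z / z] is nonincreasing in z; hence so is Q. *)
Lemma Umoment_le_scale (y z : R) : 0 < y -> y <= z ->
  z ^- 2 * U z <= y ^- 2 * U y.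
Proof.
move=> y0 yz; have z0 := lt_le_trans y0 yz.
have m0 : measurable D0 by exact: measurable_itv.
have iz := Umoment_integrable hPi z0; have iy := Umoment_integrable hPi y0.
rewrite /Umoment -!RintegralZl//; apply: le_Rintegral => //.
- exact: integrable_scale.
- exact: integrable_scale.
- move=> w /in_D0 w0; rewrite -!exprVn -!exprMn ler_sqr ?nnegrE; first last.
  + by rewrite mulr_ge0 ?invr_ge0 ?le_min ?ltW.
  + by rewrite mulr_ge0 ?invr_ge0 ?le_min ?ltW.
  rewrite [z^-1 * _]mulrC [y^-1 * _]mulrC ler_pdivrMr// mulrAC ler_pdivlMr//.
  have [wz|zw] := leP w z; have [wy|yw] := leP w y; nra.
Qed.

Lemma Umoment_le (y z : R) : 0 < y -> y <= z -> U y <= U z.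
Proof.
move=> y0 yz; have z0 := lt_le_trans y0 yz.
apply: le_Rintegral => //; [exact: Umoment_integrable|exact: Umoment_integrable|].
move=> w /in_D0 w0.
have h1 : Num.min w y <= Num.min w z by rewrite le_min !ge_min lexx yz orbT.
have h2 : 0 <= Num.min w y by rewrite le_min !ltW.
by rewrite ler_sqr ?nnegrE// (le_trans h2).
Qed.

Lemma Vmoment_weighted (w : R -> R) (c z : R) : 0 < z -> 0 <= c ->
  Pi.-integrable D0 (EFin \o w) -> (forall y, 0 < y -> 0 <= w y) ->
  (forall y, 0 < y < z -> c * y ^+ 2 <= w y) ->
  c * V z <= \int[Pi]_(y in `]0, +oo[) w y.
Proof.
move=> z0 c0 wi w0 cw; have m1 : measurable (`]0, z[%classic : set R) by exact: measurable_itv.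
have m0 : measurable D0 by exact: measurable_itv.
have ws := integrableS m0 m1 (@sub_D0 _ z) wi.
have iV := Vmoment_integrable hPi z0.
apply: (@le_trans _ _ (\int[Pi]_(y in `]0, z[) w y)).
  rewrite -RintegralZl//; apply: le_Rintegral => //; exact: integrable_scale.
apply: Rintegral_subset => //; first exact: sub_D0.
by move=> y /in_D0; exact: w0.
Qed.

(** Jumps below z lie in the quadratic range of [1 - cos]; the others contribute nonnegatively and
    are dropped. *)
Lemma alpha_ge (u v z : R) : 0 <= u -> 0 <= v -> 0 < z -> v * z <= 1 ->
  expR (- (u * z)) * v ^+ 2 / 8 * V z <= alpha Pi u v.
Proof.
move=> u0 v0 z0 vz; apply: Vmoment_weighted => //.
- by rewrite divr_ge0 ?mulr_ge0 ?expR_ge0 ?sqr_ge0.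
- exact: levy_alpha_integrable.
- move=> y /andP[y0 yz] /=.
  have -> : expR (- (u * z)) * v ^+ 2 / 8 * y ^+ 2 =
    expR (- (u * z)) * ((v * y) ^+ 2 / 8) by field.
  apply: ler_pM; rewrite ?expR_ge0 ?divr_ge0 ?sqr_ge0//.
    by rewrite ler_expR lerN2 ler_wpM2l// ltW.
  apply: onem_cos_ge; first by rewrite mulr_ge0 ?(ltW y0).
  by rewrite (le_trans _ vz)// ler_wpM2l// ltW.
Qed.

Lemma sigma2_ge (u : R) : 0 < u -> expR (-1) * V u^-1 <= sigma2 Pi u.
Proof.
move=> u0; apply: Vmoment_weighted; rewrite ?invr_gt0 ?expR_ge0//.
- exact: levy_pow_exp_integrable1.
- by move=> y y0 /=; rewrite mulr_ge0 ?expR_ge0 ?sqr_ge0.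
- move=> y /andP[y0 yz] /=; rewrite mulrC ler_wpM2l ?sqr_ge0// ler_expR lerN2.
  by rewrite mulrC -ler_pdivlMr// mul1r ltW.
Qed.

Definition moment (n : nat) (u : R) : R :=
  \int[Pi]_(y in `]0, +oo[) (y ^+ n * expR (- (u * y))).

(** The inequality [w^(n+2) exp(-w) <= (n+2)! min(w,1)^2] at [w = uy]. The exponent 2 is kept for
    every n, so that all tilted moments are measured by [U u^-1] and a power of u. *)
Lemma moment_le n (u : R) : 0 < u ->
  moment n.+2 u <= n.+2`!%:R * U u^-1 / u ^+ n.
Proof.
move=> u0; have ui : 0 < u^-1 by rewrite invr_gt0.
have m0 : measurable D0 by exact: measurable_itv.
have iU := Umoment_integrable hPi ui.
rewrite mulrAC /Umoment -RintegralZl//; apply: le_Rintegral => //.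
- exact: levy_pow_exp_integrable1.
- exact: integrable_scale.
move=> y /in_D0 y0; have uy : 0 <= u * y by rewrite mulr_ge0 ?ltW.
have := @pow_expRN_min R n.+2 2 _ isT uy.
have -> : Num.min (u * y) 1 = u * Num.min y u^-1.
  by rewrite minr_pMr ?ltW// divff ?gt_eqF.
rewrite exprMn [(u * Num.min _ _) ^+ 2]exprMn => h.
have un : 0 < u ^+ n by rewrite exprn_gt0.
have u2 : 0 < u ^+ 2 by rewrite exprn_gt0.
rewrite -(ler_pM2l un) -(ler_pM2l u2).
have -> : u ^+ 2 * (u ^+ n * (y ^+ n.+2 * expR (- (u * y)))) =
  u ^+ n.+2 * y ^+ n.+2 * expR (- (u * y)).
  by have -> : u ^+ n.+2 = u ^+ 2 * u ^+ n; [rewrite -exprD|rewrite !mulrA].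
apply: (le_trans h); rewrite le_eqVlt; apply/orP; left; apply/eqP; field.
by rewrite gt_eqF.
Qed.

Lemma alpha_taylor (u v : R) : 0 < u -> 0 <= v ->
  `|alpha Pi u v - v ^+ 2 / 2 * sigma2 Pi u| <= v ^+ 3 * moment 3 u.
Proof.
move=> u0 v0; have m0 : measurable D0 by exact: measurable_itv.
have i2 := levy_pow_exp_integrable1 hPi 1 u0.
have i3 := levy_pow_exp_integrable1 hPi 2 u0.
rewrite /sigma2 /moment -!RintegralZl//; apply: Rintegral_dist_le => //.
- by apply: levy_alpha_integrable; rewrite ?ltW.
- exact: integrable_scale.
- exact: integrable_scale.
move=> y /in_D0 y0.
have -> : expR (- (u * y)) * (1 - cos (v * y)) -
    v ^+ 2 / 2 * (y ^+ 2 * expR (- (u * y))) =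
  expR (- (u * y)) * (1 - cos (v * y) - (v * y) ^+ 2 / 2) by field.
rewrite normrM ger0_norm ?expR_ge0//.
have -> : v ^+ 3 * (y ^+ 3 * expR (- (u * y))) = expR (- (u * y)) * (v * y) ^+ 3 by ring.
by rewrite ler_wpM2l ?expR_ge0// cos_taylor2// mulr_ge0// ltW.
Qed.

Lemma beta_taylor (u v : R) : 0 < u -> 0 <= v ->
  `|beta b Pi u v - v * dpsi b Pi u| <= v ^+ 3 * moment 3 u.
Proof.
move=> u0 v0; have m0 : measurable D0 by exact: measurable_itv.
have i1 := levy_y_integrable hPi u0.
have i3 := levy_pow_exp_integrable1 hPi 2 u0.
have -> : beta b Pi u v - v * dpsi b Pi u =
  \int[Pi]_(y in `]0, +oo[) (expR (- (u * y)) * sin (v * y)) -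
  v * \int[Pi]_(y in `]0, +oo[) (y * expR (- (u * y))) by rewrite /beta /dpsi; ring.
rewrite /moment -!RintegralZl//; apply: Rintegral_dist_le => //.
- by apply: levy_beta_integrable; rewrite ?ltW.
- exact: integrable_scale.
- exact: integrable_scale.
move=> y /in_D0 y0.
have -> : expR (- (u * y)) * sin (v * y) - v * (y * expR (- (u * y))) =
  expR (- (u * y)) * (sin (v * y) - v * y) by ring.
rewrite normrM ger0_norm ?expR_ge0//.
have -> : v ^+ 3 * (y ^+ 3 * expR (- (u * y))) = expR (- (u * y)) * (v * y) ^+ 3 by ring.
by rewrite ler_wpM2l ?expR_ge0// sin_taylor1// mulr_ge0// ltW.
Qed.

End TruncatedMoments.

(** * Stochastic compactness at 0 *)

Section StochasticCompactness.
Context {R : realType} (b : R) (Pi : {measure set R -> \bar R}).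
Hypothesis hPi : levy_measure Pi.

Local Notation D0 := (`]0%R, +oo[%classic : set R).
Local Notation U := (Umoment Pi).
Local Notation V := (Vmoment Pi).

(* This is [QPi z] for [z > 0]: see [QPiE]. *)
Definition Qmoment (z : R) : R := z ^- 2 * Umoment Pi z.

Local Notation q := Qmoment.

Lemma Qmoment_ge0 (z : R) : 0 <= q z.
Proof. by rewrite mulr_ge0 ?Umoment_ge0// invr_ge0 sqr_ge0. Qed.

Lemma sc_tail_bound : stochastically_compact0 Pi -> exists C y0 : R,
  [/\ 0 < C, 0 < y0 & forall y, 0 < y < y0 -> y ^+ 2 * Pibar Pi y <= C * V y].
Proof.
case=> K0 /ereal_inf_lt[_ [A FA <-]] supA.
move: FA; rewrite /at_right /within /= => /nbhs_ballP[e /= e0 eA].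
set s := ereal_sup _ in supA.
exists (Num.max 1 (fine s)), e; split => //; first by rewrite lt_max ltr01.
move=> y /andP[y0 ye].
have Ay : A y by apply: eA => //; rewrite /ball/= sub0r normrN gtr0_norm.
have ys : ((Pibar Pi y / KPi Pi y)%:E <= s)%E by apply: ereal_sup_ubound; exists y.
have sfin : s \is a fin_num.
  by rewrite fin_numElt supA andbT (lt_le_trans _ ys)// ltNyr.
move: ys; rewrite -(fineK sfin) lee_fin => ys.
have {}ys : Pibar Pi y / KPi Pi y <= Num.max 1 (fine s).
  by rewrite le_max ys orbT.
move: ys; rewrite ler_pdivrMr ?K0// /KPi -/(V y) => ys.
by rewrite -ler_pdivlMl ?exprn_gt0// mulrCA.
Qed.

Lemma sc_Vmoment_gt0 (y : R) : stochastically_compact0 Pi -> 0 < y -> 0 < V y.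
Proof.
case=> K0 _ y0; have := K0 _ y0; rewrite /KPi -/(V y) pmulr_rgt0//.
by rewrite invr_gt0 exprn_gt0.
Qed.

Lemma Qmoment_le (y z : R) : 0 < y -> y <= z -> q z <= q y.
Proof. exact: Umoment_le_scale. Qed.

Lemma exists_pow_le_half (theta : R) : 0 <= theta < 1 -> exists N, theta ^+ N.+1 <= 2^-1.
Proof.
move=> /andP[t0 t1]; have h : `|theta| < 1 by rewrite ger0_norm.
have /cvgrPdist_le/(_ 2^-1) := cvg_expr h.
rewrite invr_gt0 ltr0n => /(_ isT)[N _ /(_ N.+1 (leqnSn N))] /=.
by rewrite sub0r normrN ger0_norm ?exprn_ge0// => ?; exists N.
Qed.

(** The tail bound gives [q (2 * y) <= theta * q y] with [theta < 1]. Once [theta ^+ N.+1 <= 1/2],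
    the power [q ^+ N.+1] at least doubles when its argument is halved, so it grows at least like 1
    / y towards 0. The 2 in [z / (2 * y)] pays for ratios that are not powers of 2. *)
Lemma sc_regular : stochastically_compact0 Pi -> exists (C y0 : R) (N : nat),
  [/\ 0 < C, 0 < y0, (forall y, 0 < y < y0 -> U y <= C * V y) &
      forall y z, 0 < y -> y <= z -> z < y0 ->
        z / (2 * y) * q z ^+ N.+1 <= q y ^+ N.+1].
Proof.
move=> /sc_tail_bound[C [y0 [C0 y00 CV]]].
have C1 : 0 < 1 + C by rewrite addr_gt0.
(* As [U y >= V y + y^2 Pibar y], the tail bound gives [y^2 Pibar y <= C / (1 + C) U y]. Then
   [U (2y) <= U y + 3 y^2 Pibar y], and division by 4 leaves this factor. *)
pose theta := (1 + 4 * C) / (4 * (1 + C)).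
have [N thN] : exists N, theta ^+ N.+1 <= 2^-1.
  apply: exists_pow_le_half; rewrite /theta divr_ge0 ?mulr_ge0 ?addr_ge0 ?mulr_ge0 ?(ltW C0)//=.
  rewrite ltr_pdivrMr ?mulr_gt0// mul1r; lra.
have dbl y : 0 < y -> y < y0 -> q (2 * y) <= theta * q y.
  move=> yp yy0; have y2 : y <= 2 * y by lra.
  have h1 := Umoment_increment hPi yp y2.
  have h2 := UmomentE hPi yp; have /andP[h3 _] := Pibar_le_closed hPi yp.
  have h4 : y ^+ 2 * Pibar Pi y <= C * V y by apply: CV; rewrite yp.
  have yy : 0 < y ^+ 2 by rewrite exprn_gt0.
  have h5 : V y + y ^+ 2 * Pibar Pi y <= U y by rewrite h2 lerD2l ler_pM2l.
  have h6 : (1 + C) * (y ^+ 2 * Pibar Pi y) <= C * U y.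
    have : C * (V y + y ^+ 2 * Pibar Pi y) <= C * U y by rewrite ler_pM2l.
    by move: h4; set A := y ^+ 2 * _; set B := V y; move=> ? ?; nra.
  rewrite /q /theta.
  have -> : (2 * y) ^- 2 * U (2 * y) = y ^- 2 * (U (2 * y) / 4).
    by field; rewrite gt_eqF.
  have -> : (1 + 4 * C) / (4 * (1 + C)) * (y ^- 2 * U y) =
      y ^- 2 * ((1 + 4 * C) * U y / (1 + C) / 4) by field; rewrite !gt_eqF.
  rewrite ler_pM2l ?invr_gt0// ler_pM2r ?invr_gt0// ler_pdivlMr//.
  apply: (@le_trans _ _ ((U y + ((2 * y) ^+ 2 - y ^+ 2) * Pibar Pi y) * (1 + C))).
    by rewrite ler_pM2r.
  move: h6; rewrite exprMn; set A := y ^+ 2; set P := Pibar _ _; nra.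
(* The tail part of [U y] is at most [y^2 Pibar (y/2) <= 4 C V (y/2)]; the tail bound at y / 2
   accounts for the 4. *)
exists (1 + 4 * C), y0, N; split => //.
- by rewrite addr_gt0// mulr_gt0.
- move=> y /andP[yp yy0]; have y2 : 0 < y / 2 by rewrite divr_gt0.
  have /andP[_ h3] := Pibar_le_closed hPi yp.
  have h4 : (y / 2) ^+ 2 * Pibar Pi (y / 2) <= C * V (y / 2).
    by apply: CV; rewrite y2/=; lra.
  have h5 : V (y / 2) <= V y by apply: Vmoment_le => //; lra.
  rewrite (UmomentE hPi yp) mulrDl mul1r lerD2l.
  have yy : 0 < y ^+ 2 by rewrite exprn_gt0.
  apply: (@le_trans _ _ (y ^+ 2 * Pibar Pi (y / 2))); first by rewrite ler_pM2l.
  have : C * V (y / 2) <= C * V y by rewrite ler_pM2l.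
  by move: h4; rewrite exprMn; set P := Pibar _ _; set A := y ^+ 2; set B := V _; nra.
(* Induction on a number k of doublings that lead from y past z. *)
have key k : forall y z, 0 < y -> y <= z -> z < y0 -> z < 2 ^+ k * y ->
    z / (2 * y) * q z ^+ N.+1 <= q y ^+ N.+1.
  elim: k => [|k IH] y z yp yz zy0 zk.
    by move: zk; rewrite expr0 mul1r ltNge yz.
  have y2 : 0 < 2 * y by rewrite mulr_gt0.
  have qz0 : 0 <= q z ^+ N.+1 by rewrite exprn_ge0// Qmoment_ge0.
  have [z2|z2] := ltP z (2 * y).
    apply: (@le_trans _ _ (q z ^+ N.+1)).
      by rewrite ler_piMl// ler_pdivrMr// mul1r ltW.
    by rewrite lerXn2r ?nnegrE ?Qmoment_ge0// Qmoment_le.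
  have h1 := IH (2 * y) z y2 z2 zy0.
  have h2 : q (2 * y) ^+ N.+1 <= 2^-1 * q y ^+ N.+1.
    apply: (@le_trans _ _ ((theta * q y) ^+ N.+1)).
      have := dbl y yp (le_lt_trans yz zy0) => h.
      by rewrite lerXn2r ?nnegrE ?Qmoment_ge0// (le_trans _ h)// Qmoment_ge0.
    by rewrite exprMn ler_wpM2r// exprn_ge0// Qmoment_ge0.
  have {h1} : z / (2 * (2 * y)) * q z ^+ N.+1 <= q (2 * y) ^+ N.+1.
    by apply: h1; rewrite mulrA -exprSr.
  have -> : z / (2 * y) * q z ^+ N.+1 = 2 * (z / (2 * (2 * y)) * q z ^+ N.+1).
    by field; rewrite gt_eqF.
  lra.
move=> y z yp yz zy0; apply: (key (Num.truncn (z / y)).+1) => //.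
rewrite -ltr_pdivrMr//; apply: (lt_trans (truncnS_gt _)).
by rewrite -natrX ltr_nat ltn_expl.
Qed.

(** [Umoment_increment] makes U Lipschitz on ]x/2, 2x[, where the tails are at most
    [Pibar Pi (x / 2)]. *)
Lemma Umoment_continuous (x : R) : 0 < x -> {for x, continuous U}.
Proof.
move=> x0; have x2 : 0 < x / 2 by rewrite divr_gt0.
have P0 := Pibar_ge0 Pi (x / 2).
have lip y z : x / 2 < y -> y <= z -> z < 2 * x ->
    `|U z - U y| <= 4 * x * Pibar Pi (x / 2) * `|z - y|.
  move=> xy yz zx; have y0 := lt_trans x2 xy.
  have h1 := Umoment_increment hPi y0 yz; have h2 := Umoment_le hPi y0 yz.
  have h3 : Pibar Pi y <= Pibar Pi (x / 2).
    rewrite fine_le ?tail_fin_num// le_measure ?inE//.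
    by move=> w /=; rewrite !in_itv/= !andbT; exact: lt_trans.
  rewrite !ger0_norm ?subr_ge0//.
  have h4 : (z ^+ 2 - y ^+ 2) * Pibar Pi y <= 4 * x * (z - y) * Pibar Pi (x / 2).
    apply: ler_pM => //.
    - have : 0 <= (z - y) * (z + y) by rewrite mulr_ge0//; lra.
      by nra.
    - exact: Pibar_ge0.
    - have : 0 <= (z - y) * (4 * x - z - y) by rewrite mulr_ge0//; lra.
      by nra.
  have -> : 4 * x * Pibar Pi (x / 2) * (z - y) = 4 * x * (z - y) * Pibar Pi (x / 2) by ring.
  by apply: le_trans h4; rewrite lerBlDl.
set L := 4 * x * Pibar Pi (x / 2) in lip.
have L0 : 0 <= L by rewrite /L !mulr_ge0// ltW.
apply/cvgrPdist_le => e e0; near=> y.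
have yx : x / 2 < y < 2 * x.
  apply/andP; split; near: y; [apply: lt_nbhsr|apply: lt_nbhsl]; lra.
have h : `|U x - U y| <= L * `|x - y|.
  have [xy|/ltW xy] := leP x y; last by apply: lip => //; case/andP: yx => // *; lra.
  rewrite distrC (distrC x); apply: lip => //; first lra.
  by case/andP: yx.
apply: (le_trans h); have : `|x - y| <= e / (L + 1).
  near: y; apply: cvgr_dist_le; [exact: cvg_id|by rewrite divr_gt0// ltr_wpDl].
rewrite ler_pdivlMr ?ltr_wpDl// => h2.
by apply: le_trans h2; rewrite mulrC ler_wpM2l// lerDl.
Unshelve. all: by end_near. Qed.

Lemma Qmoment_continuous (x : R) : 0 < x -> {for x, continuous q}.
Proof.
move=> x0; apply: continuousM; last exact: Umoment_continuous.
by apply: continuousV; [rewrite expf_neq0// gt_eqF|exact: exprn_continuous].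
Qed.

(** [cfun] is a choice, so its equation must be shown solvable: q is continuous, lies below 1 / t at
    a fixed z once t is small, and exceeds 1 / t close to 0 by its power growth. *)
Lemma cfun_spec : stochastically_compact0 Pi -> exists2 t0 : R, 0 < t0 &
  forall t, 0 < t < t0 -> 0 < cfun Pi t /\ t * q (cfun Pi t) = 1.
Proof.
move=> hSC; have [C [y0 [N [C0 y00 CV qpow]]]] := sc_regular hSC.
pose z := y0 / 2; have z0 : 0 < z by rewrite divr_gt0.
have zy : z < y0 by rewrite /z; lra.
have qz : 0 < q z.
  rewrite /q mulr_gt0 ?invr_gt0 ?exprn_gt0//.
  exact: lt_le_trans (sc_Vmoment_gt0 hSC z0) (Vmoment_le_Umoment hPi z0).
exists (q z)^-1; first by rewrite invr_gt0.
move=> t /andP[t0 tq].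
suff [c [c0 tc]] : exists c, 0 < c /\ t * q c = 1.
  have h : exists c, [set z : R | 0 < z /\ t * QPi Pi z = 1] c.
    by exists c; split => //; rewrite QPiE.
  have [h1 h2] := xgetPex 0 h; split => //.
  by rewrite -[q _](QPiE hPi h1).
have qt : q z < t^-1 by rewrite -[ltLHS]invrK ltf_pV2 ?posrE ?invr_gt0.
(* The solution of [z / (2 * y) * q z ^+ N.+1 = t^-1 ^+ N.+1], for which the growth of q gives
   [t^-1 <= q y]. *)
pose y := z / 2 * (q z * t) ^+ N.+1.
have qt0 : 0 < (q z * t) ^+ N.+1 by rewrite exprn_gt0// mulr_gt0.
have yp : 0 < y by rewrite /y mulr_gt0// divr_gt0.
have qt1 : (q z * t) ^+ N.+1 <= 1.
  apply: exprn_ile1; first by rewrite mulr_ge0// ltW.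
  by rewrite -ler_pdivlMr// mul1r ltW.
have yz : y <= z.
  by rewrite /y -mulrA ler_piMr ?(ltW z0)// (le_trans (ler_wpM2l _ qt1))//; lra.
have qy : t^-1 <= q y.
  have := qpow y z yp yz zy.
  have -> : z / (2 * y) * q z ^+ N.+1 = t^-1 ^+ N.+1.
    rewrite /y exprMn exprVn; field.
    by rewrite !expf_neq0 ?gt_eqF.
  by rewrite ler_pXn2r// nnegrE ?Qmoment_ge0// invr_ge0 ltW.
have cq : {within `[y, z], continuous q}.
  apply: continuous_in_subspaceT => x; rewrite inE/= in_itv/= => /andP[yx _].
  by apply: Qmoment_continuous; exact: lt_le_trans yx.
have [|c] := IVT yz cq (v := t^-1).
  by rewrite ge_min (ltW qt) orbT/= le_max qy.
rewrite in_itv/= => /andP[yc _] qc; exists c; split; first exact: lt_le_trans yc.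
by rewrite qc divff// gt_eqF.
Qed.

End StochasticCompactness.

(** * The saddlepoint *)

Section Saddlepoint.
Context {R : realType} (b : R) (Pi : {measure set R -> \bar R}).
Hypothesis hPi : levy_measure Pi.

Local Notation D0 := (`]0%R, +oo[%classic : set R).

Lemma cvg0_harmonic (f : nat -> R) (c : R) : (forall n, `|f n| <= c / n.+1%:R) ->
  f @ \oo --> 0.
Proof.
move=> fc; apply/norm_cvg0P; apply: (@squeeze_cvgr _ _ _ _ (fun=> 0) (fun n => c / n.+1%:R)).
- by apply: nearW => n; rewrite normr_ge0 fc.
- exact: cvg_cst.
- by rewrite -(mulr0 c); exact: (cvgM (cvg_cst c) (@cvg_harmonic R)).
Qed.

Lemma dpsi_le (u v : R) : 0 < u -> u <= v -> dpsi b Pi v <= dpsi b Pi u.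
Proof.
move=> u0 uv; have v0 := lt_le_trans u0 uv.
rewrite lerD2l; apply: le_Rintegral => //; [exact: levy_y_integrable|exact: levy_y_integrable|].
by move=> y /in_D0 y0; rewrite ler_pM2l// ler_expR lerN2 ler_pM2r.
Qed.

(** On ]0, c[ the weight y is at least [y^2 / c], and the exponential at least its value at c. *)
Lemma dpsi_ge (u c : R) : 0 < u -> 0 < c ->
  expR (- (u * c)) / c * Vmoment Pi c <= dpsi b Pi u - b.
Proof.
move=> u0 c0; rewrite /dpsi addrC addKr; apply: Vmoment_weighted => //.
- by rewrite divr_ge0 ?expR_ge0// ltW.
- exact: levy_y_integrable.
- by move=> y yp; rewrite mulr_ge0 ?expR_ge0// ltW.
- move=> y /andP[yp yc].
  have -> : expR (- (u * c)) / c * y ^+ 2 = y * (expR (- (u * c)) * (y / c)).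
    by field; rewrite gt_eqF.
  rewrite ler_pM2l//; apply: (@le_trans _ _ (expR (- (u * c)))).
    by rewrite ler_piMr ?expR_ge0// ler_pdivrMr// mul1r ltW.
  by rewrite ler_expR lerN2 ler_pM2l// ltW.
Qed.

Lemma dpsi_gt (u z : R) : 0 < u -> 0 < z -> 0 < Vmoment Pi z -> b < dpsi b Pi u.
Proof.
move=> u0 z0 V0; rewrite -subr_gt0; apply: lt_le_trans (dpsi_ge u0 z0).
by rewrite !mulr_gt0 ?invr_gt0 ?expR_gt0.
Qed.

Lemma dpsi_cvg : (fun n : nat => dpsi b Pi n.+1%:R) @ \oo --> b.
Proof.
rewrite -[X in _ --> X]addr0; apply: cvgD; first exact: cvg_cst.
have I0 : \int[Pi]_(y in D0) (0 : R) = 0 by rewrite Rintegral_cst// mul0r.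
rewrite -[X in _ --> X]I0.
apply: (@dominated_cvg_Rintegral _ _ _ Pi D0
  (fun n y => y * expR (- (n.+1%:R * y))) (fun=> 0) (fun y => y * expR (- (1 * y)))) => //.
- by move=> n; apply: measurable_funTS; measurability.
- move=> y /in_D0 y0; apply: (@cvg0_harmonic _ 1) => n.
  rewrite ger0_norm ?mulr_ge0 ?expR_ge0 ?(ltW y0)// ler_pdivlMr//.
  have := @pow_expRN_le R 1 (n.+1%:R * y); rewrite expr1 => h.
  have {}h : n.+1%:R * y * expR (- (n.+1%:R * y)) <= 1 by exact: h (mulr_ge0 (ler0n _ _) (ltW y0)).
  by rewrite mulrC mulrA.
- exact: levy_y_integrable.
- move=> n y /in_D0 y0; rewrite ger0_norm ?mulr_ge0 ?expR_ge0 ?(ltW y0)//.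
  by rewrite ler_pM2l// ler_expR lerN2 ler_pM2r// ler1n.
Qed.

Lemma psi_cvg0 : (fun n : nat => psi b Pi n.+1%:R^-1) @ \oo --> 0.
Proof.
rewrite -[X in _ --> X]addr0; apply: cvgD.
  apply: (@cvg0_harmonic _ `|b|) => n; rewrite normrM.
  by rewrite (ger0_norm (_ : 0 <= n.+1%:R^-1)) ?invr_ge0.
have I0 : \int[Pi]_(y in D0) (0 : R) = 0 by rewrite Rintegral_cst// mul0r.
rewrite -[X in _ --> X]I0.
apply: (@dominated_cvg_Rintegral _ _ _ Pi D0
  (fun n y => 1 - expR (- (n.+1%:R^-1 * y))) (fun=> 0) (fun y => 1 - expR (- (1 * y)))) => //.
- by move=> n; apply: measurable_funTS; measurability.
- move=> y /in_D0 y0; apply: (@cvg0_harmonic _ y) => n.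
  have ny : 0 <= n.+1%:R^-1 * y by rewrite mulr_ge0 ?invr_ge0// ltW.
  by rewrite ger0_norm ?subr_ge0 ?expRN_le1// mulrC onem_expRN_le.
- exact: levy_onem_exp_integrable.
- move=> n y /in_D0 y0.
  have ny : 0 <= n.+1%:R^-1 * y by rewrite mulr_ge0 ?invr_ge0// ltW.
  rewrite ger0_norm ?subr_ge0 ?expRN_le1// lerD2l lerN2 ler_expR lerN2.
  by rewrite ler_pM2r// invf_le1// ler1n.
Qed.

(** The derivative is available at positive points only, so the mean value theorem is applied on
    [1/(n+1), u], and [psi_cvg0] lets the left end go to 0. *)
Lemma psi_le_linear (s : R) : (forall u, 0 < u -> dpsi b Pi u <= s) ->
  forall u, 0 < u -> psi b Pi u <= s * u.
Proof.
move=> ds u u0.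
have h (n : nat) : n.+1%:R^-1 <= u ->
    psi b Pi u - psi b Pi n.+1%:R^-1 <= s * (u - n.+1%:R^-1).
  move=> nu; have n0 : 0 < n.+1%:R^-1 :> R by rewrite invr_gt0.
  have [c /andP[nc _] ->] := @mean_value _ (psi b Pi) (dpsi b Pi) _ _ nu
    (fun x hx => is_derive_psi b hPi (lt_le_trans n0 (andP hx).1)).
  by rewrite ler_wpM2r ?subr_ge0// ds// (lt_le_trans n0).
rewrite -[leLHS]subr0 -[u in leRHS]subr0.
apply: (ler_cvg_to (cvgB (cvg_cst (psi b Pi u)) psi_cvg0)
  (cvgM (cvg_cst s) (cvgB (cvg_cst u) (@cvg_harmonic R)))).
near=> n; apply: h; near: n.
have /cvgrPdist_le/(_ _ u0) := @cvg_harmonic R.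
by apply: filterS => n; rewrite sub0r normrN ger0_norm ?invr_ge0.
Unshelve. all: by end_near. Qed.

Lemma rho_spec (s u : R) : b < s -> 0 < u -> s < dpsi b Pi u ->
  0 < rho b Pi s /\ dpsi b Pi (rho b Pi s) = s.
Proof.
move=> bs u0 su.
suff [c [c0 sc]] : exists c, 0 < c /\ dpsi b Pi c = s.
  have h : exists c, [set u : R | 0 < u /\ derive1 (psi b Pi) u = s] c.
    by exists c; split => //; rewrite (is_derive_derive1 (is_derive_psi b hPi c0)).
  have [h1 h2] := xgetPex 0 h; split => //.
  by rewrite -[RHS]h2 (is_derive_derive1 (is_derive_psi b hPi h1)).
have [n sn un] : exists2 n : nat, dpsi b Pi n.+1%:R < s & u <= n.+1%:R.
  near \oo => n; exists n.
    near: n; have := dpsi_cvg => /cvgrPdist_lt/(_ (s - b)).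
    rewrite subr_gt0 => /(_ bs); apply: filterS => n.
    rewrite ltr_distlC => /andP[_]; lra.
  near: n; exists (Num.truncn u) => // n /= un.
  by rewrite (le_trans (ltW (truncnS_gt u)))// ler_nat.
have cont : {within `[u, n.+1%:R], continuous (dpsi b Pi)}.
  apply: continuous_in_subspaceT => x; rewrite inE/= in_itv/= => /andP[ux _].
  exact: is_derive_continuous (is_derive_dpsi b hPi (lt_le_trans u0 ux)).
have [|c] := IVT un cont (v := s).
  by rewrite ge_min (ltW sn) orbT/= le_max (ltW su).
rewrite in_itv/= => /andP[uc _] dc; exists c; split => //.
exact: lt_le_trans uc.
Unshelve. all: by end_near. Qed.

End Saddlepoint.

(** * Laws with a given Laplace transform, and their mean *)

Section Law.
Context {R : realType} (b : R) (Pi : {measure set R -> \bar R}).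
Hypothesis hPi : levy_measure Pi.
Variables (m : probability R R) (t : R).

Local Notation D1 := (`[0%R, +oo[%classic : set R).

Definition has_laplace_transform : Prop := m (`]-oo, 0%R[%classic) = 0%E /\
  forall u, 0 <= u -> \int[m]_(x in `[0, +oo[) expR (- (u * x)) = expR (- (t * psi b Pi u)).

Lemma in_D1 (y : R) : D1 y -> 0 <= y.
Proof. by rewrite /= in_itv/= andbT. Qed.

Lemma law_integrable (f : R -> R) (c : R) : measurable_fun setT f ->
  (forall x, 0 <= x -> `|f x| <= c) -> m.-integrable D1 (EFin \o f).
Proof.
move=> mf fc; apply: (@integrable_le _ _ _ m D1 f (cst c)) => //.
- exact: measurable_funTS.
- exact: (finite_measure_integrable_cst m c).
- by move=> x /in_D1; exact: fc.
Qed.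

(** If X has law m, [n (1 - E exp(-X/n)) <= n t psi(1/n) <= t s], and Fatou's lemma lets n tend to
    infinity. Contrapositively, a number below the mean is exceeded by some [t * dpsi u], whence the
    saddlepoint. *)
Lemma law_mean_le (s : R) : has_laplace_transform -> 0 <= t ->
  (forall u, 0 < u -> dpsi b Pi u <= s) ->
  (\int[m]_(x in D1) x%:E <= (t * s)%:E)%E.
Proof.
move=> [_ hL] t0 ds.
pose f (n : nat) (x : R) : \bar R := (n.+1%:R * (1 - expR (- (n.+1%:R^-1 * x))))%:E.
have n0 (n : nat) : 0 < n.+1%:R^-1 :> R by rewrite invr_gt0.
have mf n : measurable_fun D1 (f n).
  by apply/measurable_EFinP; apply: measurable_funTS; measurability.
have f0 n x : D1 x -> (0 <= f n x)%E.
  move=> /in_D1 x0; rewrite lee_fin mulr_ge0// subr_ge0 expRN_le1//.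
  by rewrite mulr_ge0// ltW.
have lim x : D1 x -> f n x @[n --> \oo] --> x%:E.
  move=> /in_D1 x0; apply: cvg_EFin; first exact: nearW.
  rewrite -[x in _ --> x]subr0.
  have -> : (fine \o f ^~ x) = (fun n : nat => x - (x - fine (f n x))).
    by apply/funext => n /=; ring.
  apply: cvgB; first exact: cvg_cst.
  apply: (@cvg0_harmonic _ _ (x ^+ 2)) => n /=; set e := n.+1%:R^-1.
  have ex : 0 <= e * x by rewrite mulr_ge0// ltW// n0.
  have -> : x - n.+1%:R * (1 - expR (- (e * x))) =
      n.+1%:R * (e * x - (1 - expR (- (e * x)))).
    by rewrite /e; field; rewrite gt_eqF.
  rewrite ger0_norm ?mulr_ge0 ?subr_ge0 ?onem_expRN_le//.
  have h : e * x - (1 - expR (- (e * x))) <= (e * x) ^+ 2.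
    rewrite -subr_ge0; apply: (@derive_ge0_ge0 _ (fun y => y ^+ 2 - (y - (1 - expR (- y))))
      (fun y => 2 * y - (1 - expR (- y)))) => //.
    + by rewrite oppr0 expR0; ring.
    + by move=> y _; derives; ring.
    + by move=> y y0; have := onem_expRN_le y; lra.
  apply: (@le_trans _ _ (n.+1%:R * (e * x) ^+ 2)); first by rewrite ler_pM2l.
  by rewrite /e le_eqVlt; apply/orP; left; apply/eqP; field; rewrite gt_eqF.
have intf n : (\int[m]_(x in D1) f n x <= (t * s)%:E)%E.
  have i1 : m.-integrable D1 (EFin \o (fun x => n.+1%:R * (1 - expR (- (n.+1%:R^-1 * x))))).
    apply: (@law_integrable _ n.+1%:R); first by measurability.
    move=> x x0; rewrite normrM (ger0_norm (ler0n _ _)) ler_piMr//.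
    have nx : 0 <= n.+1%:R^-1 * x by rewrite mulr_ge0 ?(ltW (n0 n)).
    rewrite ger0_norm ?subr_ge0 ?expRN_le1//.
  rewrite -[leLHS]fineK; last exact: integrable_fin_num.
  rewrite lee_fin -/(Rintegral _ _ _).
  have ie u : 0 <= u -> m.-integrable D1 (EFin \o (fun x => expR (- (u * x)))).
    move=> u0; apply: (@law_integrable _ 1); first by measurability.
    by move=> x x0; rewrite ger0_norm ?expR_ge0 ?expRN_le1 ?mulr_ge0.
  have i01 : m.-integrable D1 (EFin \o (fun x => 1 : R)).
    exact: (finite_measure_integrable_cst m 1).
  have i2 := ie _ (ltW (n0 n)).
  rewrite RintegralZl//; last exact: integrable_sub.
  rewrite RintegralB// hL ?(ltW (n0 n))//.
  have -> : \int[m]_(x in D1) (1 : R) = 1.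
    have := hL 0 (lexx _); rewrite (psi0 b Pi) mulr0 oppr0 expR0 => {2}<-.
    by apply: eq_Rintegral => x _; rewrite mul0r oppr0 expR0.
  have h1 := psi_le_linear hPi ds (n0 n).
  have := onem_expRN_le (t * psi b Pi n.+1%:R^-1) => h2.
  by rewrite mulrC -ler_pdivlMr// -mulrA; exact: (le_trans h2 (ler_wpM2l t0 h1)).
rewrite (eq_integral (fun x => limn_einf (fun n => f n x))); last first.
  by move=> x /set_mem Dx; have [<- _] := cvg_limn_einf_sup (lim x Dx).
apply: (le_trans (fatou m _ mf f0)) => //.
rewrite limn_einf_lim; apply: lime_le; first exact: is_cvg_einfs.
apply: nearW => n; apply: le_trans (intf n).
by apply: ereal_inf_lbound; exists n => /=.
Qed.

End Law.

(** * The law on vertical lines *)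

Section Bernstein.
Context {R : realType}.
Implicit Types (f g : nat -> R) (x : R).

(* The mean of [f] under the binomial law of parameters [n] and ['X]. *)
Fixpoint bernstein n f : {poly R} :=
  if n is n'.+1 then (1 - 'X) * bernstein n' f + 'X * bernstein n' (f \o succn)
  else (f 0%N)%:P.

Lemma bernsteinS n f x : (bernstein n.+1 f).[x] =
  (1 - x) * (bernstein n f).[x] + x * (bernstein n (f \o succn)).[x].
Proof. by rewrite /= !hornerE. Qed.

Lemma bernstein_le n f g x : 0 <= x <= 1 -> (forall k, f k <= g k) ->
  (bernstein n f).[x] <= (bernstein n g).[x].
Proof.
move=> /andP[x0 x1]; elim: n f g => [|n IH] f g fg; first by rewrite /= !hornerE.
rewrite !bernsteinS lerD// ler_wpM2l ?subr_ge0//; apply: IH => // k.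
exact: fg.
Qed.

Lemma bernstein_sub n (c : R) f x :
  (bernstein n (fun k => c - f k)).[x] = c - (bernstein n f).[x].
Proof.
elim: n f => [|n IH] f; first by rewrite /= !hornerE.
rewrite !bernsteinS IH (_ : (fun k => c - f k) \o succn = (fun k => c - (f \o succn) k))//.
by rewrite IH; ring.
Qed.

(** The second moment of a binomial variable. The shift e is general because [succn] turns [k + e]
    into [k + (1 + e)] in the induction. *)
Lemma bernstein_quad n (c d e x : R) :
  (bernstein n (fun k => c + d * (k%:R + e) ^+ 2)).[x] =
  c + d * (n%:R * x * (1 - x) + (n%:R * x + e) ^+ 2).
Proof.
elim: n e => [|n IH] e; first by rewrite /= !hornerE; ring.
rewrite bernsteinS IH.
rewrite (_ : _ \o succn = (fun k => c + d * (k%:R + (1 + e)) ^+ 2)); last first.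
  by apply/funext => k /=; rewrite -natr1; ring.
by rewrite IH -natr1; ring.
Qed.

(** Bernstein's argument: [|a| <= delta + a^2 / delta] makes the Lipschitz bound quadratic in
    [a = x - k/n], and its binomial mean is then given by the variance [x (1 - x) / n]. *)
Lemma lipschitz_poly_approx (g : R -> R) (L e : R) :
  (forall x y, 0 <= x -> 0 <= y -> `|g x - g y| <= L * `|x - y|) -> 0 < e ->
  exists p : {poly R}, forall x, 0 <= x <= 1 -> `|g x - p.[x]| <= e.
Proof.
move=> gL e0; have L0 : 0 <= L.
  have := gL 1 0 ler01 (lexx _); rewrite subr0 normr1 mulr1; exact: le_trans.
(* The two error terms are [L delta] and [L / (delta n)], each made at most e / 2; [L + 1] avoids a
   division by 0. *)
pose delta := e / (2 * (L + 1)); have d0 : 0 < delta by rewrite divr_gt0//; lra.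
have Ld : L * delta <= e / 2.
  have -> : e / 2 = (L + 1) * delta by rewrite /delta; field; lra.
  by rewrite ler_pM2r//; lra.
pose n := (Num.truncn (2 * L / (delta * e))).+1.
have n0 : 0 < n%:R :> R by [].
have dd0 : delta != 0 by rewrite gt_eqF.
have nn0 : n%:R != 0 :> R by rewrite gt_eqF.
have nL : L / (delta * n%:R) <= e / 2.
  have de0 : 0 < delta * e by rewrite mulr_gt0.
  have dn0 : 0 < delta * n%:R by rewrite mulr_gt0.
  have := truncnS_gt (2 * L / (delta * e)); rewrite -/n (ltr_pdivrMr _ _ de0) => h.
  by rewrite (ler_pdivrMr _ _ dn0); lra.
exists (bernstein n (fun k => g (k%:R / n%:R))) => x x01.
rewrite -bernstein_sub.
have bnd k : `|g x - g (k%:R / n%:R)| <=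
    L * delta + L / delta / n%:R ^+ 2 * (k%:R + - (n%:R * x)) ^+ 2.
  case/andP: x01 => x0 x1; apply: (le_trans (gL _ _ x0 _)); first by rewrite divr_ge0.
  have -> : L * delta + L / delta / n%:R ^+ 2 * (k%:R + - (n%:R * x)) ^+ 2 =
    L * (delta + `|x - k%:R / n%:R| ^+ 2 / delta).
    by rewrite real_normK ?num_real//; field; rewrite ?dd0 ?nn0.
  rewrite ler_wpM2l//; set a := `|_|; have a0 : 0 <= a by exact: normr_ge0.
  have [ad|da] := leP a delta; first by rewrite (le_trans ad)// lerDl divr_ge0 ?sqr_ge0// ltW.
  apply: (@le_trans _ _ (a ^+ 2 / delta)); last by rewrite lerDr ltW.
  by rewrite ler_pdivlMr// expr2 ler_wpM2l// ltW.
have fin : L * delta + L / delta / n%:R ^+ 2 *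
    (n%:R * x * (1 - x) + (n%:R * x + - (n%:R * x)) ^+ 2) <= e.
  have -> : L * delta + L / delta / n%:R ^+ 2 *
    (n%:R * x * (1 - x) + (n%:R * x + - (n%:R * x)) ^+ 2) =
    L * delta + L / (delta * n%:R) * (x * (1 - x)) by field; rewrite ?dd0 ?nn0.
  have a0 : 0 <= L / (delta * n%:R) by rewrite divr_ge0// mulr_ge0// ltW.
  have : x * (1 - x) <= 1 by case/andP: x01 => x0 x1; nra.
  by move=> h; have := ler_wpM2l a0 h; lra.
rewrite ler_norml; apply/andP; split; last first.
  apply: le_trans fin; rewrite -bernstein_quad; apply: bernstein_le => // k.
  by apply: le_trans (bnd k); rewrite ler_norm.
rewrite lerNl; apply: le_trans fin; rewrite -[leLHS]add0r -[0 - _]/(0 - _) -bernstein_sub.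
rewrite -bernstein_quad; apply: bernstein_le => // k.
by apply: le_trans (bnd k); rewrite sub0r -normrN ler_norm.
Qed.

End Bernstein.

(** * The size-bias identity *)

Section SizeBias.
Context {R : realType} (b : R) (Pi : {measure set R -> \bar R}).
Hypothesis hPi : levy_measure Pi.
Variables (m : probability R R) (t : R).
Hypothesis hm : has_laplace_transform b Pi m t.

Local Notation D0 := (`]0%R, +oo[%classic : set R).
Local Notation D1 := (`[0%R, +oo[%classic : set R).

Let mD0 : measurable D0. Proof. exact: measurable_itv. Qed.
Let mD1 : measurable D1. Proof. exact: measurable_itv. Qed.

Lemma law_total : fine (m D1) = 1.
Proof.
have [m0 _] := hm; have -> : m D1 = 1%E; last by [].
have D1C : ~` D1 = `]-oo, 0%R[%classic by rewrite setCitvr.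
have := probability_setC m (measurableC mD1); rewrite setCK => ->.
by rewrite D1C m0 sube0.
Qed.

Lemma law_x_exp_integrable (u c : R) (g : R -> R) : 0 < u -> measurable_fun setT g ->
  (forall x, 0 <= x -> `|g x| <= c) ->
  m.-integrable D1 (EFin \o (fun x => x * expR (- (u * x)) * g x)).
Proof.
move=> u0 mg gc; apply: (@law_integrable _ _ _ (u^-1 * c)); first by measurability.
move=> x x0; rewrite normrM; apply: ler_pM => //; last exact: gc.
rewrite ger0_norm ?mulr_ge0 ?expR_ge0//.
have ux : 0 <= u * x by rewrite mulr_ge0// ltW.
have := @pow_expRN_le R 1 (u * x) ux; rewrite expr1 => h.
have {}h : u * x * expR (- (u * x)) <= 1 by exact: h.
by rewrite -(ler_pM2l u0) mulrA mulfV// gt_eqF.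
Qed.

Lemma law_exp_integrable (u c : R) (g : R -> R) : 0 <= u -> measurable_fun setT g ->
  (forall x, 0 <= x -> `|g x| <= c) ->
  m.-integrable D1 (EFin \o (fun x => expR (- (u * x)) * g x)).
Proof.
move=> u0 mg gc; apply: (@law_integrable _ _ _ c); first by measurability.
move=> x x0; rewrite normrM -[leRHS]mul1r; apply: ler_pM => //; last exact: gc.
by rewrite ger0_norm ?expR_ge0 ?expRN_le1 ?mulr_ge0.
Qed.

Lemma law_x_exp_integrable1 (u : R) : 0 < u ->
  m.-integrable D1 (EFin \o (fun x => x * expR (- (u * x)))).
Proof.
move=> u0; have := @law_x_exp_integrable u 1 (cst 1) u0 (measurable_cst _).
have h : forall x : R, 0 <= x -> `|cst (1 : R) x| <= 1 by move=> x _; rewrite normr1.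
by move=> /(_ h); apply: eq_integrable => // x _ /=; rewrite mulr1.
Qed.

Lemma law_exp_integrable1 (u : R) : 0 <= u ->
  m.-integrable D1 (EFin \o (fun x => expR (- (u * x)))).
Proof.
move=> u0; have := @law_exp_integrable u 1 (cst 1) u0 (measurable_cst _).
have h : forall x : R, 0 <= x -> `|cst (1 : R) x| <= 1 by move=> x _; rewrite normr1.
by move=> /(_ h); apply: eq_integrable => // x _ /=; rewrite mulr1.
Qed.

Lemma size_bias_exp (u : R) : 0 < u ->
  \int[m]_(x in `[0, +oo[) (x * expR (- (u * x))) =
  t * dpsi b Pi u * expR (- (t * psi b Pi u)).
Proof.
move=> u0; have [_ hL] := hm.
have d1 : is_derive u 1 (fun u => \int[m]_(x in `[0, +oo[) expR (- (u * x)))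
    (\int[m]_(x in `[0, +oo[) (- (x * expR (- (u * x))))).
  apply: (@is_derive_Rintegral _ _ _ m D1 (fun u x => expR (- (u * x)))
    (fun u x => - (x * expR (- (u * x)))) (fun x => x * expR (- (u / 2 * x))) (u / 2) (u + 1)) => //.
  - by apply/andP; split; lra.
  - by move=> v /andP[uv _]; apply: law_exp_integrable1; lra.
  - by move=> v x _ _; derives; ring.
  - by apply: law_x_exp_integrable1; lra.
  - move=> v x /andP[uv _] /in_D1 x0; rewrite normrN ger0_norm ?mulr_ge0 ?expR_ge0//.
    by rewrite ler_wpM2l// ler_expR lerN2 ler_wpM2r// ltW.
have d2 : is_derive u 1 (fun u => expR (- (t * psi b Pi u)))
    (- (t * dpsi b Pi u) * expR (- (t * psi b Pi u))).
  have h := is_derive_psi b hPi u0.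
  apply: (is_derive_eq (is_derive_expf (is_derive_opp (is_derive_mul (is_derive_const t u) h)))).
  by rewrite mul0r add0r.
have d3 : is_derive u 1 (fun u => \int[m]_(x in `[0, +oo[) expR (- (u * x)))
    (- (t * dpsi b Pi u) * expR (- (t * psi b Pi u))).
  apply: near_eq_is_derive d2; near=> v; rewrite hL//.
  by apply/ltW; near: v; exact: lt_nbhsr.
have := is_derive_derive1 d1; rewrite (is_derive_derive1 d3) => h.
rewrite -[LHS]opprK -[RHS]opprK; congr (- _).
rewrite -[RHS]mulNr h -mulN1r -RintegralZl//.
  by apply: eq_Rintegral => x _; rewrite mulN1r.
exact: law_x_exp_integrable1.
Unshelve. all: by end_near. Qed.

Section Fixed.
Variable h : R.
Hypothesis h0 : 0 < h.

(** The weight exp(-h(x + y)) of the test function is split between x and the jump y: with the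
    factor exp(-hy), [y Pi(dy)] becomes a finite measure and bounded G are admissible. *)
Definition jump_mean (G : R -> R) (x : R) : R :=
  b * G x + \int[Pi]_(y in `]0, +oo[) (y * expR (- (h * y)) * G (x + y)).

(* The law [x m(dx)] is [t (b delta_0 + y Pi(dy)) * m], tested on [exp(-hx) G(x)]. *)
Record size_biased (G : R -> R) : Prop := SizeBiased {
  sb_measurable : measurable_fun setT G ;
  sb_bounded : exists c, forall x, 0 <= x -> `|G x| <= c ;
  sb_jump_measurable : measurable_fun D1 (jump_mean G) ;
  sb_eq : \int[m]_(x in `[0, +oo[) (x * expR (- (h * x)) * G x) =
    t * \int[m]_(x in `[0, +oo[) (expR (- (h * x)) * jump_mean G x) }.

Lemma levy_y_bounded_integrable (c : R) (g : R -> R) : measurable_fun setT g ->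
  (forall y, 0 < y -> `|g y| <= c) ->
  Pi.-integrable D0 (EFin \o (fun y => y * expR (- (h * y)) * g y)).
Proof.
move=> mg gc; apply: (@integrable_le _ _ _ Pi D0 _ (fun y => c * (y * expR (- (h * y))))) => //.
- by apply: measurable_funTS; measurability.
- by apply: integrable_scale => //; exact: levy_y_integrable.
- move=> y /in_D0 y0; rewrite normrM mulrC (ger0_norm (mulr_ge0 (ltW y0) (expR_ge0 _))).
  by rewrite ler_wpM2r ?gc// mulr_ge0 ?expR_ge0 ?(ltW y0).
Qed.

Lemma jump_integrable (G : R -> R) (c x : R) : measurable_fun setT G ->
  (forall x, 0 <= x -> `|G x| <= c) -> 0 <= x ->
  Pi.-integrable D0 (EFin \o (fun y => y * expR (- (h * y)) * G (x + y))).
Proof.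
move=> mG Gc x0; apply: (@levy_y_bounded_integrable c (fun y => G (x + y))).
  apply: (@measurableT_comp _ _ _ _ _ _ G) => //; exact: measurable_funD.
by move=> y y0; apply: Gc; rewrite addr_ge0// ltW.
Qed.

Lemma jump_mean_dist (G P : R -> R) (c e x : R) :
  measurable_fun setT G -> measurable_fun setT P ->
  (forall x, 0 <= x -> `|G x| <= c) -> (forall x, 0 <= x -> `|P x| <= c) ->
  (forall x, 0 <= x -> `|G x - P x| <= e) -> 0 <= x ->
  `|jump_mean G x - jump_mean P x| <= (`|b| + (dpsi b Pi h - b)) * e.
Proof.
move=> mG mP Gc Pc GP x0; rewrite /jump_mean opprD addrACA -mulrBr.
apply: (le_trans (ler_normD _ _)); rewrite mulrDl; apply: lerD.
  by rewrite normrM ler_wpM2l// GP.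
have -> : dpsi b Pi h - b = \int[Pi]_(y in `]0, +oo[) (y * expR (- (h * y))).
  by rewrite /dpsi addrC addKr.
rewrite mulrC -RintegralZl//; last exact: levy_y_integrable.
apply: Rintegral_dist_le => //.
- exact: (jump_integrable mG Gc).
- exact: (jump_integrable mP Pc).
- by apply: integrable_scale => //; exact: levy_y_integrable.
- move=> y /in_D0 y0; rewrite -mulrBr normrM mulrC (ger0_norm (mulr_ge0 (ltW y0) (expR_ge0 _))).
  by rewrite ler_wpM2r ?mulr_ge0 ?expR_ge0 ?(ltW y0)// GP// addr_ge0// ltW.
Qed.

Lemma jump_mean_bounded (G : R -> R) (c x : R) : measurable_fun setT G ->
  (forall x, 0 <= x -> `|G x| <= c) -> 0 <= x ->
  `|jump_mean G x| <= (`|b| + (dpsi b Pi h - b)) * c.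
Proof.
move=> mG Gc x0; have c0 : 0 <= c by apply: le_trans (Gc 0 (lexx _)).
have h1 : measurable_fun setT (fun _ : R => 0 : R) by exact: measurable_cst.
have := @jump_mean_dist G (fun=> 0) c c x mG h1 Gc.
have -> : jump_mean (fun=> 0) x = 0.
  rewrite /jump_mean mulr0 add0r (_ : (fun _ => _) = cst 0); last first.
    by apply/funext => y; rewrite mulr0.
  by rewrite Rintegral_cst// mul0r.
rewrite subr0; apply => //; first by move=> y _; rewrite normr0.
by move=> y y0; rewrite subr0 Gc.
Qed.

Lemma jump_mean_integrable (G : R -> R) (c : R) : measurable_fun setT G ->
  (forall x, 0 <= x -> `|G x| <= c) -> measurable_fun D1 (jump_mean G) ->
  m.-integrable D1 (EFin \o (fun x => expR (- (h * x)) * jump_mean G x)).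
Proof.
move=> mG Gc mJ.
apply: (@integrable_le _ _ _ m D1 _ (cst ((`|b| + (dpsi b Pi h - b)) * c))) => //.
- by apply: measurable_funM => //; apply: measurable_funTS; measurability.
- exact: (finite_measure_integrable_cst m).
- move=> x /in_D1 x0; rewrite normrM -[leRHS]mul1r; apply: ler_pM => //.
    by rewrite ger0_norm ?expR_ge0 ?expRN_le1 ?mulr_ge0 ?(ltW h0).
  exact: jump_mean_bounded.
Qed.

(** Both sides are continuous for the supremum norm on [0, +oo[, since x exp(-hx) is integrable
    against m and y exp(-hy) against Pi. Measurability of [jump_mean G], an integral with a
    parameter, is a premise, met later by a closed form. *)
Lemma size_biased_lim (G : R -> R) : measurable_fun setT G ->
  (exists c, forall x, 0 <= x -> `|G x| <= c) -> measurable_fun D1 (jump_mean G) ->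
  (forall e, 0 < e -> exists2 P, size_biased P & forall x, 0 <= x -> `|G x - P x| <= e) ->
  size_biased G.
Proof.
move=> mG [c Gc] mJ approx; split => //; first by exists c.
set A := \int[m]_(x in _) _; set B := \int[m]_(x in _) _.
pose K := \int[m]_(x in D1) (x * expR (- (h * x))) + `|t| * (`|b| + (dpsi b Pi h - b)).
have Ih := law_x_exp_integrable1 h0.
suff key e : 0 < e -> `|A - t * B| <= K * e.
  apply/eqP; rewrite -subr_eq0 -normr_eq0.
  rewrite eq_le normr_ge0 andbT leNgt; apply/negP => AB.
  have K0 : 0 < K by have := lt_le_trans AB (key 1 ltr01); rewrite mulr1.
  have := key (`|A - t * B| / (2 * K)) (divr_gt0 AB (mulr_gt0 _ K0)).
  have -> : K * (`|A - t * B| / (2 * K)) = `|A - t * B| / 2 by field; rewrite gt_eqF.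
  by move=> /(_ (ltr0n _ 2)); lra.
move=> e0; have [P [mP [c' Pc] mJP eqP'] GP] := approx _ e0.
pose c2 := Num.max c c'.
have Gc2 x : 0 <= x -> `|G x| <= c2 by move=> x0; rewrite le_max Gc.
have Pc2 x : 0 <= x -> `|P x| <= c2 by move=> x0; rewrite le_max Pc// orbT.
have d1 : `|A - \int[m]_(x in D1) (x * expR (- (h * x)) * P x)| <=
    e * \int[m]_(x in D1) (x * expR (- (h * x))).
  rewrite -RintegralZl//; apply: Rintegral_dist_le => //.
  - exact: (law_x_exp_integrable h0 mG Gc).
  - exact: (law_x_exp_integrable h0 mP Pc).
  - exact: integrable_scale.
  - move=> x /in_D1 x0; rewrite -mulrBr normrM mulrC (ger0_norm (mulr_ge0 x0 (expR_ge0 _))).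
    by rewrite ler_wpM2r ?mulr_ge0 ?expR_ge0// GP.
have d2 : `|B - \int[m]_(x in D1) (expR (- (h * x)) * jump_mean P x)| <=
    (`|b| + (dpsi b Pi h - b)) * e.
  have -> : (`|b| + (dpsi b Pi h - b)) * e = \int[m]_(x in D1) ((`|b| + (dpsi b Pi h - b)) * e).
    rewrite Rintegral_cst// -[LHS]mulr1; congr (_ * _); apply/esym.
    exact: law_total.
  apply: Rintegral_dist_le => //.
  - exact: (jump_mean_integrable mG Gc).
  - exact: (jump_mean_integrable mP Pc).
  - exact: (finite_measure_integrable_cst m).
  - move=> x /in_D1 x0; rewrite -mulrBr normrM -[leRHS]mul1r; apply: ler_pM => //.
      by rewrite ger0_norm ?expR_ge0 ?expRN_le1 ?mulr_ge0 ?(ltW h0).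
    exact: (jump_mean_dist mG mP Gc2 Pc2 GP x0).
have -> : A - t * B = (A - \int[m]_(x in D1) (x * expR (- (h * x)) * P x)) -
    t * (B - \int[m]_(x in D1) (expR (- (h * x)) * jump_mean P x)).
  by rewrite eqP'; ring.
apply: (le_trans (ler_normB _ _)); rewrite /K mulrDl; apply: lerD; first by rewrite mulrC.
by rewrite normrM -mulrA ler_wpM2l.
Qed.

Lemma size_biased_scaleD (P Q : R -> R) (a : R) :
  size_biased P -> size_biased Q -> size_biased (fun x => P x + a * Q x).
Proof.
move=> [mP [c Pc] mJP eP] [mQ [c' Qc] mJQ eQ].
have JE x : 0 <= x -> jump_mean (fun x => P x + a * Q x) x =
    jump_mean P x + a * jump_mean Q x.
  move=> x0; rewrite /jump_mean.
  have iP := jump_integrable mP Pc x0; have iQ := jump_integrable mQ Qc x0.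
  have -> : \int[Pi]_(y in `]0, +oo[) (y * expR (- (h * y)) * (P (x + y) + a * Q (x + y))) =
    \int[Pi]_(y in `]0, +oo[) (y * expR (- (h * y)) * P (x + y)) +
    a * \int[Pi]_(y in `]0, +oo[) (y * expR (- (h * y)) * Q (x + y)).
    rewrite -RintegralZl// -RintegralD//; last exact: integrable_scale.
    by apply: eq_Rintegral => y _; ring.
  ring.
have iJP := jump_mean_integrable mP Pc mJP.
have iJQ := jump_mean_integrable mQ Qc mJQ.
split.
- by measurability.
- exists (c + `|a| * c') => x x0; apply: (le_trans (ler_normD _ _)); apply: lerD.
    exact: Pc.
  by rewrite normrM ler_wpM2l// Qc.
- apply: (@eq_measurable_fun _ _ _ _ _ (fun x => jump_mean P x + a * jump_mean Q x)).
    by move=> x /set_mem/in_D1 x0; rewrite JE.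
  by apply: measurable_funD => //; exact: measurable_funM.
- have -> : \int[m]_(x in `[0, +oo[) (x * expR (- (h * x)) * (P x + a * Q x)) =
    \int[m]_(x in `[0, +oo[) (x * expR (- (h * x)) * P x) +
    a * \int[m]_(x in `[0, +oo[) (x * expR (- (h * x)) * Q x).
    have i1 := law_x_exp_integrable h0 mP Pc; have i2 := law_x_exp_integrable h0 mQ Qc.
    rewrite -RintegralZl// -RintegralD//; last exact: integrable_scale.
    by apply: eq_Rintegral => y _; ring.
  rewrite eP eQ mulrCA -mulrDr; congr (_ * _).
  rewrite -RintegralZl// -RintegralD//; last exact: integrable_scale.
  by apply: eq_Rintegral => x /set_mem/in_D1 x0; rewrite JE//; ring.
Qed.

Lemma size_biased_exp (i : nat) : size_biased (fun x => expR (- (h * x)) ^+ i).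
Proof.
pose u := h * i.+1%:R; have u0 : 0 < u by rewrite mulr_gt0.
have E x : expR (- (h * x)) * expR (- (h * x)) ^+ i = expR (- (u * x)).
  rewrite -exprS -expRM_natl; congr expR; rewrite /u; ring.
have JE x : jump_mean (fun x => expR (- (h * x)) ^+ i) x =
    expR (- (h * x)) ^+ i * dpsi b Pi u.
  rewrite /jump_mean /dpsi mulrDr (mulrC b); congr (_ + _).
  rewrite -RintegralZl//; last exact: levy_y_integrable.
  apply: eq_Rintegral => y _; rewrite -E mulrDr opprD expRD exprMn; ring.
split.
- by measurability.
- exists 1 => x x0; rewrite normrX exprn_ile1//.
  by rewrite ger0_norm ?expR_ge0 ?expRN_le1 ?mulr_ge0 ?(ltW h0).
- by rewrite (funext JE); apply: measurable_funTS; measurability.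
- transitivity (t * dpsi b Pi u * expR (- (t * psi b Pi u))).
    rewrite -size_bias_exp//; apply: eq_Rintegral => x _; rewrite -E; ring.
  have [_ <-] := hm; last exact: ltW.
  rewrite -mulrA -RintegralZl//; last exact: law_exp_integrable1 (ltW _).
  by congr (_ * _); apply: eq_Rintegral => x _; rewrite JE -E; ring.
Qed.

Lemma size_biased_poly (p : {poly R}) : size_biased (fun x => p.[expR (- (h * x))]).
Proof.
have -> : (fun x => p.[expR (- (h * x))]) =
    (fun x => \sum_(i < size p) p`_i * expR (- (h * x)) ^+ i).
  by apply/funext => x; rewrite horner_coef.
elim: (size p) => [|n IH].
  (* The zero function, written as a difference of two equal functions. *)
  have := size_biased_scaleD (-1) (size_biased_exp 0) (size_biased_exp 0).
  congr size_biased; apply/funext => x; rewrite big_ord0; ring.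
have := size_biased_scaleD p`_n IH (size_biased_exp n).
by congr size_biased; apply/funext => x; rewrite big_ord_recr.
Qed.

End Fixed.
End SizeBias.

(** * Cosine and sine transforms of the law *)

Section TrigTransform.
Context {R : realType} (b : R) (Pi : {measure set R -> \bar R}).
Hypothesis hPi : levy_measure Pi.
Variables (m : probability R R) (t : R).
Hypothesis hm : has_laplace_transform b Pi m t.

Local Notation D0 := (`]0%R, +oo[%classic : set R).
Local Notation D1 := (`[0%R, +oo[%classic : set R).

Let mD0 : measurable D0. Proof. exact: measurable_itv. Qed.
Let mD1 : measurable D1. Proof. exact: measurable_itv. Qed.

(** In the variable [w = exp(-hx)], the function [exp(-hx) cos(vx + c)] reads
    [w cos(-(v/h) ln w + c)]. The cosine oscillates without limit at w = 0, but the factor w keeps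
    the derivative bounded, as the polynomial approximation requires. *)
Lemma mul_cos_ln_lipschitz (k c x y : R) : 0 <= x -> 0 <= y ->
  `|x * cos (k * ln x + c) - y * cos (k * ln y + c)| <= (1 + `|k|) * `|x - y|.
Proof.
move=> x0 y0; wlog xy : x y x0 y0 / x <= y.
  move=> wl; have [/wl|/ltW/wl h] := leP x y; first exact.
  by rewrite distrC (distrC x); exact: h.
have k0 : 0 <= `|k| by [].
move: x0; rewrite le_eqVlt => /predU1P[<-|x0].
  rewrite mul0r !sub0r !normrN normrM; apply: (@le_trans _ _ (`|y| * 1)).
    by rewrite ler_wpM2l// cos_max.
  by rewrite mulr1 ler_peMl// lerDl.
have dz z : x <= z <= y -> is_derive z 1 (fun z => z * cos (k * ln z + c))
    (cos (k * ln z + c) - k * sin (k * ln z + c)).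
  move=> /andP[xz _]; have z0 := lt_le_trans x0 xz.
  have dl := is_derive1_ln z0.
  apply: (is_derive_eq (is_derive_mul (is_derive_idfun z) (is_derive_cosf
    (is_derive_add (is_derive_mul (is_derive_const k z) dl) (is_derive_const c z))))).
  by field; rewrite gt_eqF.
have [w /andP[xw _] h] := mean_value xy dz.
rewrite [leLHS]distrC h normrM (distrC x) ler_wpM2r//.
apply: (le_trans (ler_normB _ _)); apply: lerD; first exact: cos_max.
by rewrite normrM ler_piMr// sin_max.
Qed.

(** The factor exp(-hx) of the test function is the damping that [mul_cos_ln_lipschitz] needs. It
    adds to the weight of [size_biased], hence the tilt [2 * h] in the proof. *)
Lemma size_biased_trig (h v c : R) : 0 < h ->
  size_biased b Pi m t h (fun x => expR (- (h * x)) * cos (v * x + c)).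
Proof.
move=> h0; have h20 : 0 < 2 * h by rewrite mulr_gt0.
have JE x : jump_mean b Pi h (fun x => expR (- (h * x)) * cos (v * x + c)) x =
    expR (- (h * x)) * (cos (v * x + c) * dbeta b Pi (2 * h) v -
                        sin (v * x + c) * dalpha Pi (2 * h) v).
  have mc : measurable_fun setT (fun y : R => cos (v * y)) by measurability.
  have ms : measurable_fun setT (fun y : R => sin (v * y)) by measurability.
  have ic := levy_ytrig_integrable hPi h20 mc (fun y => cos_max _).
  have isn := levy_ytrig_integrable hPi h20 ms (fun y => sin_max _).
  rewrite /jump_mean /dbeta /dalpha.
  have -> : \int[Pi]_(y in `]0, +oo[) (y * expR (- (h * y)) *
        (expR (- (h * (x + y))) * cos (v * (x + y) + c))) =
      expR (- (h * x)) * cos (v * x + c) *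
        \int[Pi]_(y in `]0, +oo[) (y * expR (- (2 * h * y)) * cos (v * y)) -
      expR (- (h * x)) * sin (v * x + c) *
        \int[Pi]_(y in `]0, +oo[) (y * expR (- (2 * h * y)) * sin (v * y)).
    rewrite -!RintegralZl// -RintegralB//; [|exact: integrable_scale..].
    apply: eq_Rintegral => y _.
    have -> : v * (x + y) + c = (v * x + c) + v * y by ring.
    have -> : - (h * (x + y)) = - (h * x) + - (h * y) by ring.
    have -> : - (2 * h * y) = - (h * y) + - (h * y) by ring.
    by rewrite cosD !expRD; ring.
  ring.
apply: (size_biased_lim hPi hm h0).
- by measurability.
- exists 1 => x x0; rewrite normrM -[leRHS]mulr1; apply: ler_pM => //; last exact: cos_max.
  by rewrite ger0_norm ?expR_ge0 ?expRN_le1 ?mulr_ge0 ?(ltW h0).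
- by rewrite (funext JE); apply: measurable_funTS; measurability.
move=> e e0.
have [p pe] := lipschitz_poly_approx (mul_cos_ln_lipschitz (- (v / h)) c) e0.
exists (fun x => p.[expR (- (h * x))]); first exact: size_biased_poly.
move=> x x0; have := pe (expR (- (h * x))).
rewrite expRK expR_ge0 expRN_le1 ?mulr_ge0 ?(ltW h0)// => /(_ isT).
have -> : - (v / h) * - (h * x) + c = v * x + c by field; rewrite gt_eqF.
exact.
Qed.

Definition cos_transform (u v : R) : R :=
  \int[m]_(x in `[0, +oo[) (expR (- (u * x)) * cos (v * x)).

Definition sin_transform (u v : R) : R :=
  \int[m]_(x in `[0, +oo[) (expR (- (u * x)) * sin (v * x)).

Let ecos (u v : R) : 0 < u ->
  m.-integrable D1 (EFin \o (fun x => expR (- (u * x)) * cos (v * x))).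
Proof.
move=> u0; apply: (@law_exp_integrable _ _ _ 1); [exact: ltW|by measurability|].
by move=> x _; exact: cos_max.
Qed.

Let esin (u v : R) : 0 < u ->
  m.-integrable D1 (EFin \o (fun x => expR (- (u * x)) * sin (v * x))).
Proof.
move=> u0; apply: (@law_exp_integrable _ _ _ 1); [exact: ltW|by measurability|].
by move=> x _; exact: sin_max.
Qed.

(** Taken with [h = u / 2], weight and damping together tilt by u. The phases c = 0 and c = pi / 2
    produce x cos(vx) and - x sin(vx), the derivatives of sin(vx) and cos(vx) in v. *)
Lemma size_bias_trig (u v c : R) : 0 < u ->
  \int[m]_(x in `[0, +oo[) (x * expR (- (u * x)) * cos (v * x + c)) =
  t * \int[m]_(x in `[0, +oo[) (expR (- (u * x)) *
    (cos (v * x + c) * dbeta b Pi u v - sin (v * x + c) * dalpha Pi u v)).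
Proof.
move=> u0; have h0 : 0 < u / 2 by rewrite divr_gt0.
have e x : expR (- (u * x)) = expR (- (u / 2 * x)) * expR (- (u / 2 * x)).
  by rewrite -expRD; congr expR; field.
have u2 : 2 * (u / 2) = u by field.
have [_ _ _ h] := size_biased_trig v c h0.
transitivity (\int[m]_(x in `[0, +oo[) (x * expR (- (u / 2 * x)) *
    (expR (- (u / 2 * x)) * cos (v * x + c)))).
  by apply: eq_Rintegral => x _; rewrite e; ring.
rewrite h; congr (_ * _); apply: eq_Rintegral => x _.
have mc : measurable_fun setT (fun y : R => cos (v * y)) by measurability.
have ms : measurable_fun setT (fun y : R => sin (v * y)) by measurability.
have ic := levy_ytrig_integrable hPi u0 mc (fun y => cos_max _).
have isn := levy_ytrig_integrable hPi u0 ms (fun y => sin_max _).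
rewrite [in RHS]e -[RHS]mulrA; congr (_ * _).
rewrite /jump_mean /dbeta /dalpha.
have -> : \int[Pi]_(y in `]0, +oo[) (y * expR (- (u / 2 * y)) *
      (expR (- (u / 2 * (x + y))) * cos (v * (x + y) + c))) =
    expR (- (u / 2 * x)) * cos (v * x + c) *
      \int[Pi]_(y in `]0, +oo[) (y * expR (- (u * y)) * cos (v * y)) -
    expR (- (u / 2 * x)) * sin (v * x + c) *
      \int[Pi]_(y in `]0, +oo[) (y * expR (- (u * y)) * sin (v * y)).
  rewrite -!RintegralZl// -RintegralB//; [|exact: integrable_scale..].
  apply: eq_Rintegral => y _.
  have -> : v * (x + y) + c = (v * x + c) + v * y by ring.
  have -> : - (u / 2 * (x + y)) = - (u / 2 * x) + - (u / 2 * y) by ring.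
  by rewrite (e y) cosD !expRD; ring.
ring.
Qed.

Lemma is_derive_cos_transform (u v : R) : 0 < u ->
  is_derive v 1 (cos_transform u)
    (- (t * (dbeta b Pi u v * sin_transform u v + dalpha Pi u v * cos_transform u v))).
Proof.
move=> u0; have <- : \int[m]_(x in `[0, +oo[) (x * expR (- (u * x)) * cos (v * x + pi / 2)) =
    - (t * (dbeta b Pi u v * sin_transform u v + dalpha Pi u v * cos_transform u v)).
  rewrite size_bias_trig// -mulrN; congr (_ * _).
  rewrite opprD -!mulNr -!RintegralZl//; [|first [exact: esin|exact: ecos]..].
  rewrite -RintegralD//; [|by apply: integrable_scale => //; first [exact: esin|exact: ecos]..].
  by apply: eq_Rintegral => x _; rewrite cosDpihalf sinDpihalf; ring.
apply: (@is_derive_Rintegral _ _ _ m D1 (fun v x => expR (- (u * x)) * cos (v * x))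
  (fun v x => x * expR (- (u * x)) * cos (v * x + pi / 2))
  (fun x => x * expR (- (u * x))) (v - 1) (v + 1)) => //.
- by apply/andP; split; lra.
- by move=> w _; exact: ecos.
- by move=> w x _ _; derives; rewrite cosDpihalf; ring.
- exact: law_x_exp_integrable1.
- move=> w x _ /in_D1 x0; rewrite normrM (ger0_norm (mulr_ge0 x0 (expR_ge0 _))).
  by rewrite ler_piMr ?cos_max// mulr_ge0 ?expR_ge0.
Qed.

Lemma is_derive_sin_transform (u v : R) : 0 < u ->
  is_derive v 1 (sin_transform u)
    (t * (dbeta b Pi u v * cos_transform u v - dalpha Pi u v * sin_transform u v)).
Proof.
move=> u0; have <- : \int[m]_(x in `[0, +oo[) (x * expR (- (u * x)) * cos (v * x + 0)) =
    t * (dbeta b Pi u v * cos_transform u v - dalpha Pi u v * sin_transform u v).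
  rewrite size_bias_trig//; congr (_ * _).
  rewrite -!RintegralZl//; [|first [exact: esin|exact: ecos]..].
  rewrite -RintegralB//; [|by apply: integrable_scale => //; first [exact: esin|exact: ecos]..].
  by apply: eq_Rintegral => x _; rewrite addr0; ring.
apply: (@is_derive_Rintegral _ _ _ m D1 (fun v x => expR (- (u * x)) * sin (v * x))
  (fun v x => x * expR (- (u * x)) * cos (v * x + 0))
  (fun x => x * expR (- (u * x))) (v - 1) (v + 1)) => //.
- by apply/andP; split; lra.
- by move=> w _; exact: esin.
- by move=> w x _ _; derives; rewrite addr0; ring.
- exact: law_x_exp_integrable1.
- move=> w x _ /in_D1 x0; rewrite normrM (ger0_norm (mulr_ge0 x0 (expR_ge0 _))).
  by rewrite ler_piMr ?cos_max// mulr_ge0 ?expR_ge0.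
Qed.

(* The rotated transforms [E] and [F] are constant in [v]. *)
Lemma trig_transformE (u v : R) : 0 < u ->
  cos_transform u v = expR (- (t * psi b Pi u)) *
    (expR (- (t * alpha Pi u v)) * cos (t * beta b Pi u v)) /\
  sin_transform u v = expR (- (t * psi b Pi u)) *
    (expR (- (t * alpha Pi u v)) * sin (t * beta b Pi u v)).
Proof.
move=> u0; set C := cos_transform u; set S := sin_transform u.
set al := alpha Pi u; set be := beta b Pi u.
pose E w := expR (t * al w) * (C w * cos (t * be w) + S w * sin (t * be w)).
pose F w := expR (t * al w) * (S w * cos (t * be w) - C w * sin (t * be w)).
have dal w := is_derive_alpha hPi w u0; have dbe w := is_derive_beta b hPi w u0.
have dC w := is_derive_cos_transform w u0; have dS w := is_derive_sin_transform w u0.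
have dta w := is_derive_mul (is_derive_const t w) (dal w).
have dtb w := is_derive_mul (is_derive_const t w) (dbe w).
have dE (w : R) : is_derive w 1 E 0.
  apply: (is_derive_eq (is_derive_mul (is_derive_expf (dta w)) (is_derive_add
    (is_derive_mul (dC w) (is_derive_cosf (dtb w)))
    (is_derive_mul (dS w) (is_derive_sinf (dtb w)))))).
  by rewrite /C /S; ring.
have dF (w : R) : is_derive w 1 F 0.
  apply: (is_derive_eq (is_derive_mul (is_derive_expf (dta w)) (is_derive_sub
    (is_derive_mul (dS w) (is_derive_cosf (dtb w)))
    (is_derive_mul (dC w) (is_derive_sinf (dtb w)))))).
  by rewrite /C /S; ring.
have [_ hL] := hm.
have C0 : C 0 = expR (- (t * psi b Pi u)).
  rewrite -hL ?(ltW u0)//; apply: eq_Rintegral => x _.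
  by rewrite mul0r cos0 mulr1.
have S0 : S 0 = 0.
  rewrite /S /sin_transform (_ : (fun _ => _) = cst 0) ?Rintegral_cst ?mul0r//.
  by apply/funext => x; rewrite mul0r sin0 mulr0.
have Ev : E v = expR (- (t * psi b Pi u)).
  rewrite (is_derive_0_is_cst v 0 dE) /E /al /be alpha0 beta0 !mulr0 expR0 cos0 sin0 C0.
  ring.
have Fv : F v = 0.
  rewrite (is_derive_0_is_cst v 0 dF) /F /al /be alpha0 beta0 !mulr0 expR0 cos0 sin0 S0.
  ring.
have ee : expR (t * al v) * expR (- (t * al v)) = 1 by rewrite expRxMexpNx_1.
have cs := cos2Dsin2 (t * be v).
split.
- transitivity (expR (- (t * al v)) * (E v * cos (t * be v) - F v * sin (t * be v))).
    rewrite /E /F; transitivity ((expR (t * al v) * expR (- (t * al v))) *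
      (C v * (cos (t * be v) ^+ 2 + sin (t * be v) ^+ 2))); last by ring.
    by rewrite ee cs; ring.
  by rewrite Ev Fv; ring.
- transitivity (expR (- (t * al v)) * (E v * sin (t * be v) + F v * cos (t * be v))).
    rewrite /E /F; transitivity ((expR (t * al v) * expR (- (t * al v))) *
      (S v * (cos (t * be v) ^+ 2 + sin (t * be v) ^+ 2))); last by ring.
    by rewrite ee cs; ring.
  by rewrite Ev Fv; ring.
Qed.

End TrigTransform.

(** * Fourier inversion *)

Section HalfLine.
Context {R : realType}.

Local Notation leb := (@lebesgue_measure R).
Local Notation H := (`[0%R, +oo[%classic : set (measurableTypeR R)).

Let mH : measurable H. Proof. exact: measurable_itv. Qed.

Lemma in_half_line (x : R) : H x -> 0 <= x.
Proof. by rewrite /= in_itv/= andbT. Qed.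

(** The integrand may change sign, so the passage to infinity is by dominated convergence of
    truncations, and F is followed along integers only. *)
Lemma half_line_FTC (f F : R -> R) (l : R) : continuous f ->
  (forall x : R, is_derive x 1 F (f x)) ->
  leb.-integrable H (EFin \o f) ->
  (fun n : nat => F n.+1%:R) @ \oo --> l ->
  \int[leb]_(x in H) f x = l - F 0.
Proof.
move=> cf dF fi Fl.
pose f_ (n : nat) (x : R) := if x <= n.+1%:R then f x else 0.
have mf : measurable_fun (setT : set (measurableTypeR R)) f.
  exact: continuous_measurable_fun.
have c1 : (fun n => \int[leb]_(x in H) f_ n x) @ \oo --> \int[leb]_(x in H) f x.
  apply: (@dominated_cvg_Rintegral _ _ _ leb H f_ f (fun x => `|f x|)) => //.
  - move=> n; apply: measurable_funTS; apply: measurable_fun_ifT => //.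
    exact: measurable_fun_ler.
  - move=> x _; apply: cvg_near_cst; near=> n; rewrite /f_; case: ifPn => //.
    move/negP; case; near: n; exists (Num.truncn x) => // n /= xn.
    by rewrite (le_trans (ltW (truncnS_gt x)))// ler_nat.
  - by have := integrable_abse fi; apply: eq_integrable.
  - by move=> n x _; rewrite /f_; case: ifP => // _; rewrite normr0.
have e n : \int[leb]_(x in H) f_ n x = F n.+1%:R - F 0.
  rewrite -[RHS]/(fine (F n.+1%:R - F 0)%:E) -(ftc_segment _ cf dF)//.
  have -> : (`[0%R, n.+1%:R]%classic : set R) = H `&` `]-oo, n.+1%:R]%classic.
    apply/seteqP; split => x /=; rewrite !in_itv/= andbT; first by move=> /andP[].
    by case=> -> ->.
  rewrite -[RHS]/(Rintegral _ _ _) Rintegral_mkcondr; apply: eq_Rintegral => x _.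
  by rewrite patchE /f_ mem_setE in_itv.
have c2 : (fun n : nat => F n.+1%:R - F 0) @ \oo --> l - F 0.
  by apply: cvgB => //; exact: cvg_cst.
by rewrite -(funext e) in c2; exact: (cvg_unique _ c1 c2).
Unshelve. all: by end_near. Qed.

(** A Cauchy profile, used as a majorant because its integral over the half-line is exactly
    [pi / 2 / s]. *)
Definition lorentz (s v : R) : R := (1 + (s * v) ^+ 2)^-1.

Lemma lorentz_gt0 (s v : R) : 0 < lorentz s v.
Proof. by rewrite invr_gt0 ltr_pwDl// sqr_ge0. Qed.

Lemma lorentz_continuous (s : R) : continuous (lorentz s).
Proof.
move=> v; apply: (@continuousV _ _ (fun v => 1 + (s * v) ^+ 2) v).
  by rewrite gt_eqF// ltr_pwDl// sqr_ge0.
have h (w : R) : is_derive w 1 (fun v => 1 + (s * v) ^+ 2) (2 * s * (s * w)).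
  by derives; ring.
exact: is_derive_all_continuous h v.
Qed.

Lemma lorentz_integral (s : R) : 0 < s ->
  (\int[leb]_(v in H) (lorentz s v)%:E)%E = (pi / 2 / s)%:E.
Proof.
move=> s0; pose F v := atan (s * v) / s.
have dF (v : R) : is_derive v 1 F (lorentz s v).
  have h : is_derive v 1 (fun v => s * v) s by derives; ring.
  have h2 := is_derive1_comp (is_derive1_atan (s * v)) h.
  apply: (is_derive_eq (is_derive_mul h2 (is_derive_const s^-1 v))).
  by rewrite /lorentz; field; rewrite !gt_eqF// ltr_pwDl// sqr_ge0.
rewrite (@ge0_continuous_FTC2y _ (lorentz s) F 0 (pi / 2 / s)).
- by rewrite /F mulr0 atan0 mul0r sube0.
- by move=> v _; exact/ltW/lorentz_gt0.
- exact/continuous_subspaceT/lorentz_continuous.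
- have sv : (fun v : R => s * v) @ +oo --> +oo by exact: (gt0_cvgMry s0 (@cvg_id _ (pinfty_nbhs R))).
  exact: (cvgM (cvg_comp _ _ sv (@cvgy_atan R)) (cvg_cst s^-1)).
- by move=> v _; have h := dF v; exact: ex_derive.
- exact/cvg_at_right_filter/(is_derive_all_continuous dF).
- by move=> v _; exact: is_derive_derive1.
Qed.

Lemma lorentz_integrable (s : R) : 0 < s -> leb.-integrable H (EFin \o lorentz s).
Proof.
move=> s0; apply/integrableP; split.
  apply/measurable_EFinP/measurable_funTS.
  exact: (continuous_measurable_fun (@lorentz_continuous s)).
under eq_integral do rewrite /= ger0_norm ?(ltW (lorentz_gt0 _ _))//.
by rewrite lorentz_integral// ltry.
Qed.

(** Decay is asked for v >= 0 only: the inversion integrand of a real law is even in v, and the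
    half-line suffices. *)
Definition rapid (a : R -> R) : Prop := continuous a /\
  forall n, exists c, forall v, 0 <= v -> v ^+ n * `|a v| <= c.

Lemma rapid_mulX (a : R -> R) : rapid a -> rapid (fun v => v * a v).
Proof.
move=> [ca ra]; split; first by move=> v; apply: continuousM; [exact: cvg_id|exact: ca].
move=> n; have [c h] := ra n.+1; exists c => v v0.
by rewrite normrM (ger0_norm v0) mulrA -exprSr h.
Qed.

Lemma rapid_opp (a : R -> R) : rapid a -> rapid (fun v => - a v).
Proof.
move=> [ca ra]; split; first by move=> v; apply: continuousN; exact: ca.
by move=> n; have [c h] := ra n; exists c => v v0; rewrite normrN h.
Qed.

Lemma rapid_le (a a' : R -> R) : continuous a -> rapid a' ->
  (forall v, 0 <= v -> `|a v| <= `|a' v|) -> rapid a.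
Proof.
move=> ca [_ ra] aa'; split=> // n; have [c h] := ra n; exists c => v v0.
by apply: le_trans (h v v0); rewrite ler_wpM2l ?exprn_ge0// aa'.
Qed.

Lemma rapid_mul_integrable (a g : R -> R) : rapid a ->
  measurable_fun (setT : set (measurableTypeR R)) g -> (forall v, 0 <= v -> `|g v| <= 1) ->
  leb.-integrable H (EFin \o (fun v => a v * g v)).
Proof.
move=> [ca ra] mg g1; have [c0 h0] := ra 0%N; have [c2 h2] := ra 2%N.
apply: (@integrable_le _ _ _ leb H _ (fun v => (c0 + c2) * lorentz 1 v)) => //.
- apply: measurable_funTS; apply: measurable_funM => //.
  exact: continuous_measurable_fun.
- by apply: integrable_scale => //; exact: lorentz_integrable.
- move=> v /in_half_line v0; apply: (@le_trans _ _ `|a v|).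
    by rewrite normrM ler_piMr// g1.
  rewrite /lorentz mul1r ler_pdivlMr ?ltr_pwDl ?sqr_ge0//.
  have := h0 v v0; have := h2 v v0; rewrite expr0 mul1r => ? ?; lra.
Qed.

Lemma rapid_norm_integrable (a : R -> R) : rapid a ->
  leb.-integrable H (EFin \o (fun v => `|a v|)).
Proof.
move=> ra; have h : leb.-integrable H (EFin \o (fun v => a v * 1)).
  by apply: rapid_mul_integrable => // v _; rewrite normr1.
have := integrable_abse h; apply: eq_integrable => // v _ /=.
by rewrite mulr1.
Qed.

(** The real part of the integral of [(a + ib) exp(-ivy)] over v >= 0. Differentiation in y
    exchanges a and b up to sign and a factor v, so the family is stable under it. *)
Definition osc (a b : R -> R) (y : R) : R :=
  \int[leb]_(v in H) (a v * cos (v * y) + b v * sin (v * y)).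

Lemma osc_integrable (a b : R -> R) (y : R) : rapid a -> rapid b ->
  leb.-integrable H (EFin \o (fun v => a v * cos (v * y) + b v * sin (v * y))).
Proof.
move=> ra rb; apply: integrable_add => //; apply: rapid_mul_integrable => //.
- by measurability.
- by move=> v _; exact: cos_max.
- by measurability.
- by move=> v _; exact: sin_max.
Qed.

Lemma is_derive_osc (a b : R -> R) (y : R) : rapid a -> rapid b ->
  is_derive y 1 (osc a b) (osc (fun v => v * b v) (fun v => - (v * a v)) y).
Proof.
move=> ra rb.
have ia := rapid_norm_integrable (rapid_mulX ra).
have ib := rapid_norm_integrable (rapid_mulX rb).
apply: (@is_derive_Rintegral _ _ _ leb H
  (fun y v => a v * cos (v * y) + b v * sin (v * y))
  (fun y v => v * b v * cos (v * y) + - (v * a v) * sin (v * y))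
  (fun v => `|v * a v| + `|v * b v|) (y - 1) (y + 1)) => //.
- by apply/andP; split; lra.
- by move=> w _; exact: osc_integrable.
- by move=> w v _ _; derives; ring.
- exact: integrable_add.
- move=> w v _ _; rewrite addrC; apply: (le_trans (ler_normD _ _)); apply: lerD.
    by rewrite normrM normrN ler_piMr ?sin_max.
  by rewrite normrM ler_piMr ?cos_max.
Qed.

Lemma osc_bounded (a b : R -> R) : rapid a -> rapid b ->
  exists M, forall y, `|osc a b y| <= M.
Proof.
move=> ra rb; exists (\int[leb]_(v in H) (`|a v| + `|b v|)) => y.
apply: Rintegral_norm_le => //.
- exact/integrable_measurable/osc_integrable.
- by apply: integrable_add => //; exact: rapid_norm_integrable.
- move=> v _; apply: (le_trans (ler_normD _ _)); apply: lerD.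
    by rewrite normrM ler_piMr ?cos_max.
  by rewrite normrM ler_piMr ?sin_max.
Qed.

Lemma smooth_osc (a b : R -> R) : rapid a -> rapid b -> smooth (osc a b).
Proof.
move=> ra rb n y; suff [a' [b' [ra' [rb' ->]]]] : exists a' b',
    rapid a' /\ rapid b' /\ derive1n n (osc a b) = osc a' b'.
  by have h := is_derive_osc y ra' rb'; exact: ex_derive.
elim: n => [|n [a' [b' [ra' [rb' e]]]]]; first by exists a, b.
exists (fun v => v * b' v), (fun v => - (v * a' v)); split; first exact: rapid_mulX.
split; first exact/rapid_opp/rapid_mulX.
rewrite derive1nS e; apply/funext => z.
exact: is_derive_derive1 (is_derive_osc z ra' rb').
Qed.

(** The derivative [exp(uy) (u g + g')] has the same shape with another smooth function, whence an
    induction on the order with g general. *)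
Lemma smooth_expM (u : R) (g : R -> R) : smooth g -> smooth (fun y => expR (u * y) * g y).
Proof.
have add (f1 f2 : R -> R) (c : R) : smooth f1 -> smooth f2 ->
    smooth (fun y => c * f1 y + f2 y).
  move=> s1 s2 n; have h k : derive1n k (fun y => c * f1 y + f2 y) =
      (fun y => c * derive1n k f1 y + derive1n k f2 y).
    elim: k => [//|k IH]; rewrite !derive1nS IH; apply/funext => y.
    apply: is_derive_derive1; apply: is_derive_add.
      have h1 := derivableP (s1 k y); rewrite derive1E.
      by apply: (is_derive_eq (is_derive_mul (is_derive_const c y) h1)); rewrite mul0r add0r.
    by rewrite derive1E; exact: derivableP (s2 k y).
  move=> y; rewrite h; have h1 := derivableP (s1 n y); have h2 := derivableP (s2 n y).
  have h3 := is_derive_add (is_derive_mul (is_derive_const c y) h1) h2.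
  exact: ex_derive.
move=> sg n; elim: n g sg => [|n IH] g sg y.
  have h1 := derivableP (sg 0%N y).
  have h2 := is_derive_expf (is_derive_mul (is_derive_const u y) (is_derive_idfun y)).
  have h3 := is_derive_mul h2 h1; exact: ex_derive.
rewrite derive1Sn (_ : derive1 _ = (fun y => expR (u * y) * (u * g y + derive1 g y))).
  by apply: IH; apply: add => // k z; rewrite -derive1Sn; exact: sg.
apply/funext => z; have h1 := derivableP (sg 0%N z).
have h2 := is_derive_expf (is_derive_mul (is_derive_const u z) (is_derive_idfun z)).
rewrite (is_derive_derive1 (is_derive_mul h2 h1)) derive1E /=; ring.
Qed.

End HalfLine.

(** * Damped inversion and the Poisson kernel *)

Section PoissonSmoothing.
Context {R : realType}.

Variables (m : probability R R) (u : R).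
Hypothesis u0 : 0 < u.

Local Notation D1 := (`[0%R, +oo[%classic : set R).
Local Notation C := (cos_transform m u).
Local Notation S := (sin_transform m u).

Let mD1 : measurable D1. Proof. exact: measurable_itv. Qed.

Hypotheses (rC : rapid C) (rS : rapid S).

Lemma law_norm_le (f : R -> R) (c : R) : measurable_fun setT f ->
  (forall x, 0 <= x -> `|f x| <= c) -> `|\int[m]_(x in `[0, +oo[) f x| <= c.
Proof.
move=> mf fc; have c0 : 0 <= c by apply: le_trans (fc 0 (lexx _)).
apply: (@le_trans _ _ (\int[m]_(x in D1) c)).
  apply: Rintegral_norm_le => //; first exact: measurable_funTS.
    exact: (finite_measure_integrable_cst m).
  by move=> x /in_D1; exact: fc.
rewrite Rintegral_cst//; apply: ler_piMr => //.
by rewrite -lee_fin fineK ?fin_num_measure// probability_le1.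
Qed.

(** Without the usual factor 1 / pi, so that it is the derivative of atan(x / e) in x. *)
Definition poisson_kernel (e x : R) : R := e / (e ^+ 2 + x ^+ 2).

Lemma poisson_den_gt0 (e x : R) : 0 < e -> 0 < e ^+ 2 + x ^+ 2.
Proof. by move=> e0; rewrite ltr_pwDl ?sqr_ge0// exprn_gt0. Qed.

Lemma measurable_poisson (e y : R) : 0 < e ->
  measurable_fun setT (fun x : R => poisson_kernel e (x - y)).
Proof.
move=> e0; apply: continuous_measurable_fun => x; apply: cvgM; first exact: cvg_cst.
apply: (@continuousV _ _ (fun x => e ^+ 2 + (x - y) ^+ 2) x).
  by rewrite gt_eqF// poisson_den_gt0.
have h (w : R) : is_derive w 1 (fun x => e ^+ 2 + (x - y) ^+ 2) (2 * (w - y)).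
  by derives; ring.
exact: is_derive_all_continuous h x.
Qed.

(* [F] below is an explicit primitive in [v] of the integrand on the left. *)
Lemma osc_damped (e y : R) : 0 < e ->
  osc (fun v => expR (- (e * v)) * C v) (fun v => expR (- (e * v)) * S v) y =
  \int[m]_(x in `[0, +oo[) (expR (- (u * x)) * poisson_kernel e (x - y)).
Proof.
move=> e0.
pose k (v x : R) := expR (- (e * v)) * ((x - y) * sin (v * (x - y)) - e * cos (v * (x - y)))
  / (e ^+ 2 + (x - y) ^+ 2).
have kb v x : `|k v x| <= 2 / e * expR (- (e * v)).
  have d0 := poisson_den_gt0 (x - y) e0.
  rewrite /k normrM normfV (gtr0_norm d0) ler_pdivrMr// normrM (ger0_norm (expR_ge0 _)).
  have -> : 2 / e * expR (- (e * v)) * (e ^+ 2 + (x - y) ^+ 2) =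
    expR (- (e * v)) * (2 / e * (e ^+ 2 + (x - y) ^+ 2)) by ring.
  rewrite ler_wpM2l ?expR_ge0//.
  apply: (le_trans (ler_normB _ _)).
  have h1 : `|(x - y) * sin (v * (x - y))| <= `|x - y| by rewrite normrM ler_piMr ?sin_max.
  have h2 : `|e * cos (v * (x - y))| <= e by rewrite normrM gtr0_norm// ler_piMr ?cos_max ?ltW.
  apply: (le_trans (lerD h1 h2)); rewrite mulrAC ler_pdivlMr//.
  have : `|x - y| ^+ 2 = (x - y) ^+ 2 by rewrite real_normK ?num_real.
  have := sqr_ge0 (`|x - y| - e); set a := `|x - y|; nra.
pose F v := \int[m]_(x in `[0, +oo[) (expR (- (u * x)) * k v x).
have mk v : measurable_fun setT (k v).
  have -> : k v = (fun x => expR (- (e * v)) *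
      ((x - y) * sin (v * (x - y)) - e * cos (v * (x - y))) *
      (poisson_kernel e (x - y) / e)).
    by apply/funext => x; rewrite /k /poisson_kernel; field; rewrite !gt_eqF ?poisson_den_gt0.
  have mp := measurable_poisson y e0.
  by measurability.
have ik v : m.-integrable D1 (EFin \o (fun x => expR (- (u * x)) * k v x)).
  by apply: (@law_exp_integrable _ _ _ (2 / e * expR (- (e * v)))); [exact: ltW| |].
pose f v := expR (- (e * v)) * C v * cos (v * y) + expR (- (e * v)) * S v * sin (v * y).
have cE : continuous (fun v : R => expR (- (e * v))).
  have h (w : R) : is_derive w 1 (fun v => expR (- (e * v))) (- e * expR (- (e * w))).
    by derives; ring.
  exact: is_derive_all_continuous h.
have cc : continuous (fun v : R => cos (v * y)).
  have h (w : R) : is_derive w 1 (fun v => cos (v * y)) (- (y * sin (w * y))) by derives; ring.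
  exact: is_derive_all_continuous h.
have cs : continuous (fun v : R => sin (v * y)).
  have h (w : R) : is_derive w 1 (fun v => sin (v * y)) (y * cos (w * y)) by derives; ring.
  exact: is_derive_all_continuous h.
have cdC : continuous (fun v => expR (- (e * v)) * C v).
  by move=> v; exact: (continuousM (cE v) (rC.1 v)).
have cdS : continuous (fun v => expR (- (e * v)) * S v).
  by move=> v; exact: (continuousM (cE v) (rS.1 v)).
have damp (a : R -> R) v : 0 <= v -> `|expR (- (e * v)) * a v| <= `|a v|.
  move=> v0; rewrite normrM ler_piMl// ger0_norm ?expR_ge0 ?expRN_le1 ?mulr_ge0//.
  exact: ltW.
have rdC := rapid_le cdC rC (damp _); have rdS := rapid_le cdS rS (damp _).
have cf : continuous f.
  by move=> v; exact: (continuousD (continuousM (cdC v) (cc v)) (continuousM (cdS v) (cs v))).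
have dF (v : R) : is_derive v 1 F (f v).
  have -> : f v = \int[m]_(x in `[0, +oo[)
      (expR (- (u * x)) * (expR (- (e * v)) * cos (v * (x - y)))).
    have i1 : m.-integrable D1 (EFin \o (fun x => expR (- (u * x)) * cos (v * x))).
      apply: (@law_exp_integrable _ _ _ 1); [exact: ltW|by measurability|].
      by move=> x _; exact: cos_max.
    have i2 : m.-integrable D1 (EFin \o (fun x => expR (- (u * x)) * sin (v * x))).
      apply: (@law_exp_integrable _ _ _ 1); [exact: ltW|by measurability|].
      by move=> x _; exact: sin_max.
    rewrite /f mulrAC [X in _ + X]mulrAC /cos_transform /sin_transform.
    rewrite -!RintegralZl// -RintegralD//; [|exact: integrable_scale..].
    by apply: eq_Rintegral => x _; rewrite mulrBr cosB; ring.
  apply: (@is_derive_Rintegral _ _ _ m D1 (fun v x => expR (- (u * x)) * k v x)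
    (fun v x => expR (- (u * x)) * (expR (- (e * v)) * cos (v * (x - y))))
    (cst (expR (- (e * (v - 1))))) (v - 1) (v + 1)) => //.
  - by apply/andP; split; lra.
  - move=> w x _ _; rewrite /k; derives.
    have d0 := poisson_den_gt0 (x - y) e0.
    by field; rewrite gt_eqF.
  - exact: (finite_measure_integrable_cst m).
  - move=> w x /andP[vw _] /in_D1 x0; rewrite normrM -[leRHS]mul1r; apply: ler_pM => //.
      by rewrite ger0_norm ?expR_ge0 ?expRN_le1 ?mulr_ge0 ?(ltW u0).
    rewrite normrM ger0_norm ?expR_ge0//; apply: (@le_trans _ _ (expR (- (e * w)))).
      by rewrite ler_piMr ?cos_max ?expR_ge0.
    by rewrite ler_expR lerN2 ler_pM2l// ltW.
rewrite /osc (half_line_FTC cf dF (osc_integrable y rdC rdS) (l := 0)).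
- rewrite sub0r -mulN1r -RintegralZl//.
  apply: eq_Rintegral => x _; rewrite /k /poisson_kernel !mul0r mulr0 oppr0 expR0 sin0 cos0.
  by field; rewrite gt_eqF ?poisson_den_gt0.
- apply: (@cvg0_harmonic _ _ (2 / e / e)) => n.
  apply: (@le_trans _ _ (2 / e * expR (- (e * n.+1%:R)))).
    apply: law_norm_le => [|x x0]; first by apply: measurable_funM => //; measurability.
    rewrite normrM -[leRHS]mul1r; apply: ler_pM => //.
    by rewrite ger0_norm ?expR_ge0 ?expRN_le1 ?mulr_ge0 ?(ltW u0).
  rewrite -!mulrA ler_wpM2l// ler_wpM2l ?invr_ge0 ?(ltW e0)//.
  have en : 0 <= e * n.+1%:R by rewrite mulr_ge0// ltW.
  have := @pow_expRN_le R 1 _ en; rewrite expr1 => h.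
  have {}h : e * n.+1%:R * expR (- (e * n.+1%:R)) <= 1 by exact: h.
  by rewrite ler_pdivlMr// -(ler_pM2l e0) mulfV ?gt_eqF// mulrA mulrAC.
Qed.
End PoissonSmoothing.

(** * A primitive of the tilted law *)

Section Inversion.
Context {R : realType}.
Variables (m : probability R R) (u : R).
Hypothesis u0 : 0 < u.

Local Notation D1 := (`[0%R, +oo[%classic : set R).
Local Notation C := (cos_transform m u).
Local Notation S := (sin_transform m u).
Local Notation J := (osc C S).
Local Notation leb := (@lebesgue_measure R).
Local Notation H := (`[0%R, +oo[%classic : set (measurableTypeR R)).

Let mD1 : measurable D1. Proof. exact: measurable_itv. Qed.

Hypotheses (rC : rapid C) (rS : rapid S).

(** As e decreases to 0, atan(./e) tends to [pi / 2] times the sign; the derivative in y is the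
    Poisson average evaluated by [osc_damped]. *)
Let smooth_sign (e y : R) : R :=
  \int[m]_(x in `[0, +oo[) (expR (- (u * x)) * atan ((y - x) / e)).

(** Up to an additive constant, pi times the distribution function of exp(-ux) m(dx), with half of
    an atom at y counted at y. *)
Definition tilted_sign (y : R) : R :=
  \int[m]_(x in `[0, +oo[) (expR (- (u * x)) * (pi / 2 * Num.sg (y - x))).

Let exp_le1 (x : R) : 0 <= x -> `|expR (- (u * x))| <= 1.
Proof. by move=> x0; rewrite ger0_norm ?expR_ge0 ?expRN_le1 ?mulr_ge0 ?(ltW u0). Qed.

Lemma atan_bounded (x : R) : `|atan x| <= pi / 2.
Proof. by rewrite ler_norml; have := atan_gtNpi2 x; have := atan_ltpi2 x; lra. Qed.

Lemma measurable_atanf (f : R -> R) : measurable_fun setT f ->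
  measurable_fun setT (fun x => atan (f x)).
Proof.
move=> mf; apply: (@measurableT_comp _ _ _ _ _ _ (@atan R)) => //.
by apply: continuous_measurable_fun => x; exact: continuous_atan.
Qed.

Let measurable_ratio (e y : R) : measurable_fun setT (fun x : R => (y - x) / e).
Proof. by measurability. Qed.

Let is_derive_smooth_sign (e y : R) : 0 < e ->
  is_derive y 1 (smooth_sign e)
    (\int[m]_(x in `[0, +oo[) (expR (- (u * x)) * poisson_kernel e (x - y))).
Proof.
move=> e0; apply: (@is_derive_Rintegral _ _ _ m D1
  (fun y x => expR (- (u * x)) * atan ((y - x) / e))
  (fun y x => expR (- (u * x)) * poisson_kernel e (x - y)) (cst e^-1) (y - 1) (y + 1)) => //.
- by apply/andP; split; lra.
- move=> w _; apply: (@law_exp_integrable _ _ _ (pi / 2)); first exact: ltW.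
    exact: measurable_atanf.
  by move=> x _; exact: atan_bounded.
- move=> w x _ _.
  have h : is_derive w 1 (fun y => (y - x) / e) e^-1 by derives; ring.
  have h2 := @is_derive1_comp _ atan (fun y => (y - x) / e) w _ _
    (is_derive1_atan ((w - x) / e)) h.
  apply: (is_derive_eq (is_derive_mul (is_derive_const _ w) h2)).
  have d1 := @poisson_den_gt0 _ e (w - x) e0; have d2 := @poisson_den_gt0 _ e (x - w) e0.
  rewrite /poisson_kernel mul0r add0r.
  have -> : (x - w) ^+ 2 = (w - x) ^+ 2 by ring.
  have h3 : 0 < 1 + ((w - x) / e) ^+ 2 by rewrite ltr_pwDl ?sqr_ge0.
  have -> : 1 + ((w - x) / e) ^+ 2 = (e ^+ 2 + (w - x) ^+ 2) / e ^+ 2.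
    by field; rewrite gt_eqF.
  by field; rewrite !gt_eqF.
- exact: (finite_measure_integrable_cst m).
- move=> w x _ /in_D1 x0; rewrite normrM -[leRHS]mul1r; apply: ler_pM => //.
    exact: exp_le1.
  have d0 := @poisson_den_gt0 _ e (x - w) e0.
  rewrite ger0_norm ?divr_ge0 ?(ltW e0) ?(ltW d0)// ler_pdivrMr//.
  by rewrite ler_pdivlMl// -expr2 lerDl sqr_ge0.
Qed.

Let M : R := \int[leb]_(v in H) (`|v * C v| + `|v * S v|).

Let iM : leb.-integrable H (EFin \o (fun v => `|v * C v| + `|v * S v|)).
Proof. by apply: integrable_add => //; apply/rapid_norm_integrable/rapid_mulX. Qed.

Lemma osc_transform_lipschitz : forall a b, `|J b - J a| <= M * `|b - a|.
Proof.
apply: (derive_bounded_lipschitz (fun x => is_derive_osc x rC rS)) => y.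
apply: Rintegral_norm_le => //.
- apply/integrable_measurable/osc_integrable; first exact: rapid_mulX.
  exact/rapid_opp/rapid_mulX.
- move=> v _; apply: (le_trans (ler_normD _ _)); rewrite [leRHS]addrC; apply: lerD.
    by rewrite normrM ler_piMr ?cos_max.
  by rewrite normrM normrN ler_piMr ?sin_max.
Qed.

(** Removing the damping costs [|exp(-ev) - 1| <= ev], one more power of v under the integral; this
    is the same [M] as in the Lipschitz bound of J. *)
Let damped_dist (e y : R) : 0 < e ->
  `|\int[m]_(x in `[0, +oo[) (expR (- (u * x)) * poisson_kernel e (x - y)) - J y| <= e * M.
Proof.
move=> e0; rewrite -osc_damped//.
have cE : continuous (fun v : R => expR (- (e * v))).
  have h (w : R) : is_derive w 1 (fun v => expR (- (e * v))) (- e * expR (- (e * w))).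
    by derives; ring.
  exact: is_derive_all_continuous h.
have damp (a : R -> R) v : 0 <= v -> `|expR (- (e * v)) * a v| <= `|a v|.
  move=> v0; rewrite normrM ler_piMl// ger0_norm ?expR_ge0 ?expRN_le1 ?mulr_ge0//.
  exact: ltW.
have rdC : rapid (fun v => expR (- (e * v)) * C v).
  apply: (rapid_le _ rC (damp _)) => v; exact: (continuousM (cE v) (rC.1 v)).
have rdS : rapid (fun v => expR (- (e * v)) * S v).
  apply: (rapid_le _ rS (damp _)) => v; exact: (continuousM (cE v) (rS.1 v)).
rewrite /M -RintegralZl//; apply: Rintegral_dist_le => //.
- exact: osc_integrable.
- exact: osc_integrable.
- exact: integrable_scale.
move=> v /in_half_line v0.
have ev : 0 <= e * v by rewrite mulr_ge0 ?(ltW e0).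
have h1 (a w : R) : `|w| <= 1 -> `|(expR (- (e * v)) - 1) * (a * w)| <= e * `|v * a|.
  have e1 : `|expR (- (e * v)) - 1| <= e * v.
    by rewrite distrC ger0_norm ?subr_ge0 ?expRN_le1// onem_expRN_le.
  move=> w1; rewrite normrM (normrM v) (ger0_norm v0) mulrA; apply: ler_pM => //.
  by rewrite normrM ler_piMr.
have -> : expR (- (e * v)) * C v * cos (v * y) + expR (- (e * v)) * S v * sin (v * y) -
    (C v * cos (v * y) + S v * sin (v * y)) =
  (expR (- (e * v)) - 1) * (C v * cos (v * y)) + (expR (- (e * v)) - 1) * (S v * sin (v * y)).
  by ring.
apply: (le_trans (ler_normD _ _)); rewrite mulrDr; apply: lerD.
  by apply: h1; exact: cos_max.
by apply: h1; exact: sin_max.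
Qed.

Lemma sg_measurable (y : R) : measurable_fun setT (fun x : R => Num.sg (y - x)).
Proof.
apply: (nonincreasing_measurable measurableT) => a b ab.
case: (sgrP (y - b)); case: (sgrP (y - a)) => //; lra.
Qed.

Let smooth_sign_cvg (y : R) :
  (fun n : nat => smooth_sign n.+1%:R^-1 y) @ \oo --> tilted_sign y.
Proof.
apply: (@dominated_cvg_Rintegral _ _ _ m D1
  (fun n x => expR (- (u * x)) * atan ((y - x) / n.+1%:R^-1)) _ (cst (pi / 2))) => //.
- move=> n; apply: measurable_funTS; apply: measurable_funM; first by measurability.
  exact: measurable_atanf.
- move=> x _; apply: cvgM; first exact: cvg_cst.
  have lim (z : R) : 0 < z -> (fun n : nat => atan (z / n.+1%:R^-1)) @ \oo --> pi / 2.
    move=> z0; apply: (@cvg_comp _ _ _ (fun n : nat => z / n.+1%:R^-1) atan _ _ _ _ (@cvgy_atan R)).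
    apply/cvgryPge => A; near=> n; rewrite invrK mulrC -ler_pdivrMr//.
    near: n; exists (Num.truncn (A / z)) => // n /= An.
    by rewrite (le_trans (ltW (truncnS_gt _)))// ler_nat.
  case: (sgrP (y - x)) => [->|z0|z0].
  + rewrite mulr0 (_ : (fun _ => _) = cst 0); first exact: cvg_cst.
    by apply/funext => n; rewrite mul0r atan0.
  + by rewrite mulr1; exact: lim.
  + rewrite mulrN1 (_ : (fun _ => _) = (fun n : nat => - atan ((x - y) / n.+1%:R^-1))).
      by apply: cvgN; apply: lim; rewrite subr_gt0 -subr_lt0.
    by apply/funext => n; rewrite -atanN; congr atan; ring.
- exact: (finite_measure_integrable_cst m).
- move=> n x /in_D1 x0; rewrite normrM -[leRHS]mul1r; apply: ler_pM => //.
    exact: exp_le1.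
  exact: atan_bounded.
Unshelve. all: by end_near. Qed.

(** The increment of [smooth_sign] differs from [h J y] by at most [(e M + M |h|) |h|]. The
    inequality survives e -> 0 and leaves a quadratic remainder. *)
Lemma is_derive_tilted_sign (y : R) : is_derive y 1 tilted_sign (J y).
Proof.
apply: (@is_derive_quad_near _ _ _ _ M) => h _.
have step (n : nat) : `|smooth_sign n.+1%:R^-1 (y + h) - smooth_sign n.+1%:R^-1 y - h * J y|
    <= (n.+1%:R^-1 * M + M * `|h|) * `|h|.
  have n0 : 0 < n.+1%:R^-1 :> R by rewrite invr_gt0.
  have := @segment_lipschitz _ (fun z => smooth_sign n.+1%:R^-1 z - z * J y)
    (fun z => \int[m]_(x in `[0, +oo[) (expR (- (u * x)) * poisson_kernel n.+1%:R^-1 (x - z)) - J y)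
    (n.+1%:R^-1 * M + M * `|h|) y (y + h).
  have -> : smooth_sign n.+1%:R^-1 (y + h) - (y + h) * J y - (smooth_sign n.+1%:R^-1 y - y * J y) =
    smooth_sign n.+1%:R^-1 (y + h) - smooth_sign n.+1%:R^-1 y - h * J y by ring.
  rewrite (_ : y + h - y = h); last by ring.
  apply.
    move=> x _; have h1 := is_derive_smooth_sign x n0.
    apply: (is_derive_eq (is_derive_sub h1 (is_derive_mul (is_derive_idfun x) (is_derive_const (J y) x)))).
    by ring.
  move=> x xy; have -> : \int[m]_(w in `[0, +oo[) (expR (- (u * w)) *
      poisson_kernel n.+1%:R^-1 (w - x)) - J y =
    (\int[m]_(w in `[0, +oo[) (expR (- (u * w)) *
      poisson_kernel n.+1%:R^-1 (w - x)) - J x) + (J x - J y) by ring.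
  apply: (le_trans (ler_normD _ _)); apply: lerD; first exact: damped_dist.
  apply: (le_trans (osc_transform_lipschitz _ _)); rewrite ler_wpM2l//.
  by apply: Rintegral_ge0 => v _; rewrite addr_ge0.
have c1 : (fun n : nat => `|smooth_sign n.+1%:R^-1 (y + h) - smooth_sign n.+1%:R^-1 y - h * J y|)
    @ \oo --> `|tilted_sign (y + h) - tilted_sign y - h * J y|.
  apply: cvg_norm; apply: cvgB; last exact: cvg_cst.
  by apply: cvgB; exact: smooth_sign_cvg.
have c2 : (fun n : nat => (n.+1%:R^-1 * M + M * `|h|) * `|h|) @ \oo --> M * h ^+ 2.
  have -> : M * h ^+ 2 = (0 * M + M * `|h|) * `|h|.
    by rewrite -(real_normK (num_real h)); ring.
  exact: (cvgM (cvgD (cvgM (@cvg_harmonic R) (cvg_cst M)) (cvg_cst (M * `|h|))) (cvg_cst `|h|)).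
by apply: (ler_cvg_to c1 c2); apply: nearW.
Qed.

End Inversion.

(** * The smooth density *)

Section Density.
Context {R : realType}.
Variables (m : probability R R) (u : R).
Hypothesis u0 : 0 < u.
Hypothesis m0 : m (`]-oo, 0%R[%classic) = 0%E.

Local Notation D1 := (`[0%R, +oo[%classic : set R).
Local Notation C := (cos_transform m u).
Local Notation S := (sin_transform m u).
Local Notation J := (osc C S).
Local Notation leb := (@lebesgue_measure R).
Local Notation K := (tilted_sign m u).

Let mD1 : measurable D1. Proof. exact: measurable_itv. Qed.

Hypotheses (rC : rapid C) (rS : rapid S).

Let mass (A : set R) : R := fine (m A).

Lemma mass_half_line (A : set R) : measurable A -> mass (A `&` D1) = mass A.
Proof.
move=> mA; rewrite /mass; congr fine.
have h : m (A `\` D1) = 0%E.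
  apply: (subset_measure0 _ _ _ m0) => //; first exact: measurableD.
  by move=> x [_ /negP]; rewrite /= !in_itv/= andbT -ltNge.
transitivity (m (A `\` D1) + m (A `&` D1))%E; first by rewrite h add0e.
by apply/esym; exact: (measureDI m mA mD1).
Qed.

Lemma mass_le (A B : set R) : measurable A -> measurable B -> A `<=` B -> mass A <= mass B.
Proof.
by move=> mA mB AB; rewrite fine_le ?fin_num_measure// le_measure ?inE.
Qed.

(** Since [Num.sg 0 = 0], endpoints count by half: the open interval serves for the lower bound, the
    closed one for the upper, and exp(-ux) is replaced by its extreme values. *)
Lemma tilted_sign_increment (a b : R) : a < b ->
  expR (- (u * b)) * pi * mass (`]a, b[%classic) <= K b - K a <=
  expR (- (u * a)) * pi * mass (`[a, b]%classic).
Proof.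
move=> ab; pose phi x := expR (- (u * x)) * (pi / 2 * (Num.sg (b - x) - Num.sg (a - x))).
have sgi y : m.-integrable D1 (EFin \o (fun x => expR (- (u * x)) * (pi / 2 * Num.sg (y - x)))).
  apply: (@law_exp_integrable _ _ _ (pi / 2)); first exact: ltW.
    apply: measurable_funM => //; exact: sg_measurable.
  move=> x _; rewrite normrM ger0_norm ?divr_ge0 ?pi_ge0// ler_piMr ?divr_ge0 ?pi_ge0//.
  by rewrite normr_sg lern1 leq_b1.
have phiE : phi = (fun x => expR (- (u * x)) * (pi / 2 * Num.sg (b - x)) -
    expR (- (u * x)) * (pi / 2 * Num.sg (a - x))).
  by apply/funext => x; rewrite /phi; ring.
have phii : m.-integrable D1 (EFin \o phi) by rewrite phiE; exact: integrable_sub.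
have -> : K b - K a = \int[m]_(x in `[0, +oo[) phi x by rewrite phiE RintegralB.
have pi0 : 0 < pi :> R := pi_gt0 R.
have phi_in x : a < x < b -> phi x = expR (- (u * x)) * pi.
  move=> /andP[ax xb]; have h1 : Num.sg (b - x) = 1 by rewrite gtr0_sg ?subr_gt0.
  have h2 : Num.sg (a - x) = -1 by rewrite ltr0_sg ?subr_lt0.
  by rewrite /phi h1 h2; field.
have phi0 x : 0 <= phi x.
  rewrite mulr_ge0 ?expR_ge0// mulr_ge0 ?divr_ge0 ?(ltW pi0)// subr_ge0.
  by case: (sgrP (b - x)); case: (sgrP (a - x)) => //; lra.
have phi_le x : phi x <= expR (- (u * x)) * pi.
  rewrite /phi ler_wpM2l ?expR_ge0//.
  have hs : Num.sg (b - x) - Num.sg (a - x) <= 2.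
    case: (sgrP (b - x)) => ?; case: (sgrP (a - x)) => ?; lra.
  have pi2 : 0 <= pi / 2 :> R by rewrite divr_ge0 ?(ltW pi0).
  by have := ler_wpM2l pi2 hs; lra.
have phi_out x : ~~ (a <= x <= b) -> phi x = 0.
  rewrite negb_and -!ltNge => /orP[xa|bx]; rewrite /phi.
    by rewrite !gtr0_sg ?subr_gt0// ?(lt_trans xa)// subrr !mulr0.
  by rewrite !ltr0_sg ?subr_lt0// ?(lt_trans ab)// subrr !mulr0.
have mI : measurable (`]a, b[%classic `&` D1 : set R) by exact: measurableI.
have mI2 : measurable (D1 `&` `[a, b]%classic : set R) by exact: measurableI.
apply/andP; split.
  rewrite -mass_half_line// /mass -Rintegral_cst//.
  apply: (@le_trans _ _ (\int[m]_(x in (`]a, b[%classic `&` D1 : set R)) phi x)).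
    apply: le_Rintegral => //.
    - exact: (finite_measure_integrable_cst m).
    - by apply: integrableS phii => //; exact: subIsetr.
    - move=> x [/=]; rewrite !in_itv/= => /andP[ax xb] _; rewrite phi_in ?ax//.
      by rewrite ler_pM2r// ler_expR lerN2 ler_pM2l// ltW.
  by apply: Rintegral_subset => //; exact: subIsetr.
rewrite -mass_half_line// setIC /mass -Rintegral_cst//.
have -> : \int[m]_(x in `[0, +oo[) phi x = \int[m]_(x in (D1 `&` `[a, b]%classic : set R)) phi x.
  rewrite Rintegral_mkcondr; apply: eq_Rintegral => x _; rewrite patchE.
  by rewrite mem_setE in_itv/=; case: ifPn => // /phi_out.
apply: le_Rintegral => //.
- by apply: integrableS phii => //; exact: subIsetl.
- exact: (finite_measure_integrable_cst m).
- move=> x [/=]; rewrite !in_itv/= => _ /andP[ax _]; apply: (le_trans (phi_le x)).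
  by rewrite ler_pM2r// ler_expR lerN2 ler_pM2l.
Qed.

Lemma tilted_sign_lipschitz : exists B, forall a b, `|K b - K a| <= B * `|b - a|.
Proof.
have [B hB] := osc_bounded rC rS; exists B.
exact: (derive_bounded_lipschitz (fun x => is_derive_tilted_sign u0 rC rS x) hB).
Qed.

(** On ]y - d, y + d[ the Lipschitz bound of [tilted_sign] leaves a mass of order d. *)
Lemma mass_atom (y : R) : mass [set y] = 0.
Proof.
have [B hB] := tilted_sign_lipschitz.
have pi0 : 0 < pi :> R := pi_gt0 R.
have B0 : 0 <= B by have := hB 0 1; rewrite subr0 normr1 mulr1; exact: le_trans.
pose c := expR (- (u * (y + 1))) * pi.
have c0 : 0 < c by rewrite mulr_gt0// expR_gt0.
have h n : `|mass [set y]| <= (2 * B / c) / n.+1%:R.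
  rewrite ger0_norm ?fine_ge0//; set d := n.+1%:R^-1.
  have d0 : 0 < d by rewrite invr_gt0.
  have d1 : d <= 1 by rewrite invf_le1// ler1n.
  have yd : y - d < y + d by lra.
  have /andP[h1 _] := tilted_sign_increment yd.
  have h2 := le_trans (ler_norm _) (hB (y - d) (y + d)).
  have h3 : mass [set y] <= mass (`](y - d), (y + d)[%classic).
    by apply: mass_le => // x ->; rewrite /= in_itv/=; apply/andP; split; lra.
  rewrite mulrAC ler_pdivlMr//.
  have -> : 2 * B / n.+1%:R = B * `|y + d - (y - d)|.
    by rewrite ger0_norm; [rewrite /d; ring|lra].
  apply: le_trans h2; apply: le_trans h1; rewrite mulrC; apply: ler_pM => //.
  - exact: ltW.
  - exact: fine_ge0.
  - by rewrite /c ler_pM2r// ler_expR lerN2 ler_pM2l// lerD2l.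
have := cvg0_harmonic h => /(cvg_unique _ (cvg_cst (mass [set y])))->//.
Qed.

Let mass_null (y : R) : m [set y] = 0%E.
Proof. by have := mass_atom y; rewrite /mass => h; rewrite -[LHS]fineK ?fin_num_measure// h. Qed.

Lemma mass_oo (a b : R) : a < b -> mass (`]a, b[%classic) = mass (`]a, b]%classic).
Proof.
move=> ab; rewrite /mass; congr fine.
have -> : (`]a, b]%classic : set R) = `]a, b[%classic `|` [set b] by rewrite setUitv1.
by apply/esym; apply: (@measureU0 _ _ _ m) => //; exact: mass_null.
Qed.

Lemma mass_cc (a b : R) : a <= b -> mass (`[a, b]%classic) = mass (`]a, b]%classic).
Proof.
move=> ab; rewrite /mass; congr fine.
have -> : (`[a, b]%classic : set R) = `]a, b]%classic `|` [set a] by rewrite setUC setU1itv.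
by apply: (@measureU0 _ _ _ m) => //; exact: mass_null.
Qed.

Let cdf_ (y : R) : R := mass (`]-oo, y]%classic).

Lemma mass_oc (a b : R) : a <= b -> mass (`]a, b]%classic) = cdf_ b - cdf_ a.
Proof.
move=> ab; rewrite /cdf_ /mass.
have -> : (`]-oo, b]%classic : set R) = `]-oo, a]%classic `|` `]a, b]%classic.
  by rewrite -itv_bndbnd_setU// bnd_simp.
rewrite measureU//; last first.
  by apply/seteqP; split => // x [/=]; rewrite !in_itv/= => xa /andP[/(le_lt_trans xa)]; rewrite ltxx.
by rewrite fineD ?fin_num_measure// addrC addKr.
Qed.

Lemma cdf_increment (a b : R) : a < b ->
  expR (u * a) * ((K b - K a) / pi) <= cdf_ b - cdf_ a <= expR (u * b) * ((K b - K a) / pi).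
Proof.
move=> ab; have pi0 : 0 < pi :> R := pi_gt0 R.
have /andP[h1 h2] := tilted_sign_increment ab.
move: h1 h2; rewrite mass_oo// mass_cc ?(ltW ab)// mass_oc ?(ltW ab)// => h1 h2.
apply/andP; split.
  rewrite mulrA ler_pdivrMr// -ler_pdivlMl ?expR_gt0// -expRN.
  by apply: (le_trans h2); rewrite -!mulrA [X in _ * X]mulrC.
rewrite mulrA ler_pdivlMr// -ler_pdivrMl ?expR_gt0// -expRN.
by apply: le_trans h1; rewrite -!mulrA [X in _ * X]mulrC.
Qed.

(** [J / pi] is the density of exp(-ux) m(dx), and exp(uy) undoes the tilt. *)
Definition tilted_density (y : R) : R := expR (u * y) * (J y / pi).

Lemma is_derive_cdf (y : R) : is_derive y 1 cdf_ (tilted_density y).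
Proof.
have [B hB] := tilted_sign_lipschitz.
have pi0 : 0 < pi :> R := pi_gt0 R.
have B0 : 0 <= B by have := hB 0 1; rewrite subr0 normr1 mulr1; exact: le_trans.
set M := \int[leb]_(v in (`[0%R, +oo[%classic : set (measurableTypeR R)))
   (`|v * C v| + `|v * S v|).
have Mlip := osc_transform_lipschitz rC rS; rewrite -/M in Mlip.
have M0 : 0 <= M by apply: Rintegral_ge0 => v _; rewrite addr_ge0.
pose X := u * expR (u * (y + 1)).
have X0 : 0 <= X by rewrite mulr_ge0 ?expR_ge0// ltW.
apply: (@is_derive_quad_near _ _ _ _ (X * B / pi + expR (u * y) * M / pi)) => h h1.
have eX : `|expR (u * (y + h)) - expR (u * y)| <= X * `|h|.
  have := @segment_lipschitz _ (fun z => expR (u * z)) (fun z => u * expR (u * z)) X y (y + h).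
  rewrite (_ : y + h - y = h); last by ring.
  apply.
    by move=> x _; derives; ring.
  move=> x xy; rewrite ger0_norm ?mulr_ge0 ?expR_ge0 ?(ltW u0)// /X ler_pM2l//.
  rewrite ler_expR (ler_pM2l u0).
  have : `|x - y| <= 1 by exact: le_trans xy h1.
  by rewrite ler_norml => /andP[_]; lra.
have Kj : `|K (y + h) - K y - h * J y| <= M * h ^+ 2.
  have := @segment_lipschitz _ (fun z => K z - z * J y) (fun z => J z - J y) (M * `|h|) y (y + h).
  rewrite (_ : y + h - y = h); last by ring.
  rewrite (_ : K (y + h) - (y + h) * J y - (K y - y * J y) = K (y + h) - K y - h * J y); last by ring.
  rewrite -mulrA -expr2 real_normK ?num_real//; apply.
    move=> x _; have h2 := is_derive_tilted_sign u0 rC rS x.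
    apply: (is_derive_eq (is_derive_sub h2 (is_derive_mul (is_derive_idfun x) (is_derive_const (J y) x)))).
    by ring.
  by move=> x xy; apply: (le_trans (Mlip _ _)); rewrite ler_wpM2l.
pose k := (K (y + h) - K y) / pi.
have kb : `|k| <= B * `|h| / pi.
  rewrite /k normrM normfV (gtr0_norm pi0) ler_pM2r ?invr_gt0//.
  by have := hB y (y + h); rewrite (_ : y + h - y = h)//; ring.
(* On a short interval the factor exp(ux) lies between its values at the ends. Their difference is
   of order h, and so is k, so replacing it by exp(uy) costs a quadratic error. *)
have main : `|cdf_ (y + h) - cdf_ y - expR (u * y) * k| <=
    `|expR (u * (y + h)) - expR (u * y)| * `|k|.
  suff /andP[h2 h3] : expR (u * y) * k <= cdf_ (y + h) - cdf_ y <= expR (u * (y + h)) * k.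
    rewrite -normrM (ger0_norm (_ : 0 <= _ - expR (u * y) * k)) ?subr_ge0//.
    apply: (@le_trans _ _ ((expR (u * (y + h)) - expR (u * y)) * k)); last exact: ler_norm.
    by rewrite mulrBl lerD2r.
  case: (ltgtP h 0) => [hn|hp|].
  - have yh : y + h < y by lra.
    have /andP[] := cdf_increment yh.
    rewrite (_ : (K y - K (y + h)) / pi = - k); last by rewrite /k; ring.
    by rewrite !mulrN => h2 h3; apply/andP; split; lra.
  - by apply: cdf_increment; lra.
  - move=> hz; have k0 : k = 0 by rewrite /k hz addr0 subrr mul0r.
    by rewrite k0 hz addr0 subrr !mulr0 lexx.
have -> : cdf_ (y + h) - cdf_ y - h * tilted_density y =
    (cdf_ (y + h) - cdf_ y - expR (u * y) * k) +
    expR (u * y) / pi * (K (y + h) - K y - h * J y).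
  by rewrite /k /tilted_density; ring.
apply: (le_trans (ler_normD _ _)); rewrite mulrDl; apply: lerD.
  apply: (le_trans main); apply: (@le_trans _ _ (X * `|h| * (B * `|h| / pi))).
    by apply: ler_pM.
  by rewrite -(real_normK (num_real h)) le_eqVlt; apply/orP; left; apply/eqP; ring.
have ep : 0 <= expR (u * y) / pi by rewrite divr_ge0 ?expR_ge0 ?(ltW pi0).
rewrite normrM (ger0_norm ep).
have -> : expR (u * y) * M / pi * h ^+ 2 = expR (u * y) / pi * (M * h ^+ 2) by ring.
by rewrite ler_wpM2l.
Qed.

(** A negative value of J would persist nearby and make [tilted_sign] decrease, against
    [tilted_sign_increment]. *)
Lemma tilted_density_ge0 (y : R) : 0 <= tilted_density y.
Proof.
rewrite mulr_ge0 ?expR_ge0// divr_ge0 ?pi_ge0// leNgt; apply/negP => Jy.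
have cJ := is_derive_continuous (is_derive_osc y rC rS).
have [e e0 he] : exists2 e, 0 < e & forall z, `|z - y| <= e -> J z < 0.
  have /cvgrPdist_lt/(_ (- J y)) := cJ; rewrite oppr_gt0 => /(_ Jy).
  move=> /nbhs_ballP[e /= e0 he]; exists (e / 2); first by rewrite divr_gt0.
  move=> z zy; have : ball y e z by rewrite /ball/= distrC; lra.
  by move=> /he; rewrite ltr_norml => /andP[+ _]; lra.
have ye : y <= y + e by lra.
have [c /andP[yc ce] h] := mean_value ye (fun x _ => is_derive_tilted_sign u0 rC rS x).
have yle : y < y + e by lra.
have /andP[h1 _] := tilted_sign_increment yle.
have h2 : 0 <= K (y + e) - K y.
  by apply: le_trans h1; rewrite !mulr_ge0 ?expR_ge0 ?pi_ge0 ?fine_ge0.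
have Jc : J c < 0 by apply: he; rewrite ger0_norm; lra.
move: h2; rewrite h (_ : y + e - y = e); last by ring.
by rewrite pmulr_lge0// leNgt Jc.
Qed.

Lemma tilted_density_continuous : continuous tilted_density.
Proof.
have h (w : R) : is_derive w 1 (fun v => expR (u * v)) (u * expR (u * w)) by derives; ring.
have cJ y := is_derive_continuous (is_derive_osc y rC rS).
rewrite /tilted_density => y.
have c0 : continuous (fun v : R => expR (u * v)) by exact: is_derive_all_continuous h.
exact: (continuousM (c0 y) (continuousM (cJ y) (cvg_cst pi^-1))).
Qed.

Lemma tilted_density_smooth : smooth tilted_density.
Proof.
have -> : tilted_density = (fun y => expR (u * y) * osc (fun v => C v / pi) (fun v => S v / pi) y).
  apply/funext => y; congr (_ * _); rewrite /osc mulrC -RintegralZl//; last exact: osc_integrable.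
  by apply: eq_Rintegral => v _; ring.
apply: smooth_expM; apply: smooth_osc.
- split=> [v|n]; first exact: (continuousM (rC.1 v) (cvg_cst _)).
  have [c hc] := rC.2 n; exists (c * `|pi^-1|) => v v0.
  by rewrite normrM mulrA ler_wpM2r// hc.
- split=> [v|n]; first exact: (continuousM (rS.1 v) (cvg_cst _)).
  have [c hc] := rS.2 n; exists (c * `|pi^-1|) => v v0.
  by rewrite normrM mulrA ler_wpM2r// hc.
Qed.

Lemma integral_tilted_density (a b : R) : a < b ->
  (\int[leb]_(y in (`]a, b]%classic : set (measurableTypeR R))) (tilted_density y)%:E =
   m (`]a, b]%classic))%E.
Proof.
move=> ab; have cd := tilted_density_continuous.
have md : measurable_fun (setT : set (measurableTypeR R)) (fun y => (tilted_density y)%:E).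
  by apply/measurable_EFinP; exact: continuous_measurable_fun.
rewrite integral_itv_obnd_cbnd; last exact: measurable_funTS.
rewrite (ftc_segment ab cd is_derive_cdf) -mass_oc ?(ltW ab)// /mass fineK//.
by rewrite fin_num_measure.
Qed.

Let density_measure (B : set R) : \bar R :=
  (\int[leb]_(y in (B : set (measurableTypeR R))) (tilted_density y)%:E)%E.

Let density_measure0 : density_measure set0 = 0%E.
Proof. exact: integral_set0. Qed.

Let density_measure_ge0 B : (0 <= density_measure B)%E.
Proof. by apply: integral_ge0 => y _; rewrite lee_fin tilted_density_ge0. Qed.

Let density_measure_sigma_additive : semi_sigma_additive density_measure.
Proof.
move=> /= F mF tF mUF; rewrite /density_measure; apply: cvg_toP.
  apply: ereal_nondecreasing_is_cvgn => i j ij.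
  apply: lee_sum_nneg_natr => // k _ _.
  by apply: integral_ge0 => /= x Fkx; rewrite lee_fin tilted_density_ge0.
rewrite ge0_integral_bigcup//=.
- apply: measurable_funTS; apply/measurable_EFinP.
  exact: (continuous_measurable_fun tilted_density_continuous).
- by move=> x _; rewrite lee_fin tilted_density_ge0.
Qed.

HB.instance Definition _ := isMeasure.Build _ _ _ density_measure
  density_measure0 density_measure_ge0 density_measure_sigma_additive.

Lemma tilted_densityP (B : set R) : measurable B ->
  m B = (\int[leb]_(y in B) (tilted_density y)%:E)%E.
Proof.
move=> mB.
have cover : \bigcup_(k : nat) (`](- k%:R), k%:R]%classic : set R) = setT.
  rewrite -subTset => x _; exists (Num.truncn `|x|).+1 => //=; rewrite in_itv/=.
  have := truncnS_gt `|x|; rewrite ltr_norml => /andP[-> /ltW ->]//.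
have eqG (A : set R) : ocitv A -> density_measure A = m A.
  move=> [[a b] /= ab <-]; have [ab'|ba] := ltP a b; first exact: integral_tilted_density.
  by rewrite set_itv_ge ?bnd_simp -?leNgt// !measure0.
have gE : (default_measure_display.-measurable : set (set R)) = <<s @ocitv R >>.
  by [].
have mu := @measure_unique _ R R (@ocitv R) (fun k : nat => `](- k%:R), k%:R]%classic)
  gE (@ocitvI R) (fun k => is_ocitv _ _) cover density_measure.
have mu2 := mu m.
apply/esym; apply: mu2 => //.
move=> k; rewrite [X in (X < _)%E](_ : _ = m (`](- k%:R), k%:R]%classic)).
  by rewrite ltey_eq fin_num_measure.
exact: (eqG _ (is_ocitv _ _)).
Qed.

(** A continuous density is the derivative of the distribution function, already known to be
    [tilted_density]. A given density is thus the tilted one for every admissible u at once. *)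
Lemma density_unique (f : R -> R) : continuous f -> (forall y, 0 <= f y) ->
  (forall B : set R, measurable B -> m B = (\int[leb]_(y in B) (f y)%:E)%E) ->
  f = tilted_density.
Proof.
move=> cf f0 hf; apply/funext => y.
have yy : y < y + 1 by rewrite ltrDl.
have ay : y - 1 < y by rewrite ltrBlDr ltrDl.
have fi : leb.-integrable (`[(y - 1)%R, (y + 1)%R]%classic : set (measurableTypeR R)) (EFin \o f).
  apply: continuous_compact_integrable; first exact: segment_compact.
  exact: continuous_subspaceT.
have [d1 d2] := @continuous_FTC1_closed R f (y - 1) y (y + 1) yy fi ay (cf y).
have h1 : is_derive y 1 (fun x => \int[leb]_(t in [set` `[y - 1, x]]) f t) (f y).
  by apply: DeriveDef => //; rewrite -derive1E.
have h2 : is_derive y 1 (fun x => cdf_ x - cdf_ (y - 1)) (tilted_density y).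
  apply: (is_derive_eq (is_derive_sub (is_derive_cdf y) (is_derive_const _ y))).
  by rewrite subr0.
have h3 : is_derive y 1 (fun x => \int[leb]_(t in [set` `[y - 1, x]]) f t) (tilted_density y).
  apply: near_eq_is_derive h2; near=> x.
  have ax : y - 1 <= x by apply/ltW; near: x; exact: lt_nbhsr.
  by rewrite -mass_oc// -mass_cc// /mass hf.
by rewrite -(is_derive_derive1 h1) (is_derive_derive1 h3).
Unshelve. all: by end_near. Qed.

End Density.

(** * Decay of the transform *)

Section TransformDecay.
Context {R : realType} (b : R) (Pi : {measure set R -> \bar R}).
Hypothesis hPi : levy_measure Pi.
Hypothesis hSC : stochastically_compact0 Pi.

Local Notation q := (Qmoment Pi).

Lemma alpha_ge_Qmoment (C y0 u v : R) : 0 < C ->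
  (forall y, 0 < y < y0 -> Umoment Pi y <= C * Vmoment Pi y) ->
  0 <= u -> 0 < v -> v^-1 < y0 ->
  expR (- (u / v)) / (8 * C) * q v^-1 <= alpha Pi u v.
Proof.
move=> C0 UV u0 v0 vy; have vi : 0 < v^-1 by rewrite invr_gt0.
have h := @alpha_ge R Pi hPi u v v^-1 u0 (ltW v0) vi.
apply: le_trans (h _); last by rewrite divff// gt_eqF.
have hU : Umoment Pi v^-1 <= C * Vmoment Pi v^-1 by apply: UV; rewrite vi.
rewrite /q exprVn invrK.
have -> : expR (- (u / v)) / (8 * C) * (v ^+ 2 * Umoment Pi v^-1) =
  expR (- (u / v)) * v ^+ 2 / 8 * (Umoment Pi v^-1 / C) by field; rewrite gt_eqF.
apply: ler_wpM2l; first by rewrite divr_ge0// mulr_ge0 ?expR_ge0// sqr_ge0.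
by rewrite ler_pdivrMr// mulrC.
Qed.

(** At frequency v the jumps below 1 / v give alpha at least a multiple of [q v^-1], whose power
    [N.+1] grows at least linearly in v. *)
Lemma alpha_power_growth (u : R) : 0 < u -> exists k v0 (N : nat),
  [/\ 0 < k, 0 < v0 & forall v, v0 <= v -> k * v <= alpha Pi u v ^+ N.+1].
Proof.
move=> u0; have [C [y0 [N [C0 y00 UV qpow]]]] := sc_regular hPi hSC.
pose z := y0 / 2; have z0 : 0 < z by rewrite divr_gt0.
have zy : z < y0 by rewrite /z; lra.
have qz : 0 < q z.
  rewrite mulr_gt0 ?invr_gt0 ?exprn_gt0//.
  exact: lt_le_trans (sc_Vmoment_gt0 hSC z0) (Vmoment_le_Umoment hPi z0).
pose c := expR (- (u * z)) / (8 * C).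
have c0 : 0 < c by rewrite divr_gt0 ?expR_gt0// mulr_gt0.
exists (c ^+ N.+1 * (z / 2 * q z ^+ N.+1)), z^-1, N; split.
- by rewrite !mulr_gt0 ?exprn_gt0// divr_gt0.
- by rewrite invr_gt0.
move=> v zv; have v0 : 0 < v by rewrite (lt_le_trans _ zv)// invr_gt0.
have vi : 0 < v^-1 by rewrite invr_gt0.
have vz : v^-1 <= z by rewrite -[z]invrK lef_pV2 ?posrE// invr_gt0.
have h1 := alpha_ge_Qmoment C0 UV (ltW u0) v0 (le_lt_trans vz zy).
have h2 : c * q v^-1 <= alpha Pi u v.
  apply: le_trans h1; rewrite ler_wpM2r ?Qmoment_ge0//.
  rewrite ler_pM2r ?invr_gt0 ?mulr_gt0// ler_expR lerN2 ler_pM2l//.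
apply: (@le_trans _ _ ((c * q v^-1) ^+ N.+1)); last first.
  have cq : 0 <= c * q v^-1 by rewrite mulr_ge0 ?Qmoment_ge0// ltW.
  by rewrite lerXn2r ?nnegrE// (le_trans cq).
rewrite [leRHS]exprMn -[leLHS]mulrA ler_wpM2l ?exprn_ge0 ?(ltW c0)//.
have := qpow _ _ vi vz zy; apply: le_trans.
by rewrite le_eqVlt; apply/orP; left; apply/eqP; field; rewrite gt_eqF.
Qed.

Variables (m : probability R R) (t : R).
Hypothesis t0 : 0 < t.
Hypothesis hm : has_laplace_transform b Pi m t.

Lemma exp_alpha_rapid (u : R) (n : nat) : 0 < u ->
  exists c, forall v, 0 <= v -> v ^+ n * expR (- (t * alpha Pi u v)) <= c.
Proof.
move=> u0; have [k [v0 [N [k0 v00 hk]]]] := alpha_power_growth u0.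
(* Up to a constant, v is at most [alpha ^+ N.+1], so [v ^+ n] is at most [alpha ^+ p]. *)
pose p := (N.+1 * n)%N.
exists (v0 ^+ n + p`!%:R / (t ^+ p * k ^+ n)) => v vge0.
have tk0 : 0 < t ^+ p * k ^+ n by rewrite mulr_gt0// exprn_gt0.
have al0 := alpha_ge0 Pi u v.
have ta0 : 0 <= t * alpha Pi u v by rewrite mulr_ge0// ltW.
have [vv|vv] := leP v v0.
  apply: (@le_trans _ _ (v0 ^+ n)); last by rewrite lerDl divr_ge0// ltW.
  rewrite -[leRHS]mulr1; apply: ler_pM; rewrite ?exprn_ge0 ?expR_ge0 ?expRN_le1//.
  by rewrite lerXn2r// ?nnegrE// ltW.
apply: (@le_trans _ _ (p`!%:R / (t ^+ p * k ^+ n))); last by rewrite lerDr exprn_ge0// ltW.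
rewrite ler_pdivlMr//; apply: le_trans (pow_expRN_le p ta0).
rewrite mulrAC ler_wpM2r ?expR_ge0// exprMn.
rewrite mulrCA ler_wpM2l ?exprn_ge0 ?(ltW t0)// mulrC -exprMn exprM.
have kv : 0 <= k * v by rewrite mulr_ge0// ltW.
have hv := hk v (ltW vv).
by apply: lerXn2r => //; rewrite nnegrE exprn_ge0.
Qed.

Lemma cos_transform_rapid (u : R) : 0 < u -> rapid (cos_transform m u).
Proof.
move=> u0; split.
  exact: is_derive_all_continuous (fun v => is_derive_cos_transform hPi hm v u0).
move=> n; have [c hc] := exp_alpha_rapid n u0.
exists (expR (- (t * psi b Pi u)) * c) => v v0.
have [-> _] := trig_transformE hPi hm v u0.
rewrite normrM (ger0_norm (expR_ge0 _)) mulrCA ler_wpM2l ?expR_ge0//.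
apply: le_trans (hc v v0); rewrite ler_wpM2l ?exprn_ge0//.
by rewrite normrM (ger0_norm (expR_ge0 _)) ler_piMr ?expR_ge0 ?cos_max.
Qed.

Lemma sin_transform_rapid (u : R) : 0 < u -> rapid (sin_transform m u).
Proof.
move=> u0; split.
  exact: is_derive_all_continuous (fun v => is_derive_sin_transform hPi hm v u0).
move=> n; have [c hc] := exp_alpha_rapid n u0.
exists (expR (- (t * psi b Pi u)) * c) => v v0.
have [_ ->] := trig_transformE hPi hm v u0.
rewrite normrM (ger0_norm (expR_ge0 _)) mulrCA ler_wpM2l ?expR_ge0//.
apply: le_trans (hc v v0); rewrite ler_wpM2l ?exprn_ge0//.
by rewrite normrM (ger0_norm (expR_ge0 _)) ler_piMr ?expR_ge0 ?sin_max.
Qed.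

End TransformDecay.

(** * The local limit estimate *)

Section GaussianTransform.
Context {R : realType}.

Local Notation leb := (@lebesgue_measure R).
Local Notation H := (`[0%R, +oo[%classic : set (measurableTypeR R)).

Let mH : measurable H. Proof. exact: measurable_itv. Qed.

Variable s : R.
Hypothesis s0 : 0 < s.

Definition gaussian (v : R) : R := expR (- ((s * v) ^+ 2 / 2)).

Let is_derive_gaussian (v : R) : is_derive v 1 gaussian (- (s ^+ 2 * v * gaussian v)).
Proof. by rewrite /gaussian; derives; field. Qed.

Lemma gaussian_rapid : rapid gaussian.
Proof.
split; first exact: is_derive_all_continuous is_derive_gaussian.
move=> n; exists (1 + n`!%:R * (2 / s ^+ 2) ^+ n) => v v0.
have g0 : 0 <= gaussian v by exact: expR_ge0.
have a0 : 0 <= (s * v) ^+ 2 / 2 by rewrite divr_ge0// sqr_ge0.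
have g1 : gaussian v <= 1 by exact: expRN_le1.
have c0 : 0 <= (2 / s ^+ 2) ^+ n by rewrite exprn_ge0// divr_ge0// sqr_ge0.
rewrite ger0_norm//; have [v1|v1] := leP v 1.
  apply: (@le_trans _ _ 1); last by rewrite lerDl mulr_ge0.
  by rewrite mulr_ile1// ?exprn_ge0// exprn_ile1.
apply: (@le_trans _ _ (v ^+ (2 * n) * gaussian v)).
  by rewrite ler_wpM2r// ler_weXn2l ?(ltW v1)// leq_pmull.
have -> : v ^+ (2 * n) * gaussian v =
    ((s * v) ^+ 2 / 2) ^+ n * gaussian v * (2 / s ^+ 2) ^+ n.
  rewrite mulrAC -exprMn exprM; congr (_ ^+ _ * _).
  by field; rewrite gt_eqF.
apply: (@le_trans _ _ (n`!%:R * (2 / s ^+ 2) ^+ n)); last by rewrite lerDr.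
by rewrite ler_wpM2r// pow_expRN_le.
Qed.

(** [gauss_fun] is exp(-x^2), and [(s v)^2 / 2 = (scale v)^2]. *)
Let scale : R := s / Num.sqrt 2.

Let scale_gt0 : 0 < scale. Proof. by rewrite divr_gt0. Qed.

Lemma gaussian_integral0 : \int[leb]_(v in H) gaussian v = Num.sqrt pi / 2 / scale.
Proof.
have dF (x : R) : is_derive x 1 (fun y => scale * y) scale by derives; ring.
have dE : derive1 (fun y : R => scale * y) = cst scale.
  by apply/funext => x; exact: is_derive_derive1.
have := @increasing_ge0_integration_by_substitutiony R (fun y => scale * y) gauss_fun 0.
rewrite mulr0 integral0y_gauss dE => h.
have {}h : ((Num.sqrt pi / 2)%:E = \int[leb]_(x in H) (scale * gaussian x)%:E)%E.
  rewrite h.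
  - apply: eq_integral => x _ /=; congr (_%:E); rewrite [LHS]mulrC; congr (_ * _).
    rewrite /gauss_fun /gaussian; congr expR; rewrite /scale exprMn expr_div_n sqr_sqrtr//.
    by ring.
  - by move=> x y _ _ xy; rewrite ltr_pM2l.
  - by move=> x _; exact: cvg_cst.
  - by apply/cvg_ex; exists scale; exact: cvg_cst.
  - by apply/cvg_ex; exists scale; exact: cvg_cst.
  - split; first by move=> x _; have hx := dF x; exact: ex_derive.
    exact/cvg_at_right_filter/(is_derive_all_continuous dF).
  - exact: (gt0_cvgMry scale_gt0 (@cvg_id _ (pinfty_nbhs R))).
  - exact/continuous_subspaceT/continuous_gauss_fun.
  - by move=> x _; exact: gauss_fun_ge0.
have {}h : Num.sqrt pi / 2 = \int[leb]_(x in H) (scale * gaussian x) by rewrite /Rintegral -h.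
rewrite h RintegralZl//; first by rewrite mulrAC divff ?mul1r// gt_eqF.
have := rapid_norm_integrable gaussian_rapid; apply: eq_integrable => // v _ /=.
by rewrite ger0_norm ?expR_ge0.
Qed.

Let rg := gaussian_rapid.

Let gcos (y : R) : leb.-integrable H (EFin \o (fun v => gaussian v * cos (v * y))).
Proof. by apply: rapid_mul_integrable => //; [measurability|move=> v _; exact: cos_max]. Qed.

(** The integral I satisfies [I' = - (y / s^2) I] by the integration by parts [ibp]; its product
    with exp(y^2 / (2 s^2)) is therefore constant. *)
Lemma gaussian_cos_transform (y : R) :
  \int[leb]_(v in H) (gaussian v * cos (v * y)) =
  Num.sqrt pi / 2 / scale * expR (- (y ^+ 2 / (2 * s ^+ 2))).
Proof.
pose I y := \int[leb]_(v in H) (gaussian v * cos (v * y)).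
have vgsin z : leb.-integrable H (EFin \o (fun v => v * gaussian v * sin (v * z))).
  by apply: rapid_mul_integrable; [exact: rapid_mulX|measurability|move=> v _; exact: sin_max].
have ibp z : z * I z = s ^+ 2 * \int[leb]_(v in H) (v * gaussian v * sin (v * z)).
  apply/eqP; rewrite -subr_eq0; apply/eqP; rewrite /I -!RintegralZl// -RintegralB//.
  - pose f v := z * (gaussian v * cos (v * z)) - s ^+ 2 * (v * gaussian v * sin (v * z)).
    have dF (v : R) : is_derive v 1 (fun v => gaussian v * sin (v * z)) (f v).
      have hs : is_derive v 1 (fun v => sin (v * z)) (z * cos (v * z)) by derives; ring.
      by apply: (is_derive_eq (is_derive_mul (is_derive_gaussian v) hs)); rewrite /f; ring.
    have cf : continuous f.
      have cg := rg.1.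
      have cc : continuous (fun v : R => cos (v * z)).
        have h (w : R) : is_derive w 1 (fun v => cos (v * z)) (- (z * sin (w * z))) by derives; ring.
        exact: is_derive_all_continuous h.
      have cs : continuous (fun v : R => sin (v * z)).
        have h (w : R) : is_derive w 1 (fun v => sin (v * z)) (z * cos (w * z)) by derives; ring.
        exact: is_derive_all_continuous h.
      move=> v; rewrite /f.
      exact: (continuousB (continuousM (cvg_cst z) (continuousM (cg v) (cc v)))
        (continuousM (cvg_cst (s ^+ 2)) (continuousM (continuousM (@cvg_id _ (nbhs v)) (cg v)) (cs v)))).
    have fi : leb.-integrable H (EFin \o f) by apply: integrable_sub => //; exact: integrable_scale.
    rewrite (half_line_FTC cf dF fi (l := 0)) ?mul0r ?sin0 ?mulr0 ?subrr//.
    have [c hc] := rg.2 1%N; apply: (@cvg0_harmonic _ _ c) => n.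
    rewrite normrM; apply: (@le_trans _ _ `|gaussian n.+1%:R|); first by rewrite ler_piMr ?sin_max.
    by rewrite ler_pdivlMr// mulrC; have := hc n.+1%:R (ler0n _ _); rewrite expr1.
  - exact: integrable_scale.
  - exact: integrable_scale.
have dI (z : R) : is_derive z 1 I (- (z / s ^+ 2 * I z)).
  have -> : - (z / s ^+ 2 * I z) = \int[leb]_(v in H) (- (v * gaussian v * sin (v * z))).
    have -> : z / s ^+ 2 * I z = \int[leb]_(v in H) (v * gaussian v * sin (v * z)).
      by rewrite mulrAC ibp; field; rewrite gt_eqF.
    by rewrite -mulN1r -RintegralZl//; apply: eq_Rintegral => v _; rewrite mulN1r.
  apply: (@is_derive_Rintegral _ _ _ leb H (fun z v => gaussian v * cos (v * z))
    (fun z v => - (v * gaussian v * sin (v * z))) (fun v => `|v * gaussian v|) (z - 1) (z + 1)) => //.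
  - by apply/andP; split; lra.
  - by move=> w v _ _; derives; ring.
  - exact/rapid_norm_integrable/rapid_mulX.
  - by move=> w v _ _; rewrite normrN normrM ler_piMr ?sin_max.
have dE (z : R) : is_derive z 1 (fun z => I z * expR (z ^+ 2 / (2 * s ^+ 2))) 0.
  have he : is_derive z 1 (fun z => expR (z ^+ 2 / (2 * s ^+ 2)))
      (z / s ^+ 2 * expR (z ^+ 2 / (2 * s ^+ 2))) by derives; field; rewrite gt_eqF.
  by apply: (is_derive_eq (is_derive_mul (dI z) he)); ring.
have := is_derive_0_is_cst y 0 dE.
have -> : I 0 = Num.sqrt pi / 2 / scale.
  by rewrite -gaussian_integral0; apply: eq_Rintegral => v _; rewrite mulr0 cos0 mulr1.
rewrite expr0n/= mul0r expR0 mulr1 => <-.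
by rewrite -mulrA expRN divff ?mulr1// expR_eq0.
Qed.

Lemma normal_pdf_transform (y : R) :
  s / pi * \int[leb]_(v in H) (gaussian v * cos (v * y)) = normal_pdf 0 1 (y / s).
Proof.
rewrite gaussian_cos_transform /normal_pdf oner_eq0 /normal_peak /normal_fun.
have p0 : 0 < pi :> R := pi_gt0 R.
have sp : 0 < Num.sqrt pi :> R by rewrite sqrtr_gt0.
have -> : - (y / s - 0) ^+ 2 / (1 ^+ 2 *+ 2) = - (y ^+ 2 / (2 * s ^+ 2)).
  by rewrite subr0 expr1n; field; rewrite gt_eqF.
rewrite mulrA; congr (_ * _).
have -> : 1 ^+ 2 * pi *+ 2 = 2 * pi :> R by rewrite expr1n mul1r mulr_natl.
rewrite sqrtrM// invfM.
have e1 : pi = Num.sqrt pi ^+ 2 :> R by rewrite sqr_sqrtr ?ltW.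
have e2 : 2 = Num.sqrt 2 ^+ 2 :> R by rewrite sqr_sqrtr.
rewrite /scale {1}e1 {1}e2; field.
by rewrite !gt_eqF.
Qed.

End GaussianTransform.

(** * Comparison with the normal law *)

Section LocalError.
Context {R : realType} (b : R) (Pi : {measure set R -> \bar R}).
Hypothesis hPi : levy_measure Pi.
Hypothesis hSC : stochastically_compact0 Pi.
Variables (C y0 : R) (N : nat).
Hypothesis C0 : 0 < C.
Hypothesis UV : forall y, 0 < y < y0 -> Umoment Pi y <= C * Vmoment Pi y.
Hypothesis qpow : forall y z, 0 < y -> y <= z -> z < y0 ->
  z / (2 * y) * Qmoment Pi z ^+ N.+1 <= Qmoment Pi y ^+ N.+1.

Local Notation leb := (@lebesgue_measure R).
Local Notation H := (`[0%R, +oo[%classic : set (measurableTypeR R)).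
Local Notation q := (Qmoment Pi).

Let mH : measurable H. Proof. exact: measurable_itv. Qed.

Let E1 : R := expR (-1) / C.
Let E1_gt0 : 0 < E1. Proof. by rewrite divr_gt0 ?expR_gt0. Qed.

Variables (t u : R).
Hypothesis t0 : 0 < t.
Hypothesis u0 : 0 < u.
Hypothesis uy : u^-1 < y0.
Hypothesis M1 : 1 <= t * q u^-1.

(** The large parameter, comparable to [(s * u) ^+ 2] by [su_ge] and [su_le]. *)
Let M : R := t * q u^-1.
Let s : R := Num.sqrt t * sigma Pi u.
Let U1 : R := Umoment Pi u^-1.

Let ui : 0 < u^-1. Proof. by rewrite invr_gt0. Qed.

Let ME : M = t * u ^+ 2 * U1.
Proof. by rewrite /M /q exprVn invrK -/U1 mulrA. Qed.

Let sigma2_ge_U : E1 * U1 <= sigma2 Pi u.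
Proof.
apply: le_trans (sigma2_ge hPi u0).
have h : U1 <= C * Vmoment Pi u^-1 by apply: UV; rewrite ui.
rewrite /E1 -mulrA ler_wpM2l ?expR_ge0// mulrC ler_pdivrMr// mulrC //.
Qed.

Let sigma2_le_U : sigma2 Pi u <= 2 * U1.
Proof. by have := moment_le hPi 0 u0; rewrite expr0 divr1. Qed.

Let U1_gt0 : 0 < U1.
Proof. exact: lt_le_trans (sc_Vmoment_gt0 hSC ui) (Vmoment_le_Umoment hPi ui). Qed.

Let sigma2_gt0 : 0 < sigma2 Pi u.
Proof. by apply: lt_le_trans sigma2_ge_U; rewrite mulr_gt0. Qed.

Lemma scale_gt0 : 0 < Num.sqrt t * sigma Pi u.
Proof. by rewrite mulr_gt0 ?sqrtr_gt0. Qed.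

Let s0 : 0 < s. Proof. exact: scale_gt0. Qed.

Let s2E : s ^+ 2 = t * sigma2 Pi u.
Proof. by rewrite exprMn !sqr_sqrtr// ltW. Qed.

Let su_ge : E1 * M <= (s * u) ^+ 2.
Proof.
rewrite exprMn s2E ME.
have -> : E1 * (t * u ^+ 2 * U1) = t * u ^+ 2 * (E1 * U1) by ring.
have -> : t * sigma2 Pi u * u ^+ 2 = t * u ^+ 2 * sigma2 Pi u by ring.
by rewrite ler_wpM2l// mulr_ge0 ?sqr_ge0// ltW.
Qed.

Lemma scale_mul_ge : expR (-1) / C * (t * q u^-1) <= (Num.sqrt t * sigma Pi u * u) ^+ 2.
Proof. exact: su_ge. Qed.

Let su_le : (s * u) ^+ 2 <= 2 * M.
Proof.
rewrite exprMn s2E ME.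
have -> : 2 * (t * u ^+ 2 * U1) = t * u ^+ 2 * (2 * U1) by ring.
have -> : t * sigma2 Pi u * u ^+ 2 = t * u ^+ 2 * sigma2 Pi u by ring.
by rewrite ler_wpM2l// mulr_ge0 ?sqr_ge0// ltW.
Qed.

(** 12 is twice the 3! of [moment_le]: alpha and beta each have a Taylor error of [v^3] times the
    third tilted moment. *)
Let K1 : R := 12 / E1.
Let c1 : R := expR (-1) / (16 * C).
Let c3 : R := expR (-1) / (8 * C).
Let k4 : nat := (N.+1 * 4)%N.
(** From [(1 + w^2)^2 <= 2 + 2 w^4]; the terms in brackets bound [w^4 exp(-t alpha)], with w = s v,
    for v <= u and for v >= u. *)
Let K2 : R := 2 + 2 * (2 / c1 ^+ 2 + 64 * k4`!%:R / c3 ^+ k4).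

Let c1_gt0 : 0 < c1. Proof. by rewrite divr_gt0 ?expR_gt0// mulr_gt0. Qed.
Let c3_gt0 : 0 < c3. Proof. by rewrite divr_gt0 ?expR_gt0// mulr_gt0. Qed.

Let x : R := t * dpsi b Pi u.

Let taylor (v : R) : 0 <= v ->
  `|t * alpha Pi u v - (s * v) ^+ 2 / 2| + `|t * beta b Pi u v - v * x| <=
  K1 * (s * v) ^+ 3 / (s * u).
Proof.
move=> v0; have h1 := alpha_taylor hPi u0 v0; have h2 := beta_taylor b hPi u0 v0.
have h3 : moment Pi 3 u <= 6 * U1 / u by have := moment_le hPi 1 u0; rewrite expr1.
have v3 : 0 <= v ^+ 3 by rewrite exprn_ge0.
have -> : t * alpha Pi u v - (s * v) ^+ 2 / 2 =
    t * (alpha Pi u v - v ^+ 2 / 2 * sigma2 Pi u) by rewrite exprMn s2E; field.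
have -> : t * beta b Pi u v - v * x = t * (beta b Pi u v - v * dpsi b Pi u).
  by rewrite /x; ring.
rewrite !normrM (gtr0_norm t0).
have h4 : v ^+ 3 * moment Pi 3 u <= v ^+ 3 * (6 * U1 / u) by rewrite ler_wpM2l.
apply: (@le_trans _ _ (12 * v ^+ 3 / u ^+ 3 * M)).
  rewrite ME; have -> : 12 * v ^+ 3 / u ^+ 3 * (t * u ^+ 2 * U1) =
    t * (v ^+ 3 * (6 * U1 / u)) + t * (v ^+ 3 * (6 * U1 / u)) by field; rewrite gt_eqF.
  by apply: lerD; rewrite ler_pM2l//; [exact: le_trans h1 h4|exact: le_trans h2 h4].
have -> : K1 * (s * v) ^+ 3 / (s * u) = 12 * v ^+ 3 / u ^+ 3 * ((s * u) ^+ 2 / E1).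
  by rewrite /K1; field; rewrite !gt_eqF.
by rewrite ler_wpM2l ?divr_ge0 ?mulr_ge0// ?exprn_ge0 ?(ltW u0)// ler_pdivlMr// mulrC.
Qed.

Let one_sqr (w : R) : (1 + w ^+ 2) ^+ 2 <= 2 + 2 * w ^+ 4.
Proof. have := sqr_ge0 (1 - w ^+ 2); have -> : w ^+ 4 = (w ^+ 2) ^+ 2 by ring. nra. Qed.

(** For v <= u the jumps below 1 / u already give [t alpha >= c1 (s v)^2], a Gaussian decay. *)
Let alpha_decay_le (v : R) : 0 <= v -> v <= u ->
  (s * v) ^+ 4 * expR (- (t * alpha Pi u v)) <= 2 / c1 ^+ 2.
Proof.
move=> v0 vu; have vz : v * u^-1 <= 1 by rewrite ler_pdivrMr// mul1r.
have h := alpha_ge hPi (ltW u0) v0 ui vz; rewrite mulfV ?gt_eqF// in h.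
have hU : U1 <= C * Vmoment Pi u^-1 by apply: UV; rewrite ui.
have h2 : c1 * (s * v) ^+ 2 <= t * alpha Pi u v.
  apply: (@le_trans _ _ (t * (expR (-1) * v ^+ 2 / 8 * Vmoment Pi u^-1))); last by rewrite ler_pM2l.
  rewrite exprMn s2E /c1.
  have -> : expR (-1) / (16 * C) * (t * sigma2 Pi u * v ^+ 2) =
    t * (expR (-1) * v ^+ 2 / 8 * (sigma2 Pi u / (2 * C))) by field; rewrite gt_eqF.
  rewrite ler_pM2l// ler_wpM2l ?divr_ge0 ?mulr_ge0 ?expR_ge0 ?sqr_ge0//.
  by rewrite ler_pdivrMr ?mulr_gt0//; move: sigma2_le_U hU; lra.
have a0 : 0 <= c1 * (s * v) ^+ 2 by rewrite mulr_ge0 ?sqr_ge0// ltW.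
rewrite ler_pdivlMr ?exprn_gt0//.
apply: le_trans (pow_expRN_le 2 a0).
have -> : (s * v) ^+ 4 * expR (- (t * alpha Pi u v)) * c1 ^+ 2 =
  (c1 * (s * v) ^+ 2) ^+ 2 * expR (- (t * alpha Pi u v)) by ring.
by rewrite ler_wpM2l ?sqr_ge0// ler_expR lerN2.
Qed.

(** For v >= u the power growth of q takes over. Its fourth power, of exponent [k4], controls
    [(v / (2u))^4 M^2], as [M^2 <= M^(4(N+1))] for M >= 1. The 64 is 16 times 4, from
    [(s v)^4 = 16 (v / (2u))^4 (s u)^4] and [(s u)^2 <= 2 M]. *)
Let alpha_decay_ge (v : R) : u <= v ->
  (s * v) ^+ 4 * expR (- (t * alpha Pi u v)) <= 64 * k4`!%:R / c3 ^+ k4.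
Proof.
move=> uv; have v0 := lt_le_trans u0 uv; have vi : 0 < v^-1 by rewrite invr_gt0.
have vui : v^-1 <= u^-1 by rewrite lef_pV2 ?posrE.
have h1 := alpha_ge_Qmoment hPi C0 UV (ltW u0) v0 (le_lt_trans vui uy).
have h2 : c3 * q v^-1 <= alpha Pi u v.
  apply: le_trans h1; rewrite ler_wpM2r ?Qmoment_ge0// /c3.
  rewrite ler_pM2r ?invr_gt0 ?mulr_gt0// ler_expR lerN2.
  by rewrite ler_pdivrMr// mul1r.
have h3 : v / (2 * u) * q u^-1 ^+ N.+1 <= q v^-1 ^+ N.+1.
  apply: le_trans (qpow vi vui uy).
  by rewrite le_eqVlt; apply/orP; left; apply/eqP; field; rewrite !gt_eqF.
set P := t * alpha Pi u v.
have P0 : 0 <= P by rewrite mulr_ge0 ?alpha_ge0// ltW.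
have tq0 : 0 <= t * q v^-1 by rewrite mulr_ge0 ?Qmoment_ge0// ltW.
have h4 : c3 * (t * q v^-1) <= P by rewrite mulrCA ler_pM2l.
have h5 : v / (2 * u) * M ^+ N.+1 <= (t * q v^-1) ^+ N.+1.
  have -> : v / (2 * u) * M ^+ N.+1 = t ^+ N.+1 * (v / (2 * u) * q u^-1 ^+ N.+1).
    by rewrite /M exprMn mulrCA.
  by rewrite [leRHS]exprMn ler_wpM2l// exprn_ge0// ltW.
have vu0 : 0 <= v / (2 * u) by rewrite divr_ge0 ?mulr_ge0 ?(ltW u0) ?(ltW v0).
have M0 : 0 <= M by apply: le_trans M1.
have h6 : (v / (2 * u)) ^+ 4 * M ^+ 2 <= P ^+ k4 / c3 ^+ k4.
  rewrite ler_pdivlMr ?exprn_gt0//.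
  apply: (@le_trans _ _ ((c3 * (t * q v^-1)) ^+ k4)); last first.
    have c30 : 0 <= c3 * (t * q v^-1) by rewrite mulr_ge0// ltW.
    by apply: lerXn2r => //; rewrite nnegrE.
  rewrite [leRHS]exprMn mulrC ler_wpM2l ?exprn_ge0 ?(ltW c3_gt0)//.
  apply: (@le_trans _ _ ((v / (2 * u) * M ^+ N.+1) ^+ 4)).
    rewrite [leRHS]exprMn ler_wpM2l ?exprn_ge0// -exprM ler_weXn2l//.
  rewrite [leRHS]exprM; apply: lerXn2r => //; rewrite nnegrE.
    by rewrite mulr_ge0// exprn_ge0.
  by rewrite exprn_ge0.
have h7 : (s * v) ^+ 4 <= 64 * (P ^+ k4 / c3 ^+ k4).
  apply: (@le_trans _ _ (64 * ((v / (2 * u)) ^+ 4 * M ^+ 2))); last by rewrite ler_pM2l.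
  have -> : (s * v) ^+ 4 = 16 * (v / (2 * u)) ^+ 4 * ((s * u) ^+ 2) ^+ 2.
    by field; rewrite gt_eqF.
  have -> : 64 * ((v / (2 * u)) ^+ 4 * M ^+ 2) = 16 * (v / (2 * u)) ^+ 4 * (2 * M) ^+ 2 by ring.
  rewrite ler_wpM2l//; first by rewrite mulr_ge0// exprn_ge0.
  by apply: lerXn2r => //; rewrite nnegrE ?sqr_ge0// mulr_ge0.
apply: (@le_trans _ _ (64 * (P ^+ k4 / c3 ^+ k4) * expR (- P))).
  by rewrite ler_wpM2r// expR_ge0.
have -> : 64 * (P ^+ k4 / c3 ^+ k4) * expR (- P) = 64 * (P ^+ k4 * expR (- P)) / c3 ^+ k4 by ring.
by rewrite ler_pM2r ?invr_gt0 ?exprn_gt0// ler_pM2l// pow_expRN_le.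
Qed.

Let K2_ge : 2 <= K2.
Proof.
have a1 : 0 <= 2 / c1 ^+ 2 by rewrite divr_ge0// sqr_ge0.
have a2 : 0 <= 64 * k4`!%:R / c3 ^+ k4 by apply: divr_ge0; [rewrite mulr_ge0|apply: exprn_ge0; exact: ltW].
by rewrite /K2 lerDl mulr_ge0// addr_ge0.
Qed.

(** One Lorentz factor is to be integrated, the other makes the range s v > W negligible. *)
Let decay (v : R) : 0 <= v ->
  expR (- (t * alpha Pi u v)) <= K2 * (lorentz s v) ^+ 2.
Proof.
move=> v0; have lp : 0 < (1 + (s * v) ^+ 2) ^+ 2 by rewrite exprn_gt0// ltr_pwDl// sqr_ge0.
rewrite /lorentz exprVn ler_pdivlMr//.
have e0 := expR_ge0 (- (t * alpha Pi u v)).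
have e1 : expR (- (t * alpha Pi u v)) <= 1.
  by rewrite expRN_le1// mulr_ge0 ?alpha_ge0// ltW.
have a1 : 0 <= 2 / c1 ^+ 2 by rewrite divr_ge0// sqr_ge0.
have a2 : 0 <= 64 * k4`!%:R / c3 ^+ k4 by apply: divr_ge0; [rewrite mulr_ge0|apply: exprn_ge0; exact: ltW].
have w4 : (s * v) ^+ 4 * expR (- (t * alpha Pi u v)) <=
    2 / c1 ^+ 2 + 64 * k4`!%:R / c3 ^+ k4.
  have [vu|uv] := leP v u.
    by apply: (le_trans (alpha_decay_le v0 vu)); rewrite lerDl.
  by apply: (le_trans (alpha_decay_ge (ltW uv))); rewrite lerDr.
apply: (@le_trans _ _ (expR (- (t * alpha Pi u v)) * (2 + 2 * (s * v) ^+ 4))).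
  by rewrite ler_wpM2l.
rewrite /K2; move: w4; set A := _ / _ + _; set B := (s * v) ^+ 4; nra.
Qed.

Let gaussian_decay (v : R) : gaussian s v <= 18 * (lorentz s v) ^+ 2.
Proof.
have lp : 0 < (1 + (s * v) ^+ 2) ^+ 2 by rewrite exprn_gt0// ltr_pwDl// sqr_ge0.
rewrite /lorentz exprVn ler_pdivlMr//.
have a0 : 0 <= (s * v) ^+ 2 / 2 by rewrite divr_ge0// sqr_ge0.
have g0 : 0 <= gaussian s v by exact: expR_ge0.
have g1 : gaussian s v <= 1 by exact: expRN_le1.
have := pow_expRN_le 2 a0; rewrite -/(gaussian s v) => h.
have w4 : (s * v) ^+ 4 * gaussian s v <= 8.
  have -> : (s * v) ^+ 4 * gaussian s v = 4 * (((s * v) ^+ 2 / 2) ^+ 2 * gaussian s v) by field.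
  have : 4 * (((s * v) ^+ 2 / 2) ^+ 2 * gaussian s v) <= 4 * 2 by rewrite ler_pM2l.
  lra.
apply: (@le_trans _ _ (gaussian s v * (2 + 2 * (s * v) ^+ 4))); first by rewrite ler_wpM2l.
by move: w4; set B := (s * v) ^+ 4; nra.
Qed.

(** Frequencies are cut at s v = W: Taylor expansion of the exponents below, separate decay of the
    two transforms above. *)
Lemma transform_difference (W z v : R) : 0 < W -> 0 <= v ->
  `|expR (- (t * alpha Pi u v)) * cos (v * z - t * beta b Pi u v) -
    gaussian s v * cos (v * (z - x))| <=
  (K1 * W ^+ 3 * (1 + W ^+ 2) / (s * u) + (K2 + 18) / (1 + W ^+ 2)) * lorentz s v.
Proof.
move=> W0 v0; have sv0 : 0 <= s * v by rewrite mulr_ge0// ltW.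
have w0 : 0 < 1 + (s * v) ^+ 2 by rewrite ltr_pwDl// sqr_ge0.
have W1 : 0 < 1 + W ^+ 2 by rewrite ltr_pwDl// sqr_ge0.
have su0 : 0 < s * u by rewrite mulr_gt0.
have K10 : 0 <= K1 by rewrite divr_ge0// ltW.
have l0 := lorentz_gt0 s v.
have A10 : 0 <= K1 * W ^+ 3 * (1 + W ^+ 2) / (s * u).
  apply: divr_ge0; last exact: ltW.
  apply: mulr_ge0; last exact: ltW.
  by apply: mulr_ge0 => //; apply: exprn_ge0; exact: ltW.
have A20 : 0 <= (K2 + 18) / (1 + W ^+ 2).
  by apply: divr_ge0; [have := K2_ge; lra|exact: ltW].
have [svW|Wsv] := leP (s * v) W.
  have a0 : 0 <= t * alpha Pi u v by rewrite mulr_ge0 ?alpha_ge0// ltW.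
  have a'0 : 0 <= (s * v) ^+ 2 / 2 by rewrite divr_ge0// sqr_ge0.
  apply: (le_trans (exp_cos_lipschitz _ _ a0 a'0)).
  have -> : v * z - t * beta b Pi u v - v * (z - x) = - (t * beta b Pi u v - v * x) by ring.
  rewrite normrN; apply: (le_trans (taylor v0)).
  (* [(1 + W ^+ 2) * lorentz s v] is at least 1 on this range, which turns a constant bound into a
     multiple of the integrable profile. *)
  apply: (@le_trans _ _ (K1 * W ^+ 3 * (1 + W ^+ 2) / (s * u) * lorentz s v)); last first.
    by rewrite ler_pM2r// lerDl.
  have -> : K1 * W ^+ 3 * (1 + W ^+ 2) / (s * u) * lorentz s v =
    K1 * (W ^+ 3 * ((1 + W ^+ 2) * lorentz s v)) / (s * u) by ring.
  rewrite ler_pM2r ?invr_gt0// ler_wpM2l//.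
  have h3 : (s * v) ^+ 3 <= W ^+ 3 by apply: lerXn2r => //; rewrite nnegrE// ltW.
  apply: (le_trans h3); rewrite ler_peMr ?exprn_ge0 ?(ltW W0)//.
  rewrite /lorentz ler_pdivlMr// mul1r lerD2l; apply: lerXn2r => //; rewrite nnegrE//.
  exact: ltW.
apply: (@le_trans _ _ ((K2 + 18) / (1 + W ^+ 2) * lorentz s v)); last by rewrite ler_pM2r// lerDr.
apply: (@le_trans _ _ ((K2 + 18) * (lorentz s v) ^+ 2)).
  apply: (le_trans (ler_normB _ _)); rewrite mulrDl; apply: lerD.
    apply: le_trans (decay v0); rewrite normrM (ger0_norm (expR_ge0 _)).
    by rewrite ler_piMr ?expR_ge0 ?cos_max.
  apply: le_trans (gaussian_decay v); rewrite normrM (ger0_norm (expR_ge0 _)).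
  by rewrite ler_piMr ?expR_ge0 ?cos_max.
rewrite expr2 mulrA ler_pM2r// ler_wpM2l//; first by have := K2_ge; lra.
rewrite /lorentz lef_pV2 ?posrE// lerD2l; apply: lerXn2r; rewrite ?nnegrE ?(ltW W0)//.
exact: ltW.
Qed.

Variable m : probability R R.
Hypothesis hm : has_laplace_transform b Pi m t.

(** The mass [pi / 2 / s] of the Lorentz profile cancels the factor [s / pi] of the inversion
    formula and leaves 1 / 2. *)
Lemma local_error (W z : R) : 0 < W ->
  `|s * tilted_density m u z * expR (t * psi b Pi u - u * z) -
    normal_pdf 0 1 ((z - x) / s)| <=
  (K1 * W ^+ 3 * (1 + W ^+ 2) / (s * u) + (K2 + 18) / (1 + W ^+ 2)) / 2.
Proof.
move=> W0; have p0 : 0 < pi :> R := pi_gt0 R.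
have rC := cos_transform_rapid hPi hSC t0 hm u0; have rS := sin_transform_rapid hPi hSC t0 hm u0.
pose h v := expR (- (t * alpha Pi u v)) * cos (v * z - t * beta b Pi u v).
have hE v : h v = expR (t * psi b Pi u) *
    (cos_transform m u v * cos (v * z) + sin_transform m u v * sin (v * z)).
  have [-> ->] := trig_transformE hPi hm v u0.
  have ee : expR (t * psi b Pi u) * expR (- (t * psi b Pi u)) = 1 by rewrite expRxMexpNx_1.
  rewrite /h cosB; transitivity ((expR (t * psi b Pi u) * expR (- (t * psi b Pi u))) *
    (expR (- (t * alpha Pi u v)) * (cos (v * z) * cos (t * beta b Pi u v) +
     sin (v * z) * sin (t * beta b Pi u v)))); first by rewrite ee mul1r.
  ring.
have ih : leb.-integrable H (EFin \o h).
  rewrite (funext hE); apply: integrable_scale => //; exact: osc_integrable.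
have ig : leb.-integrable H (EFin \o (fun v => gaussian s v * cos (v * (z - x)))).
  by apply: rapid_mul_integrable;
    [exact: gaussian_rapid|measurability|move=> v _; exact: cos_max].
have -> : s * tilted_density m u z * expR (t * psi b Pi u - u * z) =
    s / pi * \int[leb]_(v in H) h v.
  have -> : \int[leb]_(v in H) h v =
      expR (t * psi b Pi u) * osc (cos_transform m u) (sin_transform m u) z.
    rewrite /osc -RintegralZl//; last exact: osc_integrable.
    by apply: eq_Rintegral => v _; rewrite hE.
  rewrite /tilted_density expRD.
  have ee : expR (u * z) * expR (- (u * z)) = 1 by rewrite expRxMexpNx_1.
  set A := osc _ _ _; set B := expR (t * _).
  transitivity (s / pi * (B * A) * (expR (u * z) * expR (- (u * z)))); last by rewrite ee mulr1.
  ring.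
rewrite -normal_pdf_transform// -mulrBr normrM (gtr0_norm (divr_gt0 s0 p0)).
set A := K1 * _ * _ / _ + _.
have hd : `|\int[leb]_(v in H) h v - \int[leb]_(v in H) (gaussian s v * cos (v * (z - x)))|
    <= \int[leb]_(v in H) (A * lorentz s v).
  apply: Rintegral_dist_le => //.
  - by apply: integrable_scale => //; exact: lorentz_integrable.
  - by move=> v /in_half_line v0; exact: transform_difference.
apply: (le_trans (ler_wpM2l (ltW (divr_gt0 s0 p0)) hd)).
rewrite RintegralZl//; last exact: lorentz_integrable.
rewrite {1}/Rintegral lorentz_integral//=.
have sn : s != 0 by rewrite gt_eqF.
have pn : pi != 0 :> R by rewrite gt_eqF.
have key (a p : R) : p != 0 -> s / p * (a * (p / 2 / s)) = a / 2 by move=> p0n; field; rewrite sn p0n.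
by rewrite key.
Qed.

End LocalError.

(** * The large parameter in the two regimes *)

Section Regimes.
Context {R : realType} (b : R) (Pi : {measure set R -> \bar R}).
Hypothesis hPi : levy_measure Pi.
Hypothesis hSC : stochastically_compact0 Pi.
Variables (C y0 : R) (N : nat).
Hypothesis C0 : 0 < C.
Hypothesis UV : forall y, 0 < y < y0 -> Umoment Pi y <= C * Vmoment Pi y.
Hypothesis qpow : forall y z, 0 < y -> y <= z -> z < y0 ->
  z / (2 * y) * Qmoment Pi z ^+ N.+1 <= Qmoment Pi y ^+ N.+1.

Local Notation q := (Qmoment Pi).
Local Notation D0 := (`]0%R, +oo[%classic : set R).

Let mD0 : measurable D0. Proof. exact: measurable_itv. Qed.

Lemma Qmoment_gt0 (z : R) : 0 < z -> 0 < q z.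
Proof.
move=> z0; rewrite mulr_gt0 ?invr_gt0 ?exprn_gt0//.
exact: lt_le_trans (sc_Vmoment_gt0 hSC z0) (Vmoment_le_Umoment hPi z0).
Qed.

Lemma local_error_small (e : R) : 0 < e -> exists M0 : R,
  forall (m : probability R R) (t u z : R), 0 < t -> 0 < u -> u^-1 < y0 ->
    has_laplace_transform b Pi m t -> M0 <= t * q u^-1 ->
  `|Num.sqrt t * sigma Pi u * tilted_density m u z * expR (t * psi b Pi u - u * z) -
    normal_pdf 0 1 ((z - t * dpsi b Pi u) / (Num.sqrt t * sigma Pi u))| <= e.
Proof.
move=> e0.
pose K1 : R := 12 / (expR (-1) / C).
pose c1 : R := expR (-1) / (16 * C); pose c3 : R := expR (-1) / (8 * C).
pose k4 : nat := (N.+1 * 4)%N.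
pose K2 : R := 2 + 2 * (2 / c1 ^+ 2 + 64 * k4`!%:R / c3 ^+ k4).
have E0 : 0 < expR (-1) / C by rewrite divr_gt0 ?expR_gt0.
have K10 : 0 < K1 by rewrite divr_gt0.
(* W makes the term [(K2 + 18) / (1 + W ^+ 2)] at most e; B below is the size of s u that does the
   same for the Taylor term. *)
pose W := 1 + `|K2 + 18| / e.
have W0 : 0 < W by rewrite ltr_pwDl// divr_ge0// ltW.
have W1 : 1 <= W by rewrite lerDl divr_ge0// ltW.
pose B := K1 * W ^+ 3 * (1 + W ^+ 2) / e.
have W2 : 0 < 1 + W ^+ 2 by rewrite ltr_pwDl// sqr_ge0.
have B0 : 0 < B.
  by apply: divr_gt0 => //; apply: mulr_gt0 => //; apply: mulr_gt0 => //; exact: exprn_gt0.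
(* The 1 meets the premise [1 <= t * q u^-1]; the other term forces [B <= s * u] through
   [scale_mul_ge]. *)
exists (1 + B ^+ 2 / (expR (-1) / C)) => m t u z t0 u0 uy hm hM.
have M1 : 1 <= t * q u^-1.
  by apply: le_trans hM; rewrite lerDl divr_ge0 ?sqr_ge0// ltW.
set s := Num.sqrt t * sigma Pi u.
have s0 : 0 < s by exact: (scale_gt0 hPi hSC C0 UV t0 u0 uy).
have su : B <= s * u.
  have h1 := scale_mul_ge hPi hSC C0 UV t0 u0 uy; rewrite -/s in h1.
  have h2 : B ^+ 2 <= (s * u) ^+ 2.
    apply: le_trans h1; rewrite mulrC -ler_pdivrMr//.
    by apply: le_trans hM; rewrite lerDr.
  rewrite -(ler_pXn2r (n := 2))// nnegrE.
    exact: ltW.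
  exact/ltW/mulr_gt0.
apply: (le_trans (local_error hPi hSC C0 UV qpow t0 u0 uy M1 hm z W0)).
rewrite -/s -/K1 -/c1 -/c3 -/k4 -/K2.
have h1 : K1 * W ^+ 3 * (1 + W ^+ 2) / (s * u) <= e.
  rewrite (ler_pdivrMr _ _ (mulr_gt0 s0 u0)).
  have -> : K1 * W ^+ 3 * (1 + W ^+ 2) = e * B by rewrite /B; field; rewrite gt_eqF.
  by rewrite ler_pM2l.
have h2 : (K2 + 18) / (1 + W ^+ 2) <= e.
  rewrite ler_pdivrMr//; apply: (le_trans (ler_norm _)).
  have -> : `|K2 + 18| = e * (W - 1) by rewrite /W; field; rewrite gt_eqF.
  by rewrite ler_pM2l//; nra.
lra.
Qed.

Lemma levy_y_near0_integrable (c : R) : 0 < c ->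
  Pi.-integrable (`]0, c[%classic : set R) (EFin \o (fun y => y)).
Proof.
move=> c0; have h : Pi.-integrable D0 (EFin \o (fun y => Num.min y c)).
  apply: (@levy_integrable _ _ hPi _ (1 + c)); first by measurability.
  move=> y yp; have m0 : 0 <= Num.min y c by rewrite le_min !ltW.
  by rewrite ger0_norm//; have [yc|cy] := leP y c; have [y1|y1] := leP y 1; nra.
have := integrableS mD0 (measurable_itv _) (@sub_D0 _ c) h.
apply: eq_integrable => // y /set_mem /=; rewrite in_itv/= => /andP[_ yc].
by rewrite min_l// ltW.
Qed.

(** Jumps below c contribute [y (1 - exp(-uy)) <= u y^2], and the larger ones only lower the left
    side. *)
Lemma drift_sub_dpsi_le (u c : R) : 0 < u -> 0 < c ->
  b + \int[Pi]_(y in `]0, c[) y - dpsi b Pi u <= u * Vmoment Pi c.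
Proof.
move=> u0 c0; rewrite /dpsi opprD addrACA subrr add0r.
have mc : measurable (`]0, c[%classic : set R) by exact: measurable_itv.
have iy := levy_y_integrable hPi u0; have i1 := levy_y_near0_integrable c0.
have iV := Vmoment_integrable hPi c0.
have sub : \int[Pi]_(y in `]0, c[) (y * expR (- (u * y))) <=
    \int[Pi]_(y in `]0, +oo[) (y * expR (- (u * y))).
  apply: Rintegral_subset => //; first exact: sub_D0.
  by move=> y /in_D0 yp; rewrite mulr_ge0 ?expR_ge0 ?ltW.
have iyc := integrableS mD0 mc (@sub_D0 _ c) iy.
apply: (@le_trans _ _ (\int[Pi]_(y in `]0, c[) (y - y * expR (- (u * y))))).
  by rewrite RintegralB// lerD2l lerN2.
rewrite /Vmoment -RintegralZl//; apply: le_Rintegral => //.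
- exact: integrable_sub.
- exact: integrable_scale.
- move=> y; rewrite /= in_itv/= => /andP[yp _].
  have -> : u * y ^+ 2 = y * (u * y) by ring.
  have -> : y - y * expR (- (u * y)) = y * (1 - expR (- (u * y))) by ring.
  by rewrite ler_pM2l// onem_expRN_le.
Qed.

Let UE (c : R) : 0 < c -> Umoment Pi c = c ^+ 2 * q c.
Proof. by move=> c0; rewrite /q mulrA divff ?mul1r// expf_neq0// gt_eqF. Qed.

(* The scale [cfun t] dominates [1 / u] at the saddlepoint [u] of [x / t]. *)
Lemma cfun_mul_ge_bfun (t u : R) : 0 < t -> 0 < u -> 0 < cfun Pi t ->
  t * q (cfun Pi t) = 1 ->
  - ((t * dpsi b Pi u - bfun b Pi t) / cfun Pi t) <= u * cfun Pi t.
Proof.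
set c := cfun Pi t => t0 u0 c0 tq; rewrite -mulNr ler_pdivrMr// opprB /bfun -/c -mulrBr.
apply: (@le_trans _ _ (t * (u * Vmoment Pi c))).
  by rewrite ler_pM2l// drift_sub_dpsi_le.
apply: (@le_trans _ _ (t * (u * (c ^+ 2 * q c)))).
  by rewrite ler_pM2l// ler_pM2l// -UE// Vmoment_le_Umoment.
have -> : t * (u * (c ^+ 2 * q c)) = u * c * c * (t * q c) by ring.
by rewrite tq mulr1.
Qed.

(** If u c < L, then [dpsi_ge] at scale c, compactness and [t q(c) = 1] bound the quotient below by
    [exp(-L) / C]. This is the form suited to the case where (N) holds. *)
Lemma cfun_mul_ge_drift (t u L : R) : 0 < t -> 0 < u -> 0 < cfun Pi t -> cfun Pi t < y0 ->
  t * q (cfun Pi t) = 1 ->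
  (t * dpsi b Pi u - b * t) / cfun Pi t < expR (- L) / C -> L <= u * cfun Pi t.
Proof.
set c := cfun Pi t => t0 u0 c0 cy tq hlt; rewrite leNgt; apply/negP => ucL.
move: hlt; rewrite ltNge => /negP; apply.
rewrite ler_pdivlMr// (mulrC b) -mulrBr.
apply: (@le_trans _ _ (t * (expR (- (u * c)) / c * Vmoment Pi c))); last first.
  by rewrite ler_pM2l// dpsi_ge.
have hU : Umoment Pi c / C <= Vmoment Pi c by rewrite ler_pdivrMr// mulrC UV// c0.
apply: (@le_trans _ _ (t * (expR (- L) / c * (Umoment Pi c / C)))).
  rewrite UE//; have -> : t * (expR (- L) / c * (c ^+ 2 * q c / C)) =
    expR (- L) / C * c * (t * q c) by field; rewrite !gt_eqF.
  by rewrite tq mulr1.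
rewrite ler_pM2l//; apply: ler_pM => //.
- by rewrite divr_ge0 ?expR_ge0// ltW.
- by rewrite divr_ge0 ?Umoment_ge0// ltW.
- by rewrite ler_pM2r ?invr_gt0// ler_expR lerN2 ltW.
Qed.

Lemma cfun_lt (e t : R) : 0 < e -> 0 < t -> t < (q e)^-1 -> 0 < cfun Pi t ->
  t * q (cfun Pi t) = 1 -> cfun Pi t < e.
Proof.
move=> e0 t0 te c0 tq; rewrite ltNge; apply/negP => ec.
have h := Qmoment_le hPi e0 ec; have qe := Qmoment_gt0 e0.
have : t * q (cfun Pi t) < 1.
  apply: (@le_lt_trans _ _ (t * q e)); first by rewrite ler_pM2l.
  by rewrite -ltr_pdivlMr// mul1r.
by rewrite tq ltxx.
Qed.

(** Multiplied by [t ^+ N.+1], the growth of q from c down to 1 / u reads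
    [u c / 2 <= (t q(1/u))^(N+1)], because [t q(c) = 1]. *)
Lemma Qmoment_at_cfun (t u M : R) : 0 < t -> 0 < u -> 0 < cfun Pi t -> cfun Pi t < y0 ->
  t * q (cfun Pi t) = 1 -> 1 <= M -> 2 * M ^+ N.+1 <= u * cfun Pi t -> M <= t * q u^-1.
Proof.
set c := cfun Pi t => t0 u0 c0 cy tq M1 hM.
have MN : 1 <= M ^+ N.+1 by rewrite exprn_ege1.
have ui : 0 < u^-1 by rewrite invr_gt0.
have uc : u^-1 <= c.
  by rewrite -(ler_pM2l u0) divff ?gt_eqF//; lra.
have h := qpow ui uc cy.
have tqu : 0 <= t * q u^-1 by rewrite mulr_ge0 ?Qmoment_ge0// ltW.
rewrite -(ler_pXn2r (n := N.+1))// ?nnegrE//; last by rewrite (le_trans ler01).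
apply: (@le_trans _ _ (u * c / 2)); first by rewrite ler_pdivlMr// mulrC.
rewrite exprMn; apply: (@le_trans _ _ (t ^+ N.+1 * (c / (2 * u^-1) * q c ^+ N.+1))).
  have -> : t ^+ N.+1 * (c / (2 * u^-1) * q c ^+ N.+1) =
      u * c / 2 * (t * q c) ^+ N.+1.
    have key (x y : R) : x * (c / (2 * u^-1) * y) = u * c / 2 * (x * y).
      by field; rewrite gt_eqF.
    by rewrite key -exprMn.
  by rewrite tq expr1n mulr1.
by rewrite ler_wpM2l// exprn_ge0// ltW.
Qed.

End Regimes.

(** * The law of the subordinator *)

Section SubordinatorLaw.
Context d (T : measurableType d) (R : realType) (P : probability T R).
Variables (X : R -> {RV P >-> R}) (b : R) (Pi : {measure set R -> \bar R}).
Hypothesis hX : subordinator X.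
Hypothesis hpsi : forall t u : R, 0 < t -> 0 <= u -> laplace_exponent X t u = psi b Pi u.

Local Notation D1 := (`[0%R, +oo[%classic : set R).

Lemma subordinator_ge0 (t : R) : 0 <= t -> {ae P, forall w, 0 <= X t w}.
Proof.
move=> t0; have := sub_start hX; have := sub_nondecreasing hX.
by apply: filterS2 => w mono start; rewrite -start mono.
Qed.

Lemma law_negative (t : R) : 0 <= t -> distribution P (X t) (`]-oo, 0%R[%classic) = 0%E.
Proof.
move=> t0; have [N [mN PN sN]] := subordinator_ge0 t0.
apply/eqP; rewrite -measure_le0 -PN /distribution /pushforward.
have mY : measurable (X t @^-1` `]-oo, 0%R[%classic).
  by rewrite -[Y in measurable Y]setTI; exact: (@measurable_funPT _ _ _ _ (X t)).
rewrite -[leLHS]/(P _); apply: (le_measure P); rewrite ?inE//.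
by move=> w /= h; apply: sN => /= hw; move: h; rewrite in_itv/= ltNge hw.
Qed.

Lemma law_half_line (m : probability R R) (g : R -> \bar R) : m (`]-oo, 0%R[%classic) = 0%E ->
  measurable_fun setT g -> (forall y, (0 <= g y)%E) ->
  (\int[m]_y g y = \int[m]_(y in D1) g y)%E.
Proof.
move=> m0 mg g0.
have mN : measurable (`]-oo, 0%R[%classic : set R) by exact: measurable_itv.
rewrite (@ge0_negligible_integral _ _ _ m setT `]-oo, 0%R[%classic)//.
congr (integral _ _ _); rewrite setTD; apply/seteqP; split=> x /=; rewrite !in_itv/= andbT.
  by rewrite ltNge => /negP; rewrite negbK.
by move=> x0; rewrite ltNge x0.
Qed.

Lemma subordinator_laplace (t : R) : 0 < t ->
  has_laplace_transform b Pi (distribution P (X t)) t.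
Proof.
move=> t0; split; first exact/law_negative/ltW.
move=> u u0; set m := distribution P (X t) : probability R R.
have m0 : m (`]-oo, 0%R[%classic) = 0%E by exact/law_negative/ltW.
have mf : measurable_fun setT (fun y : R => (expR (- (u * y)))%:E).
  by apply/measurable_EFinP; measurability.
have EE : ('E_P[fun w => expR (- u * X t w)] = \int[m]_(y in D1) (expR (- (u * y)))%:E)%E.
  have f0 (y : R) : (0 <= (expR (- (u * y)))%:E)%E by rewrite lee_fin expR_ge0.
  rewrite -(law_half_line m0 mf f0) /m ge0_integral_distribution//.
  by rewrite unlock; apply: eq_integral => w _ /=; rewrite mulNr.
have := hpsi t0 u0; rewrite /laplace_exponent EE -/(Rintegral m _ _).
set e := Rintegral _ _ _ => he.
(* [lnK] needs a positive argument: e = 0 would make exp(-ux) vanish almost everywhere on [0, +oo[,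
   which carries the whole mass. *)
have e0 : 0 < e.
  rewrite lt_neqAle Rintegral_ge0 ?andbT; last by move=> *; exact: expR_ge0.
  apply/eqP => e0; have i1 : m.-integrable D1 (EFin \o (fun y => expR (- (u * y)))).
    apply: (@law_integrable _ _ _ 1); first by measurability.
    by move=> x x0; rewrite ger0_norm ?expR_ge0 ?expRN_le1 ?mulr_ge0.
  have z : (\int[m]_(y in D1) `|(expR (- (u * y)))%:E| = 0)%E.
    under eq_integral do rewrite abse_EFin ger0_norm ?expR_ge0//.
    transitivity e%:E; last by rewrite -e0.
    by rewrite /e /Rintegral fineK//; exact: integrable_fin_num.
  have /ae_eq_integral_abs := z; case=> //; first exact: measurable_funTS.
  move=> N [mN N0 sN].
  have : (m D1 <= 0)%E.
    rewrite -N0; apply: le_measure; rewrite ?inE//.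
    by move=> y yp; apply: sN => /(_ yp) [] /eqP; rewrite gt_eqF// expR_gt0.
  have mT : (m setT = m D1)%E.
    have -> : setT = `]-oo, 0%R[%classic `|` D1 :> set R.
      by apply/seteqP; split=> // x _ /=; rewrite !in_itv/= andbT; case: (ltP x 0); [left|right].
    transitivity (m `]-oo, 0%R[%classic + m D1)%E; last by rewrite m0 add0e.
    apply: (measureU m) => //; apply/seteqP; split=> // x [/=].
    by rewrite !in_itv/= andbT ltNge => /negP.
  by rewrite -mT (probability_setT m) lee_fin ler10.
have <- : ln e = - (t * psi b Pi u) by rewrite -he; field; rewrite gt_eqF.
by rewrite lnK.
Qed.

Lemma subordinator_mean_le (s : R) : levy_measure Pi ->
  (forall u, 0 < u -> dpsi b Pi u <= s) -> ('E_P[X 1] <= s%:E)%E.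
Proof.
move=> hPi ds; set m := distribution P (X 1) : probability R R.
have hm : has_laplace_transform b Pi m 1 by exact: subordinator_laplace.
rewrite -[s in leRHS]mul1r; apply: le_trans (law_mean_le hPi hm ler01 ds).
(* [X 1] is nonnegative only almost surely, and the change of variables is for nonnegative
   integrands; hence the positive part. *)
have mX : measurable_fun setT (fun y : R => (Num.max y 0)%:E).
  apply/measurable_EFinP; exact: measurable_maxr.
have -> : ('E_P[X 1] = \int[P]_w ((fun y : R => (Num.max y 0)%:E) \o X 1) w)%E.
  rewrite unlock; apply: ae_eq_integral => //.
  - exact/measurable_EFinP.
  - exact: measurableT_comp.
  - apply: filterS (subordinator_ge0 ler01) => w w0 _ /=.
    by rewrite max_l.
rewrite -ge0_integral_distribution//; last by move=> y; rewrite lee_fin le_max lexx orbT.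
rewrite -/m (law_half_line (m := m)) //; first last.
- by move=> y; rewrite lee_fin le_max lexx orbT.
- exact: (proj1 hm).
rewrite le_eqVlt; apply/orP; left; apply/eqP; apply: eq_integral => y /set_mem /in_D1 y0.
by rewrite max_l.
Qed.

End SubordinatorLaw.

(** * Uniform local estimates *)

Section LocalEstimates.
Context d (T : measurableType d) (R : realType) (P : probability T R).
Variables (X : R -> {RV P >-> R}) (b : R) (Pi : {measure set R -> \bar R}).
Hypothesis hX : subordinator X.
Hypothesis hPi : levy_measure Pi.
Hypothesis hpsi : forall t u : R, 0 < t -> 0 <= u -> laplace_exponent X t u = psi b Pi u.
Hypothesis hSC : stochastically_compact0 Pi.

Local Notation q := (Qmoment Pi).
Local Notation law t := (distribution P (X t) : probability R R).

Let law_rapid (t u : R) : 0 < t -> 0 < u ->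
  rapid (cos_transform (law t) u) /\ rapid (sin_transform (law t) u).
Proof.
move=> t0 u0; have hm := subordinator_laplace hX hpsi t0.
by
  split; [exact: (cos_transform_rapid hPi hSC t0 hm u0)|exact: (sin_transform_rapid hPi hSC t0 hm u0)].
Qed.

Lemma smooth_density_exists (t : R) : 0 < t ->
  exists ft : R -> R, smooth ft /\ is_density ft (X t).
Proof.
move=> t0; have [rC rS] := law_rapid t0 ltr01.
have m0 := law_negative hX (ltW t0).
exists (tilted_density (law t) 1); split; first exact: tilted_density_smooth.
split; first by move=> y; apply: tilted_density_ge0.
by move=> B mB; apply: (tilted_densityP ltr01 m0).
Qed.

Lemma smooth_density_unique (t u : R) (f : R -> R) : 0 < t -> 0 < u ->
  smooth f -> is_density f (X t) -> f = tilted_density (law t) u.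
Proof.
move=> t0 u0 sf [f0 fP]; have [rC rS] := law_rapid t0 u0.
have m0 := law_negative hX (ltW t0).
apply: (density_unique u0 m0 rC rS) => // x.
by apply/differentiable_continuous/derivable1_diffP; exact: (sf 0%N x).
Qed.

Variable A : R -> set R.
Hypothesis hA : forall t x : R, 0 < t -> A t x ->
  (b%:E < (x / t)%:E)%E /\ ((x / t)%:E < 'E_P[X 1%R])%E.

(** If no [dpsi u] exceeded x / t, the mean would be at most x / t by [subordinator_mean_le]. The
    comparison is made in the extended reals, so an infinite mean is covered. *)
Lemma saddlepoint (t x : R) : 0 < t -> A t x ->
  0 < rho b Pi (x / t) /\ dpsi b Pi (rho b Pi (x / t)) = x / t.
Proof.
move=> t0 Ax; have [bx xE] := hA t0 Ax; rewrite lte_fin in bx.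
have [u [u0 xu]] : exists u, 0 < u /\ x / t < dpsi b Pi u.
  apply: contrapT => h; move: xE; rewrite ltNge => /negP; apply.
  apply: (subordinator_mean_le hX hpsi hPi) => u u0.
  by rewrite leNgt; apply/negP => xu; apply: h; exists u.
exact: (rho_spec hPi bx u0 xu).
Qed.

(** A regime enters only by making rho and [t q(1/rho)] exceed any bounds uniformly over [A t]: the
    first brings 1 / rho below the range [y0] of the compactness estimates, the second makes the
    error small. *)
Lemma local_estimate_near (F : set_system R) (f : R -> R -> R) : Filter F ->
  (forall t : R, 0 < t -> smooth (f t) /\ is_density (f t) (X t)) ->
  (forall M K : R, \forall t \near F, 0 < t /\
     forall x, A t x -> K < rho b Pi (x / t) /\ M <= t * q (rho b Pi (x / t))^-1) ->
  local_estimate b Pi f F A.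
Proof.
move=> FF hf hlim; have [C [y0 [N [C0 y00 UV qpow]]]] := sc_regular hPi hSC.
pose sc t x := Num.sqrt t * sigma Pi (rho b Pi (x / t)).
pose g t x z := sc t x * f t z *
  expR (t * psi b Pi (rho b Pi (x / t)) - rho b Pi (x / t) * z).
(* The remainder is read off the identity to be proved; its uniform smallness is what
   [local_error_small] provides. *)
exists (fun t p => g t p.1 p.2 - normal_pdf 0 1 ((p.2 - p.1) / sc t p.1)); split.
  move=> U /nbhs_ballP[e /= e0 eU].
  have e20 : 0 < e / 2 by rewrite divr_gt0.
  have [M hM] := local_error_small b hPi hSC C0 UV qpow e20.
  apply: filterS (hlim M y0^-1) => t [t0 ht] [x z] [/= Ax _].
  have [Kr Mr] := ht x Ax; have [r0 dr] := saddlepoint t0 Ax.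
  apply: eU; rewrite /ball/= sub0r normrN.
  apply: (@le_lt_trans _ _ (e / 2)); last by rewrite ltr_pdivrMr// ltr_pMr// ltr1n.
  have rN : (rho b Pi (x / t))^-1 < y0.
    by rewrite -[ltRHS]invrK ltf_pV2 ?posrE// invr_gt0.
  have := hM (law t) t _ z t0 r0 rN (subordinator_laplace hX hpsi t0) Mr.
  have [sf df] := hf t t0.
  by rewrite -(smooth_density_unique t0 r0 sf df) dr mulrCA divff ?mulr1// gt_eqF.
move=> t x z t0 Ax _ /=; rewrite addrC subrK /g -/(sc t x).
have [r0 dr] := saddlepoint t0 Ax.
set r := rho _ _ _ in r0 dr *.
rewrite -!mulrA -!expRD.
(* [t H(r) = t psi(r) - r x] at the saddlepoint, where [psi'(r) = x / t]. *)
have -> : t * psi b Pi r - r * z + (- (t * Hfun b Pi r) + r * (z - x)) = 0.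
  have dpsiE : derive1 (psi b Pi) r = x / t.
    by rewrite derive1E -dr; apply: derive_val; exact: is_derive_psi.
  by rewrite /Hfun dpsiE; field; rewrite gt_eqF.
by rewrite expR0 mulr1.
Qed.

(** [dpsi] is nonincreasing and strictly above b at [K1], V being positive; x / t close enough to b
    thus forces rho beyond [K1]. *)
Lemma saddlepoint_large (F : set_system R) (K : R) : Filter F ->
  unif_cvg F A (fun t x => x / t) (nbhs b) ->
  \forall t \near F, 0 < t -> forall x, A t x -> K < rho b Pi (x / t).
Proof.
move=> FF hcv; pose K1 := 1 + `|K|.
have K10 : 0 < K1 by rewrite ltr_pwDl.
have KK1 : K < K1 by rewrite (le_lt_trans (ler_norm K))// ltrDr.
have hU : nbhs b [set s | s < dpsi b Pi K1].
  apply: lt_nbhsl; exact: (dpsi_gt b hPi K10 ltr01 (sc_Vmoment_gt0 hSC ltr01)).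
apply: filterS (hcv _ hU) => t ht t0 x Ax; have [r0 dr] := saddlepoint t0 Ax.
rewrite ltNge; apply/negP => rK; have := ht x Ax; rewrite /= -dr ltNge => /negP; apply.
by apply: (dpsi_le b hPi r0); rewrite (le_trans rK)// ltW.
Qed.

(** As rho exceeds [K1] and q is nonincreasing, [q (1/rho)] is at least the positive constant
    [q (1/K1)], and t alone supplies the growth. *)
Lemma local_estimate_infinity (f : R -> R -> R) :
  (forall t : R, 0 < t -> smooth (f t) /\ is_density (f t) (X t)) ->
  SC0_I b A -> local_estimate b Pi f (pinfty_nbhs R) A.
Proof.
move=> hf hI; apply: local_estimate_near => // M K; pose K1 := Num.max K 1.
have K10 : 0 < K1 by rewrite lt_max ltr01 orbT.
have q0 := Qmoment_gt0 hPi hSC (z := K1^-1); rewrite invr_gt0 in q0; have {}q0 := q0 K10.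
near=> t.
have t0 : 0 < t by near: t; exact: nbhs_pinfty_gt.
have tM : M / q K1^-1 <= t by near: t; apply: nbhs_pinfty_ge; exact: num_real.
split=> // x Ax.
have Kr : K1 < rho b Pi (x / t).
  by move: x Ax; move: t0; near: t; exact: (@saddlepoint_large (pinfty_nbhs R) K1 _ hI).
split; first by apply: le_lt_trans Kr; rewrite le_max lexx.
rewrite ler_pdivrMr// in tM; apply: (le_trans tM); rewrite ler_pM2l//.
have r0 := lt_trans K10 Kr.
by apply: Qmoment_le => //; [rewrite invr_gt0|rewrite lef_pV2 ?posrE ?(ltW Kr)].
Unshelve. all: by end_near. Qed.

Lemma local_estimate_zero (f : R -> R -> R) :
  (forall t : R, 0 < t -> smooth (f t) /\ is_density (f t) (X t)) ->
  SC0_II b Pi A -> local_estimate b Pi f 0^'+ A.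
Proof.
move=> hf [hII hcase]; apply: local_estimate_near => // M K.
have [C [y0 [N [C0 y00 UV qpow]]]] := sc_regular hPi hSC.
have [t1 t10 hc] := cfun_spec hPi hSC.
have q0 := Qmoment_gt0 hPi hSC y00.
(* [L] is the threshold on [rho * cfun Pi t] in [Qmoment_at_cfun], which also asks for a bound of at
   least 1. *)
pose M1 := Num.max M 1; pose L := 2 * M1 ^+ N.+1.
have scale_large : \forall t \near 0^'+, 0 < t -> 0 < cfun Pi t -> cfun Pi t < y0 ->
    t * q (cfun Pi t) = 1 -> forall x, A t x -> L <= rho b Pi (x / t) * cfun Pi t.
  have xE t x : 0 < t -> A t x -> x = t * dpsi b Pi (rho b Pi (x / t)).
    move=> t0 Ax; have [_ ->] := saddlepoint t0 Ax.
    by rewrite mulrCA divff ?mulr1// gt_eqF.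
  (* Both normalizations of x, going to -oo without (N) and to 0 with (N), force rho c(t) beyond
     [L]. *)
  case: hcase => -[_ hcv].
    have hU : ninfty_nbhs R [set s | s < - L] by apply: nbhs_ninfty_lt; exact: num_real.
    apply: filterS (hcv _ hU) => t ht t0 c0 cy tq x Ax; have [r0 _] := saddlepoint t0 Ax.
    apply: le_trans (cfun_mul_ge_bfun b hPi t0 r0 c0 tq).
    by rewrite lerNr -xE// ltW// ht.
  have hU : nbhs (0 : R) [set s | s < expR (- L) / C].
    by apply: lt_nbhsl; rewrite divr_gt0 ?expR_gt0.
  apply: filterS (hcv _ hU) => t ht t0 c0 cy tq x Ax; have [r0 _] := saddlepoint t0 Ax.
  by apply: (cfun_mul_ge_drift (b := b) hPi C0 UV t0 r0 c0 cy tq); rewrite -xE//; exact: ht.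
near=> t.
have t0 : 0 < t by near: t; exact: nbhs_right_gt.
have tt1 : t < t1 by near: t; exact: nbhs_right_lt.
have tq0 : t < (q y0)^-1 by near: t; apply: nbhs_right_lt; rewrite invr_gt0.
have [c0 tq] : 0 < cfun Pi t /\ t * q (cfun Pi t) = 1 by apply: hc; rewrite t0.
have cy := cfun_lt hPi hSC y00 t0 tq0 c0 tq.
split=> // x Ax; split; first by move: x Ax; move: t0; near: t; exact: (@saddlepoint_large 0^'+ K _ hII).
have [r0 _] := saddlepoint t0 Ax.
apply: (@le_trans _ _ M1); first by rewrite le_max lexx.
apply: (Qmoment_at_cfun qpow t0 r0 c0 cy tq); first by rewrite le_max lexx orbT.
move: x Ax {r0}; move: tq; move: cy; move: c0; move: t0 {tt1 tq0}; near: t.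
exact: scale_large.
Unshelve. all: by end_near. Qed.

End LocalEstimates.

Theorem theorem1 (d : measure_display) (T : measurableType d) (R : realType)
  (P : probability T R) (X : R -> {RV P >-> R})
  (b : R) (Pi : {measure set R -> \bar R})
  (hX : subordinator X) (hb : 0 <= b) (hPi : levy_measure Pi)
  (hpsi : forall t u : R, 0 < t -> 0 <= u ->
     laplace_exponent X t u = psi b Pi u) :
  (stochastically_compact0 Pi ->
   forall t : R, 0 < t ->
     exists ft : R -> R, smooth ft /\ is_density ft (X t))
  /\
  (stochastically_compact0 Pi ->
   forall f : R -> R -> R,
     (forall t : R, 0 < t -> smooth (f t) /\ is_density (f t) (X t)) ->
   forall A : R -> set R,
     (forall t x : R, 0 < t -> A t x ->
        (b%:E < (x / t)%:E)%E /\ ((x / t)%:E < 'E_P[X 1%R])%E) ->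
     (SC0_I b A -> local_estimate b Pi f (pinfty_nbhs R) A) /\
     (SC0_II b Pi A -> local_estimate b Pi f 0^'+ A)).
Proof.
split=> [hSC t t0|hSC f hf A hA]; first exact: (smooth_density_exists hX hPi hpsi hSC).
split; first exact: (local_estimate_infinity hX hPi hpsi hSC hA hf).
exact: (local_estimate_zero hX hPi hpsi hSC hA hf).
Qed.
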